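(* Let $q\ge 2$ be an integer, let $X$ be a $q$-homogeneous tree with origin $o$, let $\alpha>1$, and let $L^p_\alpha$, $H^1_\alpha$, ${\rm BMO}_\alpha$ and the complex interpolation spaces $(A_0,A_1)_{[\theta]}$ be as defined in the context. Then the following hold. (i) If $\theta\in(0,1)$ and $1<p_1<p<\infty$ are such that $\frac1p=\frac{1-\theta}{p_1}$, then $(L^{p_1}_\alpha,{\rm BMO}_\alpha)_{[\theta]}=L^p_\alpha$. (ii) If $\theta\in(0,1)$ and $1<p<p_1<\infty$ are such that $\frac1p=1-\theta+\frac{\theta}{p_1}$, then $(H^1_\alpha,L^{p_1}_\alpha)_{[\theta]}=L^p_\alpha$. Equality of spaces is understood as equality of vector spaces with equivalent norms.
   Context: Tree. $X$ is a $q$-homogeneous tree ($q\ge2$): a connected, loop-free graph in which every vertex has exactly $q+1$ neighbours; $X$ also denotes its set of vertices, and $d$ is the graph distance. Fix an origin $o\in X$ and put $|x|=d(o,x)$. For $x\ne o$, the predecessor $p(x)$ is the unique neighbour of $x$ with $|p(x)|=|x|-1$. The sector of $x\in X$ is $T_x=\{y\in X: p^\ell(y)=x\text{ for some integer }\ell\ge0\}$ (so $x\in T_x$ and $T_o=X$). Measure. For $\alpha>1$, $\mu_\alpha$ is the (finite) measure on $X$ with $\mu_\alpha(\{x\})=q^{-\alpha|x|}$, and $L^p_\alpha=L^p(X,\mu_\alpha)$ with norm $\|\cdot\|_{p,\alpha}$ (complex-valued functions). Dyadic sets. $\mathcal D=\{\{v\}: v\in X\}\cup\{T_v: v\in X\}$.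 For a function $f$ and $D\in\mathcal D$, $f_D=\frac1{\mu_\alpha(D)}\sum_{x\in D}f(x)q^{-\alpha|x|}$. Hardy space. A $(1,\infty)$-atom is a function $a$ on $X$ such that either $a$ is the constant function $\mu_\alpha(X)^{-1}$, or there is $D\in\mathcal D$ such that $a$ is supported in $D$, $\|a\|_{\infty,\alpha}\le\mu_\alpha(D)^{-1}$, and $\sum_{x\in D}a(x)q^{-\alpha|x|}=0$. $H^1_\alpha$ is the space of $g\in L^1_\alpha$ of the form $g=\sum_j\lambda_ja_j$ with $a_j$ $(1,\infty)$-atoms and $(\lambda_j)$ a summable sequence of complex numbers; $\|g\|_{H^1_\alpha}$ is the infimum of $\sum_j|\lambda_j|$ over all such representations. BMO. ${\rm BMO}_\alpha$ is the space of functions $f:X\to\mathbb C$ with $f\in L^1_\alpha$ and $$\|f\|_{{\rm BMO}_\alpha}=\sup_{D\in\mathcal D}\frac1{\mu_\alpha(D)}\sum_{x\in D}|f(x)-f_D|q^{-\alpha|x|}+\Big|\sum_{x\in X}f(x)q^{-\alpha|x|}\Big|<\infty .$$ Complex interpolation. All the spaces involved are spaces of functions on $X$, and sums $A_0+A_1$ are taken there. Let $\Sigma=\{z\in\mathbb C:0<\Re z<1\}$, with closure $\overline\Sigma$. $\mathcal F(A_0,A_1)$ is the space of functions $F:\overline\Sigma\to A_0+A_1$ such that: for every $\ell\in(A_0+A_1)^*$ the function $z\mapsto\langle F(z),\ell\rangle$ is continuous and bounded on $\overline\Sigma$ and analytic on $\Sigma$; $F(it)\in A_0$ and $F(1+it)\in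 A_1$ for all $t\in\mathbb R$, with $\|F\|_{\mathcal F}=\sup_{t\in\mathbb R}\max(\|F(it)\|_{A_0},\|F(1+it)\|_{A_1})<\infty$. Then $(A_0,A_1)_{[\theta]}=\{F(\theta):F\in\mathcal F(A_0,A_1)\}$, with norm $\|f\|_{[\theta]}=\inf\{\|F\|_{\mathcal F}:F\in\mathcal F(A_0,A_1),\,F(\theta)=f\}$. *)

(* Defs.v *)
From HB Require Import structures.
From mathcomp Require Import all_boot all_order all_algebra.
From mathcomp Require Import complex.
From mathcomp Require Import all_classical all_reals all_analysis.

Set Implicit Arguments.
Unset Strict Implicit.
Unset Printing Implicit Defensive.

Import Order.TTheory GRing.Theory Num.Theory.
Import numFieldNormedType.Exports.

Local Open Scope classical_set_scope.
Local Open Scope ring_scope.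

(* The modulus as an element of R: in R[i] the norm `|z| itself is a complex
   number. *)
Definition cabs (R : realType) (z : R[i]) : R := ComplexField.Normc.normc z.

Section tree.
Context {X : pointedType}.
Implicit Types (e : rel X) (o x y : X) (q : nat).

(* A closed walk without repeated vertices is mathcomp's [ucycle]; an edge
   traversed back and forth is one of length 2. *)
Definition homogeneous_tree q e : Prop :=
  [/\ symmetric e, irreflexive e,
      forall x y, exists2 s, path e x s & last x s = y,
      forall c, ucycle e c -> (size c <= 2)%N
    & forall x, ([set y | e x y] #= `I_q.+1)%card].

Definition has_walk e x y (n : nat) : Prop :=
  exists s, [/\ path e x s, last x s = y & size s = n].

Definition gdist e x y : nat :=
  xget 0%N [set n | has_walk e x y n /\ forall m, has_walk e x y m -> (n <= m)%N].

(* Predecessor with respect to the origin o; the junk value at o is o itself,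
   so that iterating never leaves the geodesic from x to o. *)
Definition pred_vertex e o x : X :=
  xget o [set y | e x y /\ (gdist e o y).+1 = gdist e o x].

Definition sector e o x : set X :=
  [set y | exists l, iter l (pred_vertex e o) y = x].

Definition dyadic e o : set (set X) :=
  [set D | exists v, D = [set v] \/ D = sector e o v].

End tree.

(* X with the sigma-algebra of all its subsets. *)
Definition discrete (X : Type) : Type := X.

HB.instance Definition _ (X : pointedType) := Pointed.on (discrete X).
HB.instance Definition _ (X : pointedType) :=
  @isMeasurable.Build default_measure_display (discrete X)
    discrete_measurable discrete_measurable0
    discrete_measurableC discrete_measurableU.

Section tree_measure.
Context {R : realType} {X : pointedType}.
Variables (q : nat) (e : rel X) (o : X) (alpha : R).
Local Open Scope ereal_scope.

Definition weight (x : X) : R :=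
  ((q%:R : R) `^ (- (alpha * (gdist e o x)%:R)))%R.

Definition tree_measure (A : set (discrete X)) : \bar R :=
  \esum_(x in A) (weight x)%:E.

Let tree_measure0 : tree_measure set0 = 0.
Proof. exact: esum_set0. Qed.

Let tree_measure_ge0 A : 0 <= tree_measure A.
Proof. by apply: esum_ge0 => x _; rewrite lee_fin powR_ge0. Qed.

Let tree_measure_sigma_additive : semi_sigma_additive tree_measure.
Proof.
move=> F _ tF _; rewrite /tree_measure nneseries_sum_bigcup//; last first.
  by move=> x; rewrite lee_fin powR_ge0.
by apply: is_cvg_nneseries => n _ _; exact: tree_measure_ge0.
Qed.

HB.instance Definition _ := isMeasure.Build _ _ _ tree_measure
  tree_measure0 tree_measure_ge0 tree_measure_sigma_additive.

End tree_measure.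

(* A space of functions on X together with its norm; only the values of the
   norm on the carrier matter. *)
Record function_space (R : realType) (X : Type) := FunctionSpace {
  fcarrier : set (X -> R[i]) ;
  fnorm : (X -> R[i]) -> \bar R }.

Section function_spaces.
Context {R : realType} {X : pointedType}.
Variables (mu : {measure set (discrete X) -> \bar R}) (Dy : set (set X)).
Local Notation C := R[i].
Implicit Types (f g : X -> C) (D : set X).
Local Open Scope ereal_scope.

Definition Lp_norm (p : \bar R) f : \bar R :=
  'N[mu]_p [(fun x : discrete X => (cabs (f x))%:E)].

Definition Lp (p : \bar R) : function_space R X :=
  FunctionSpace [set f | Lp_norm p f < +oo] (Lp_norm p).

Definition vol D : R := fine (mu D).

(* The integral of f over D, i.e. the sum over x in D of f x * mu [set x]. *)
Definition cint D f : C :=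
  Complex (\int[mu]_(x in (D : set (discrete X))) complex.Re (f x))%R
          (\int[mu]_(x in (D : set (discrete X))) complex.Im (f x))%R.

Definition avg D f : C := (((vol D)^-1)%:C%C * cint D f)%R.

Definition atom (a : X -> C) : Prop :=
  a = (fun=> ((vol setT)^-1%R)%:C%C) \/
  exists2 D, Dy D &
    [/\ forall x, ~ D x -> a x = 0%R,
        Lp_norm +oo a <= (vol D)^-1%:E
      & cint D a = 0%R].

(* g = \sum_j lam j * a j, the series being understood in L^1. *)
Definition atomic_decomposition g (lam : nat -> C) (a : nat -> X -> C) : Prop :=
  [/\ forall j, atom (a j),
      \sum_(0 <= j <oo) (cabs (lam j))%:E < +oo
    & Lp_norm 1 (fun x => g x - \sum_(0 <= j < n) lam j * a j x)%R
        @[n --> \oo] --> 0].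

Definition H1_norm g : \bar R :=
  ereal_inf [set s | exists lam a, atomic_decomposition g lam a /\
                       s = \sum_(0 <= j <oo) (cabs (lam j))%:E].

Definition H1 : function_space R X :=
  FunctionSpace
    [set g | fcarrier (Lp 1) g /\ exists lam a, atomic_decomposition g lam a]
    H1_norm.

Definition BMO_norm f : \bar R :=
  ereal_sup [set (vol D)^-1%:E *
      \int[mu]_(x in (D : set (discrete X))) (cabs (f x - avg D f)%R)%:E | D in Dy]
  + (cabs (cint setT f))%:E.

Definition BMO : function_space R X :=
  FunctionSpace [set f | fcarrier (Lp 1) f /\ BMO_norm f < +oo] BMO_norm.

End function_spaces.

Section complex_interpolation.
Context {R : realType} {X : pointedType}.
Local Notation C := R[i].
Implicit Types (A B : function_space R X) (f g : X -> C) (F : C -> X -> C).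
Local Open Scope ereal_scope.

Definition sum_space A0 A1 : function_space R X :=
  FunctionSpace
    [set f | exists f0 f1, [/\ fcarrier A0 f0, fcarrier A1 f1 & f = (f0 \+ f1)%R]]
    (fun f => ereal_inf [set s | exists f0 f1,
       [/\ fcarrier A0 f0, fcarrier A1 f1, f = (f0 \+ f1)%R
         & s = fnorm A0 f0 + fnorm A1 f1]]).

(* ell is a bounded linear functional on A; its values outside the carrier of A
   are irrelevant. *)
Definition bounded_functional A (ell : (X -> C) -> C) : Prop :=
  [/\ forall f g, fcarrier A f -> fcarrier A g ->
        ell (f \+ g)%R = (ell f + ell g)%R,
      forall (c : C) f, fcarrier A f -> ell (fun x => c * f x)%R = (c * ell f)%R
    & exists M : R, forall f, fcarrier A f -> (cabs (ell f))%:E <= M%:E * fnorm A f].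

Definition open_strip : set C := [set z | (0 < complex.Re z < 1)%R].
Definition closed_strip : set C := [set z | (0 <= complex.Re z <= 1)%R].

Definition analytic_at (phi : C -> C) (z0 : C) : Prop :=
  exists2 r : R, (0 < r)%R & exists a : nat -> C, forall z : C,
    (cabs (z - z0) < r)%R ->
    (\sum_(0 <= k < n) a k * (z - z0) ^+ k : C^o)%R @[n --> \oo] --> (phi z : C^o).

Definition Fnorm A0 A1 F : \bar R :=
  ereal_sup [set maxe (fnorm A0 (F (0%R +i* t)%C))
                      (fnorm A1 (F (1%R +i* t)%C)) | t in [set: R]].

(* F is a total function, but only its values on the closed strip matter. *)
Definition interp_family A0 A1 : set (C -> X -> C) :=
  [set F | [/\ forall z, closed_strip z -> fcarrier (sum_space A0 A1) (F z),
      forall ell, bounded_functional (sum_space A0 A1) ell ->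
        [/\ {within (closed_strip : set C^o),
                continuous ((fun z => ell (F z)) : C^o -> C^o)},
            exists M : R, forall z, closed_strip z -> (cabs (ell (F z)) <= M)%R
          & forall z, open_strip z -> analytic_at (fun w => ell (F w)) z],
      forall t : R, fcarrier A0 (F (0%R +i* t)%C) /\
                    fcarrier A1 (F (1%R +i* t)%C)
    & Fnorm A0 A1 F < +oo]].

Definition interp A0 A1 (theta : R) : function_space R X :=
  FunctionSpace
    [set f | exists2 F, interp_family A0 A1 F & F (theta%:C%C) = f]
    (fun f => ereal_inf [set s | exists F,
       [/\ interp_family A0 A1 F, F (theta%:C%C) = f & s = Fnorm A0 A1 F]]).

Definition equivalent_spaces A B : Prop :=
  fcarrier A = fcarrier B /\
  exists c1 c2 : R, [/\ (0 < c1)%R, (0 < c2)%R &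
    forall f, fcarrier A f ->
      c1%:E * fnorm A f <= fnorm B f /\ fnorm B f <= c2%:E * fnorm A f].

End complex_interpolation.

(* Main.v *)
(** Since [mu (T_v)] is comparable with the weight [w v] of the root, the
    interpolation identities reduce to two estimates on the tree: Hardy's
    inequality for the sector averages [A v = |sum_(T_v) f w| / w v], and
    Hadamard's three lines theorem.

    For the upper bounds one exhibits families.  For [(L^p1, BMO)] it is
    [f (|f| / N)^(p (1 - z) / p1 - 1)].  For [(H^1, L^p1)], summation by parts
    writes [f] as the sum over [v] of [S_v (1_v / w v - 1_(p v) / w (p v))] with
    [S_v = sum_(T_v) f w], a multiple of an atom, and one multiplies the [v]-th
    term by [A v ^ phi(z)] with [phi] affine; Hardy's inequality bounds both
    boundary values.

    For the lower bounds one applies the three lines theorem to finite pairings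
    of [F(z)] with powers of a dual function: [sum_x F(z)(x) u(x) r(x)^psi(z) w x]
    for [(H^1, L^p1)], and [sum_v S_v A v ^ phi(z) (F(z)(v) - F(z)(p v))] for
    [(L^p1, BMO)], using that [|F(v) - F(p v)|] is bounded by the BMO norm. *)

Require Import Defs.
From mathcomp Require Import all_boot all_order all_algebra.
From mathcomp Require Import complex zify ring lra.
From mathcomp Require Import all_classical all_reals all_analysis ess_sup_inf.

Set Implicit Arguments.
Unset Strict Implicit.
Unset Printing Implicit Defensive.

Import Order.TTheory GRing.Theory Num.Theory.
Import numFieldNormedType.Exports.

Local Open Scope classical_set_scope.
Local Open Scope ring_scope.

(** * Complex analysis on the strip *)

(** Membership in the interpolation space is tested through every bounded functional [ell] on A0 +
    A1, known only by its boundedness. So both families of the upper bounds are brought to the form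
    of a series of c_j exp(beta_j z) b_j with c_j ell(b_j) absolutely summable against 1 +
    exp(beta_j). This dominates the exponentials on the whole strip and yields continuity,
    boundedness and power series once for all. For the lower bounds the functionals are point
    evaluations, bounded because each vertex has positive mass; they turn F into scalar functions.

    The exponents are forced: at theta the extra power is trivial, or the one dual to L^p, and on
    each boundary line the moduli become powers controlled by the norm at hand.

    Neighbouring weights differ at most by the factor [decay]. Hence the difference of the
    normalised point masses at v and p v is a bounded multiple of an atom on T_(p v); and v and p v
    carry at least a fixed fraction of the mass of T_(p v), so that mean oscillation controls
    differences. *)

#[global] Arguments cabs : simpl never.

(** * Moduli, limits and absolutely convergent series of complex numbers *)

Section modulus.
Context {R : realType}.
Local Notation C := R[i].
Implicit Types (z w : C) (r : R).

Lemma normE z : `|z| = (cabs z)%:C%C.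
Proof. by []. Qed.

Lemma cabs_ge0 z : 0 <= cabs z.
Proof. by rewrite /cabs /ComplexField.Normc.normc; case: z => a b; exact: sqrtr_ge0. Qed.

Lemma cabs0 : cabs (0 : C) = 0.
Proof. exact: ComplexField.Normc.normc0. Qed.

Lemma cabs1 : cabs (1 : C) = 1.
Proof. exact: ComplexField.Normc.normc1. Qed.

Lemma cabs_eq0 z : cabs z = 0 -> z = 0.
Proof. exact: ComplexField.Normc.eq0_normc. Qed.

Lemma cabsM z w : cabs (z * w) = cabs z * cabs w.
Proof. exact: ComplexField.Normc.normcM. Qed.

Lemma cabsV z : cabs z^-1 = (cabs z)^-1.
Proof. exact: ComplexField.Normc.normcV. Qed.

Lemma cabsD z w : cabs (z + w) <= cabs z + cabs w.
Proof. exact: le_normcD. Qed.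

Lemma cabsN z : cabs (- z) = cabs z.
Proof. exact: normcN. Qed.

Lemma cabsC z w : cabs (z - w) = cabs (w - z).
Proof. by rewrite -cabsN opprB. Qed.

Lemma cabsB z w : cabs (z - w) <= cabs z + cabs w.
Proof. by rewrite (le_trans (cabsD _ _))// cabsN. Qed.

Lemma cabs_trans w z t : cabs (z - t) <= cabs (z - w) + cabs (w - t).
Proof. by rewrite -[z - t](subrKA w) cabsD. Qed.

Lemma cabsX z n : cabs (z ^+ n) = cabs z ^+ n.
Proof. by elim: n => [|n ih]; rewrite ?expr0 ?cabs1// !exprS cabsM ih. Qed.

Lemma cabs_real r : cabs r%:C%C = `|r|.
Proof. by rewrite /cabs /= expr0n /= addr0 sqrtr_sqr. Qed.

Lemma cabs_sqr z : cabs z ^+ 2 = complex.Re z ^+ 2 + complex.Im z ^+ 2.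
Proof. by case: z => a b; rewrite /cabs /= sqr_sqrtr// addr_ge0// sqr_ge0. Qed.

Lemma Re_le_cabs z : `|complex.Re z| <= cabs z.
Proof.
rewrite -(ler_pXn2r (n := 2))// ?nnegrE ?cabs_ge0// cabs_sqr real_normK ?num_real//.
by rewrite lerDl sqr_ge0.
Qed.

Lemma Im_le_cabs z : `|complex.Im z| <= cabs z.
Proof.
rewrite -(ler_pXn2r (n := 2))// ?nnegrE ?cabs_ge0// cabs_sqr real_normK ?num_real//.
by rewrite lerDr sqr_ge0.
Qed.

Lemma cabs_le_ReIm z : cabs z <= `|complex.Re z| + `|complex.Im z|.
Proof.
rewrite -(ler_pXn2r (n := 2))// ?nnegrE ?cabs_ge0 ?addr_ge0// cabs_sqr sqrrD.
rewrite !real_normK ?num_real// -addrA lerD2l lerDr mulrn_wge0// mulr_ge0//.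
Qed.

Lemma cabs_sum (I : Type) (s : seq I) (P : pred I) (F : I -> C) :
  cabs (\sum_(i <- s | P i) F i) <= \sum_(i <- s | P i) cabs (F i).
Proof.
elim/big_rec2: _ => [|i y x _ ih]; first by rewrite cabs0.
by rewrite (le_trans (cabsD _ _))// lerD2l.
Qed.

Lemma Re_sum (I : Type) (s : seq I) (P : pred I) (F : I -> C) :
  complex.Re (\sum_(i <- s | P i) F i) = \sum_(i <- s | P i) complex.Re (F i).
Proof. by elim/big_rec2: _ => [//|i y x _ <-]; case: (F i) => a b; case: x. Qed.

Lemma Im_sum (I : Type) (s : seq I) (P : pred I) (F : I -> C) :
  complex.Im (\sum_(i <- s | P i) F i) = \sum_(i <- s | P i) complex.Im (F i).
Proof. by elim/big_rec2: _ => [//|i y x _ <-]; case: (F i) => a b; case: x. Qed.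

Lemma ReB z w : complex.Re (z - w) = complex.Re z - complex.Re w.
Proof. by case: z w => [a b] [c d]. Qed.

Lemma ImB z w : complex.Im (z - w) = complex.Im z - complex.Im w.
Proof. by case: z w => [a b] [c d]. Qed.

Lemma Re_realM r z : complex.Re (r%:C%C * z) = r * complex.Re z.
Proof. by case: z => a b /=; rewrite mul0r subr0. Qed.

Lemma real_cplxM r z : (r%:C * z)%C = Complex (r * complex.Re z) (r * complex.Im z).
Proof. by case: z => a b; apply/eqP; rewrite eq_complex /= !mul0r subr0 addr0 !eqxx. Qed.

(** Convergence by real epsilons: the norm of [R[i]] takes values in [R[i]], so the filter statement
    asks for a complex epsilon with vanishing imaginary part. *)
Definition ctends (u : nat -> C) (l : C) : Prop :=
  forall eps : R, 0 < eps -> exists N, forall n, (N <= n)%N -> cabs (u n - l) <= eps.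

Lemma ctends_unique u l l' : ctends u l -> ctends u l' -> l = l'.
Proof.
move=> ul ul'; apply/eqP; rewrite -subr_eq0; apply/eqP/cabs_eq0/eqP.
rewrite eq_le cabs_ge0 andbT; apply/ler_addgt0Pr => eps e0; rewrite add0r.
have e2 : 0 < eps / 2 by rewrite divr_gt0.
have [N1 h1] := ul _ e2; have [N2 h2] := ul' _ e2.
have := cabs_trans (u (maxn N1 N2)) l l' => /le_trans; apply.
by rewrite cabsC (splitr eps) lerD// ?h1 ?h2// ?leq_maxl ?leq_maxr.
Qed.

Lemma ctends_cvg (u : nat -> C) (l : C) :
  ctends u l -> (u : nat -> C^o) @ \oo --> (l : C^o).
Proof.
move=> ul; apply/cvgrPdist_le => /= eps; rewrite ltcE /= => /andP[/eqP i0 e0].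
have [N hN] := ul _ e0; near=> n.
rewrite distrC normE lecE /= i0 eqxx /=; apply: hN.
by near: n; exists N.
Unshelve. all: by end_near. Qed.

Lemma cvg_ctends (u : nat -> C) (l : C) :
  (u : nat -> C^o) @ \oo --> (l : C^o) -> ctends u l.
Proof.
move=> /cvgrPdist_le /= ul eps e0.
have : 0 < eps%:C%C :> C by rewrite ltcE /= eqxx.
move=> /ul [N _ hN]; exists N => n Nn; have := hN n Nn.
by rewrite distrC normE lecR.
Qed.

Lemma real_tends (u : nat -> R) (l : R) : u @ \oo --> l ->
  forall eps : R, 0 < eps -> exists N, forall n, (N <= n)%N -> `|u n - l| <= eps.
Proof.
by move=> /cvgrPdist_le ul eps /ul[N _ hN]; exists N => n /hN; rewrite distrC.
Qed.

Lemma ctends_ReIm u l : (fun n => complex.Re (u n)) @ \oo --> complex.Re l ->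
  (fun n => complex.Im (u n)) @ \oo --> complex.Im l -> ctends u l.
Proof.
move=> /real_tends hr /real_tends hi eps e0.
have e2 : 0 < eps / 2 by rewrite divr_gt0.
have [N1 h1] := hr _ e2; have [N2 h2] := hi _ e2.
exists (maxn N1 N2) => n; rewrite geq_max => /andP[n1 n2].
by rewrite (le_trans (cabs_le_ReIm _))// ReB ImB (splitr eps) lerD// ?h1 ?h2.
Qed.

Lemma ctends_le (u : nat -> C) (l : C) (B : R) (w : C) :
  ctends u l -> (forall n, cabs (u n - w) <= B) -> cabs (l - w) <= B.
Proof.
move=> ul uB; apply/ler_addgt0Pr => eps e0; have [N hN] := ul _ e0.
by rewrite (le_trans (cabs_trans (u N) _ _))// addrC lerD// cabsC hN.
Qed.

Lemma ctends_shift_le (u : nat -> C) (l : C) (B : R) (w : C) (n0 : nat) :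
  ctends u l -> (forall n, (n0 <= n)%N -> cabs (u n - w) <= B) -> cabs (l - w) <= B.
Proof.
move=> ul uB; apply: (@ctends_le (fun n => u (n + n0)%N)).
  move=> eps /ul[N hN]; exists N => n Nn; apply: hN.
  by rewrite (leq_trans Nn)// leq_addr.
by move=> n; apply: uB; rewrite leq_addl.
Qed.

(** Completeness is borrowed from the reals: the real and the imaginary parts form absolutely
    convergent series. *)
Lemma abs_series_cvg (c : nat -> C) (M : R) :
  (forall n, \sum_(0 <= j < n) cabs (c j) <= M) ->
  exists l, ctends (fun n => \sum_(0 <= j < n) c j) l.
Proof.
move=> cM.
have real_part (f : nat -> R) : (forall j, `|f j| <= cabs (c j)) ->
    cvg (series f @ \oo).
  move=> fc; apply: normed_cvg; apply: (@nondecreasing_is_cvgn _ _ ).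
    by apply: nondecreasing_series => n _ _; exact: normr_ge0.
  exists M => _ [n _ <-]; rewrite /series /=; apply: le_trans (cM n).
  by apply: ler_sum => j _; exact: fc.
have hr := real_part _ (fun j => Re_le_cabs (c j)).
have hi := real_part _ (fun j => Im_le_cabs (c j)).
exists (Complex (limn (series (fun j => complex.Re (c j))))
                (limn (series (fun j => complex.Im (c j))))).
apply: ctends_ReIm => /=.
  have -> : (fun n => complex.Re (\sum_(0 <= j < n) c j)) =
      series (fun j => complex.Re (c j)) by apply/funext => n; rewrite Re_sum.
  exact: hr.
have -> : (fun n => complex.Im (\sum_(0 <= j < n) c j)) =
    series (fun j => complex.Im (c j)) by apply/funext => n; rewrite Im_sum.
exact: hi.
Qed.

Lemma bounded_series_tail (d : nat -> R) (M : R) : (forall j, 0 <= d j) ->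
  (forall n, \sum_(0 <= j < n) d j <= M) ->
  forall eps : R, 0 < eps -> exists N, forall n m, (N <= n)%N -> (n <= m)%N ->
    \sum_(n <= j < m) d j <= eps.
Proof.
move=> d0 dM eps e0.
have cd : cvg (series d @ \oo).
  apply: nondecreasing_is_cvgn.
    by apply: nondecreasing_series => n _ _; exact: d0.
  by exists M => _ [n _ <-]; exact: dM.
have [N hN] := real_tends cd e0; exists N => n m Nn nm.
have le_lim : series d m <= limn (series d).
  by apply: nondecreasing_cvgn_le => //; apply: nondecreasing_series => k _ _.
have := hN n Nn; rewrite ler_norml => /andP[+ _].
have -> : \sum_(n <= j < m) d j = series d m - series d n.
  by rewrite /series /= (big_cat_nat (n := n) (m := 0%N) (p := m))//= [X in X - _]addrC addrK.
by move=> h; lra.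
Qed.

End modulus.

(** * Truncated exponential series over a field *)

Section exponential_sums.
Context {F : numFieldType}.
Implicit Types a b : F.

Definition expsum (n : nat) a : F := \sum_(0 <= k < n) a ^+ k / k`!%:R.

(** This is the binomial theorem, with the double sum cut along i + j < n. *)
Lemma expsumD n a b : expsum n (a + b) =
  \sum_(0 <= i < n) a ^+ i / i`!%:R * expsum (n - i) b.
Proof.
elim: n => [|n ih]; first by rewrite /expsum !big_geq.
rewrite {1}/expsum big_nat_recr//= -/(expsum n (a + b)) ih.
rewrite [RHS]big_nat_recr//= subSnn.
have -> : expsum 1 b = 1 by rewrite /expsum big_nat1 expr0 divr1.
have -> : \sum_(0 <= i < n) a ^+ i / i`!%:R * expsum (n.+1 - i) b =
    \sum_(0 <= i < n) a ^+ i / i`!%:R * expsum (n - i) b +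
    \sum_(0 <= i < n) a ^+ i / i`!%:R * (b ^+ (n - i) / (n - i)`!%:R).
  rewrite -big_split /= big_nat [RHS]big_nat; apply: eq_bigr => i /= iltn.
  by rewrite subSn ?(ltnW iltn)// /expsum big_nat_recr//= mulrDr.
rewrite -addrA; congr +%R.
rewrite [a + b]addrC exprDn big_ord_recr /= subnn expr0 mul1r binn mulr1n mulrDl.
rewrite mulr1; congr +%R.
rewrite big_mkord mulr_suml; apply: eq_bigr => i _.
have -> : (n`!%:R : F) = 'C(n, i)%:R * (i`!%:R * (n - i)`!%:R).
  by rewrite -!natrM bin_fact// ltnW.
have h m : (m`!%:R : F) != 0 by rewrite pnatr_eq0 -lt0n fact_gt0.
rewrite -[in LHS]mulr_natr.
move: (h i) (h (n - i)%N); have : ('C(n, i)%:R : F) != 0.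
  by rewrite pnatr_eq0 -lt0n bin_gt0 ltnW.
move: ('C(n, i)%:R : F) (i`!%:R : F) ((n - i)`!%:R : F) => t u v t0 u0 v0.
by field; rewrite t0 u0 v0.
Qed.

(** The product runs over a square of indices, the series at a + b over the triangle i + j < n.
    Their difference is the complement of the triangle, with positive coefficients. *)
Lemma expsum_defect n a b : expsum n a * expsum n b - expsum n (a + b) =
  \sum_(0 <= i < n) \sum_(n - i <= j < n) a ^+ i / i`!%:R * (b ^+ j / j`!%:R).
Proof.
rewrite expsumD {1}/expsum mulr_suml -sumrB; apply: eq_bigr => i _.
rewrite -mulrBr -mulr_sumr; congr *%R.
by rewrite /expsum (@big_cat_nat _ _ _ (n - i) 0 n)//= ?leq_subr// [X in X - _]addrC addrK.
Qed.

End exponential_sums.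

(** * The complex exponential and its power series *)

Section complex_exponential.
Context {R : realType}.
Local Notation C := R[i].
Implicit Types (z w : C) (r : R).

Definition cexp z : C :=
  Complex (expR (complex.Re z) * cos (complex.Im z))
          (expR (complex.Re z) * sin (complex.Im z)).

#[global] Arguments cexp : simpl never.

Lemma cexpD z w : cexp (z + w) = cexp z * cexp w.
Proof.
case: z w => [a b] [c d]; apply/eqP; rewrite eq_complex /= expRD cosD sinD.
by apply/andP; split; apply/eqP; ring.
Qed.

Lemma cabs_cexp z : cabs (cexp z) = expR (complex.Re z).
Proof.
apply/eqP; rewrite -(@eqrXn2 _ 2)// ?cabs_ge0 ?expR_ge0// cabs_sqr /= !exprMn -mulrDr.
by rewrite cos2Dsin2 mulr1.
Qed.

Lemma cexp_real r : cexp r%:C%C = (expR r)%:C%C.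
Proof. by apply/eqP; rewrite eq_complex /= cos0 sin0 mulr0 mulr1 !eqxx. Qed.

Lemma ctendsM (u v : nat -> C) l m : ctends u l -> ctends v m ->
  ctends (fun n => u n * v n) (l * m).
Proof.
move=> ul vm eps e0; pose K := cabs l + cabs m + 1.
have K0 : 0 < K by rewrite ltr_wpDl// addr_ge0// cabs_ge0.
have d0 : 0 < eps / (2 * K) by rewrite divr_gt0// mulr_gt0.
have [N1 h1] := ul _ d0; have [N2 h2] := vm _ d0; have [N3 h3] := vm _ ltr01.
exists (maxn N1 (maxn N2 N3)) => n; rewrite !geq_max => /and3P[n1 n2 n3].
have -> : u n * v n - l * m = (u n - l) * v n + l * (v n - m) by ring.
have -> : eps = eps / (2 * K) * K + K * (eps / (2 * K)) by field; rewrite gt_eqF.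
rewrite (le_trans (cabsD _ _))// !cabsM lerD// ler_pM ?cabs_ge0 ?h1 ?h2//.
  rewrite -[v n](subrK m) (le_trans (cabsD _ _))// /K.
  by have := h3 n n3; have := cabs_ge0 l; lra.
by rewrite /K -addrA lerDl addr_ge0// cabs_ge0.
Qed.

Lemma real_natV (n : nat) : ((n%:R : C)^-1) = ((n%:R : R)^-1)%:C%C.
Proof. by rewrite fmorphV rmorph_nat. Qed.

Lemma expsum_real n r : expsum n (r%:C%C : C) = (expsum n r)%:C%C.
Proof.
rewrite /expsum rmorph_sum; apply: eq_bigr => k _.
by rewrite real_natV -rmorphXn -rmorphM.
Qed.

Lemma expsum_exp n r : expsum n r = series (exp_coeff r) n.
Proof. by []. Qed.

Lemma expsum_cvg r : (fun n => expsum n r) @ \oo --> expR r.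
Proof.
have -> : (fun n => expsum n r) = series (exp_coeff r) by [].
exact: is_cvg_series_exp_coeff.
Qed.

Lemma expsum_le_expR n r : 0 <= r -> expsum n r <= expR r.
Proof.
move=> r0; rewrite expsum_exp; apply: (@nondecreasing_cvgn_le _ (series (exp_coeff r))).
  apply: nondecreasing_series => k _ _.
  by rewrite /exp_coeff /= divr_ge0// exprn_ge0.
exact: is_cvg_series_exp_coeff.
Qed.

Lemma cabs_expcoef k z : cabs (z ^+ k / k`!%:R) = cabs z ^+ k / k`!%:R.
Proof. by rewrite cabsM cabsX real_natV cabs_real ger0_norm// invr_ge0. Qed.

Lemma cabs_expsum n z : cabs (expsum n z) <= expsum n (cabs z).
Proof.
rewrite (le_trans (cabs_sum _ _ _))//; apply: ler_sum => k _.
by rewrite cabs_expcoef.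
Qed.

(** The coefficients of the defect are positive, so moduli dominate it. The real bound tends to exp
    a exp b - exp(a + b) = 0, which carries convergence from two numbers to their sum. *)
Lemma expsum_defect_le n z w : cabs (expsum n z * expsum n w - expsum n (z + w)) <=
  expsum n (cabs z) * expsum n (cabs w) - expsum n (cabs z + cabs w).
Proof.
rewrite !expsum_defect (le_trans (cabs_sum _ _ _))//; apply: ler_sum => i _.
rewrite (le_trans (cabs_sum _ _ _))//; apply: ler_sum => j _.
by rewrite cabsM !cabs_expcoef.
Qed.

Lemma expsum_imaginary n r : expsum n (Complex 0 r) =
  Complex (series (cos_coeff r) n) (series (sin_coeff r) n).
Proof.
(* Powers of the imaginary unit by the parity of k. At k = 0 the truncated [k.-1./2] is harmless,
   since its factor [odd k] is 0. *)
have termE k : (Complex 0 r : C) ^+ k = Complex ((~~ odd k)%:R * (-1) ^+ k./2 * r ^+ k)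
    ((odd k)%:R * (-1) ^+ k.-1./2 * r ^+ k).
  elim: k => [|k ih]; first by rewrite /= !expr0 !mul0r !mulr1.
  rewrite exprS ih; apply/eqP; rewrite eq_complex /=.
  case: (boolP (odd k)) => ok /=; rewrite !(mul0r, mul1r, subr0, sub0r, addr0, add0r).
    have -> : uphalf k = (k.-1./2).+1.
      by case: k ok {ih} => //= k ok; rewrite uphalf_half negbK in ok *; rewrite negbTE.
    by rewrite !exprS; apply/andP; split; apply/eqP; ring.
  rewrite !exprS; apply/andP; split; first by rewrite mulr0 oppr0.
  by apply/eqP; ring.
rewrite /expsum; apply/eqP; rewrite eq_complex Re_sum Im_sum /=.
apply/andP; split; apply/eqP; apply: eq_bigr => k _;
  by rewrite termE real_natV mulrC real_cplxM /= mulrC.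
Qed.

(** The real part of z is treated by the real exponential series, the imaginary part by the cosine
    and sine series; [expsum_defect_le] puts them together. *)
Lemma expsum_tends z : ctends (fun n => expsum n z) (cexp z).
Proof.
case: z => x y; have -> : Complex x y = x%:C%C + Complex 0 y :> C.
  by apply/eqP; rewrite eq_complex /= addr0 add0r !eqxx.
set a := x%:C%C; set b := Complex 0 y.
have ha : ctends (fun n => expsum n a) (cexp a).
  rewrite cexp_real; apply: ctends_ReIm => /=.
    by under eq_fun do rewrite expsum_real; exact: expsum_cvg.
  by under eq_fun do rewrite expsum_real /=; exact: cvg_cst.
have hb : ctends (fun n => expsum n b) (cexp b).
  rewrite /cexp /= expR0 !mul1r; apply: ctends_ReIm.
    under eq_fun do rewrite expsum_imaginary /=.
    by rewrite /= unlock; exact: is_cvg_series_cos_coeff.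
  under eq_fun do rewrite expsum_imaginary /=.
  by rewrite /= unlock; exact: is_cvg_series_sin_coeff.
rewrite cexpD => eps e0.
have e2 : 0 < eps / 2 by rewrite divr_gt0.
have [N1 h1] := ctendsM ha hb e2.
have : (fun n => expsum n (cabs a) * expsum n (cabs b) - expsum n (cabs a + cabs b))
    @ \oo --> expR (cabs a) * expR (cabs b) - expR (cabs a + cabs b).
  by apply: cvgB; [apply: cvgM; exact: expsum_cvg|exact: expsum_cvg].
rewrite expRD subrr => /real_tends /(_ _ e2)[N2 h2].
exists (maxn N1 N2) => n; rewrite geq_max => /andP[n1 n2].
have := cabs_trans (expsum n a * expsum n b) (expsum n (a + b)) (cexp a * cexp b).
move=> /le_trans; apply; rewrite (splitr eps) lerD ?h1//.
rewrite cabsC (le_trans (expsum_defect_le _ _ _))//.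
by have := h2 n n2; rewrite subr0; apply: le_trans; exact: ler_norm.
Qed.

Lemma cabs_cexpB1 z : cabs (cexp z - 1) <= expR (cabs z) - 1.
Proof.
apply: (ctends_shift_le (n0 := 1%N) (expsum_tends z)) => -[//|n] _.
rewrite /expsum big_nat_recl//= expr0 divr1 addrC addKr.
rewrite (le_trans (cabs_sum _ _ _))// lerBrDl.
apply: le_trans (expsum_le_expR n.+1 (cabs_ge0 z)).
rewrite /expsum big_nat_recl//= expr0 divr1 lerD2l.
by apply: ler_sum => k _; rewrite cabs_expcoef.
Qed.

End complex_exponential.

(** * Exponential series on the strip: continuity, boundedness, analyticity *)

Section exponential_series.
Context {R : realType}.
Local Notation C := R[i].
Implicit Types (z w : C) (Phi : C -> C).

Definition strip_continuous Phi : Prop := forall z, closed_strip z ->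
  forall eps : R, 0 < eps -> exists2 d : R, 0 < d & forall w, closed_strip w ->
    cabs (w - z) <= d -> cabs (Phi w - Phi z) <= eps.

Lemma strip_continuousP Phi : strip_continuous Phi <->
  {within (closed_strip : set C^o), continuous (Phi : C^o -> C^o)}.
Proof.
split=> [h|/subspace_continuousP h z sz eps e0].
  apply/subspace_continuousP => z sz; apply/cvgrPdist_le => /= eps.
  rewrite ltcE /= => /andP[/eqP i0 e0]; have [d d0 hd] := h z sz _ e0.
  rewrite near_withinE; near=> w => sw.
  rewrite distrC normE lecE /= i0 eqxx /=; apply: hd => //.
  have : `|z - w| <= d%:C%C.
    near: w; apply: (@cvgr_dist_le _ C^o C^o _ _ id); first exact: cvg_id.
    by rewrite ltcE /= eqxx.
  by rewrite distrC normE lecR.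
have /h /cvgrPdist_le : (closed_strip : set C^o) z by [].
have /[swap]/[apply] : 0 < eps%:C%C :> C by rewrite ltcE /= eqxx.
rewrite near_withinE => /nbhs_ballP[d /=]; rewrite ltcE /= => /andP[/eqP i0 d0] hd.
exists (complex.Re d / 2); first by rewrite divr_gt0.
move=> w sw wz; have := hd w; rewrite /ball /= /ball /= !normE !lecE !ltcE /= i0 eqxx /=.
rewrite cabsC => /(_ _ sw); rewrite cabsC; apply.
by rewrite cabsC (le_lt_trans wz)// ltr_pdivrMr// ltr_pMr// ltr1n.
Unshelve. all: by end_near. Qed.

Lemma ctends_cst (l : C) : ctends (fun=> l) l.
Proof. by move=> eps e0; exists 0%N => n _; rewrite subrr cabs0 ltW. Qed.

Lemma ctendsD (u v : nat -> C) l m : ctends u l -> ctends v m ->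
  ctends (fun n => u n + v n) (l + m).
Proof.
move=> ul vm eps e0; have e2 : 0 < eps / 2 by rewrite divr_gt0.
have [N1 h1] := ul _ e2; have [N2 h2] := vm _ e2.
exists (maxn N1 N2) => n; rewrite geq_max => /andP[n1 n2].
have -> : u n + v n - (l + m) = (u n - l) + (v n - m) by ring.
by rewrite (le_trans (cabsD _ _))// (splitr eps) lerD ?h1 ?h2.
Qed.

Lemma ctends_sum (I : Type) (s : seq I) (u : I -> nat -> C) (l : I -> C) :
  (forall i, ctends (u i) (l i)) ->
  ctends (fun n => \sum_(i <- s) u i n) (\sum_(i <- s) l i).
Proof.
move=> ul; elim: s => [|i s ih].
  by under eq_fun do rewrite big_nil; rewrite big_nil; exact: ctends_cst.
by under eq_fun do rewrite big_cons; rewrite big_cons; exact: ctendsD.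
Qed.

(** By monotonicity the value is at most the larger of the endpoint values 1 and exp b. *)
Lemma expR_strip (b s : R) : 0 <= s <= 1 -> expR (b * s) <= 1 + expR b.
Proof.
move=> /andP[s0 s1]; have [b0|b0] := leP 0 b.
  rewrite (@le_trans _ _ (expR b))// ?lerDr// ler_expR.
  by rewrite ler_piMr.
rewrite (@le_trans _ _ 1)// ?lerDl ?expR_ge0// -expR0 ler_expR.
by rewrite mulr_le0_ge0// ltW.
Qed.

Section series.
Variables (c : nat -> C) (beta : nat -> R) (M : R) (Phi : C -> C).
Hypothesis series_le : forall n,
  \sum_(0 <= j < n) cabs (c j) * (1 + expR (beta j)) <= M.
Hypothesis series_tends : forall z, closed_strip z ->
  ctends (fun n => \sum_(0 <= j < n) c j * cexp ((beta j)%:C%C * z)) (Phi z).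

(** Majorant of the j-th term, uniform over the closed strip. *)
Let D j := cabs (c j) * (1 + expR (beta j)).

Let D_ge0 j : 0 <= D j.
Proof. by rewrite mulr_ge0 ?cabs_ge0// addr_ge0// expR_ge0. Qed.

Let term_le j z : closed_strip z -> cabs (c j * cexp ((beta j)%:C%C * z)) <= D j.
Proof.
move=> sz; rewrite cabsM cabs_cexp Re_realM ler_wpM2l ?cabs_ge0//.
exact: expR_strip.
Qed.

Let tail (eps : R) : 0 < eps -> exists N, (forall n m, (N <= n)%N -> (n <= m)%N ->
    \sum_(n <= j < m) D j <= eps) /\
  forall n z, (N <= n)%N -> closed_strip z ->
    cabs (Phi z - \sum_(0 <= j < n) c j * cexp ((beta j)%:C%C * z)) <= eps.
Proof.
move=> e0; have [N hN] := bounded_series_tail D_ge0 series_le e0; exists N; split=> //.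
move=> n z Nn sz; apply: (ctends_shift_le (n0 := n) (series_tends sz)) => m nm.
rewrite (@big_cat_nat _ _ _ n 0 m)//= addrAC subrr add0r.
rewrite (le_trans (cabs_sum _ _ _))// (le_trans _ (hN n m Nn nm))//.
by apply: ler_sum => j _; exact: term_le.
Qed.

Lemma exp_series_bounded z : closed_strip z -> cabs (Phi z) <= M.
Proof.
move=> sz; rewrite -[Phi z]subr0; apply: (ctends_le (series_tends sz)) => n.
rewrite subr0 (le_trans (cabs_sum _ _ _))// (le_trans _ (series_le n))//.
by apply: ler_sum => j _; exact: term_le.
Qed.

Lemma cexp_continuous (b : R) z (eps : R) : 0 < eps -> exists2 d : R, 0 < d &
  forall w, cabs (w - z) <= d -> cabs (cexp (b%:C%C * w) - cexp (b%:C%C * z)) <= eps.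
Proof.
move=> e0.
pose K := 1 + expR (complex.Re (b%:C%C * z)).
have K0 : 0 < K by rewrite addr_gt0 ?expR_gt0.
have /cvgrPdist_le /(_ (eps / K)) : expR x @[x --> (0 : R)] --> expR 0.
  exact: continuous_expR.
rewrite divr_gt0// expR0 => /(_ isT) /nbhs_ballP[d /= d0 hd].
exists (d / (2 * (1 + `|b|))); first by rewrite divr_gt0// mulr_gt0// ltr_pwDl.
move=> w wz.
have -> : b%:C%C * w = b%:C%C * z + b%:C%C * (w - z) by ring.
rewrite cexpD -{2}[cexp (_ * z)]mulr1 -mulrBr cabsM cabs_cexp.
rewrite (@le_trans _ _ (K * (eps / K)))//; last by rewrite mulrC divfK ?gt_eqF.
apply: ler_pM; rewrite ?cabs_ge0 ?expR_ge0 ?lerDr//.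
rewrite (le_trans (cabs_cexpB1 _))//.
have := hd (cabs (b%:C%C * (w - z))).
rewrite /ball /= sub0r normrN distrC => /(_ _)/(le_trans (ler_norm _)); apply.
rewrite ger0_norm ?cabs_ge0// cabsM cabs_real.
have b1 : 0 < 1 + `|b| by rewrite ltr_pwDl.
apply: (@le_lt_trans _ _ ((1 + `|b|) * (d / (2 * (1 + `|b|))))).
  by apply: ler_pM; rewrite ?cabs_ge0// lerDr.
have -> : (1 + `|b|) * (d / (2 * (1 + `|b|))) = d / 2 by field; rewrite gt_eqF.
by rewrite ltr_pdivrMr// ltr_pMr// ltr1n.
Qed.

Lemma exp_series_continuous : strip_continuous Phi.
Proof.
have partial n : strip_continuous
    (fun z => \sum_(0 <= j < n) c j * cexp ((beta j)%:C%C * z)).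
  elim: n => [|n ih] z sz eps e0.
    by exists 1 => // w _ _; rewrite !big_geq// subrr cabs0 ltW.
  have e2 : 0 < eps / 2 by rewrite divr_gt0.
  have [d1 d10 h1] := ih z sz _ e2.
  have k0 : 0 < 1 + cabs (c n) by rewrite ltr_pwDl ?cabs_ge0.
  have e3 : 0 < eps / 2 / (1 + cabs (c n)) by rewrite divr_gt0.
  have [d2 d20 h2] := cexp_continuous (beta n) z e3.
  exists (Num.min d1 d2); first by rewrite lt_min d10.
  move=> w sw; rewrite le_min => /andP[w1 w2]; rewrite !big_nat_recr//=.
  set s := \sum_(_ <= _ < _) _; set t := \sum_(_ <= _ < _) _.
  have -> : s + c n * cexp ((beta n)%:C%C * w) - (t + c n * cexp ((beta n)%:C%C * z)) =
    (s - t) + c n * (cexp ((beta n)%:C%C * w) - cexp ((beta n)%:C%C * z)) by ring.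
  rewrite (le_trans (cabsD _ _))// (splitr eps) lerD ?h1// cabsM.
  rewrite (@le_trans _ _ ((1 + cabs (c n)) * (eps / 2 / (1 + cabs (c n)))))//.
    by apply: ler_pM; rewrite ?cabs_ge0 ?h2// lerDr.
  by rewrite mulrC divfK ?gt_eqF.
move=> z sz eps e0; have e3 : 0 < eps / 3 by rewrite divr_gt0.
have [N [_ hN]] := tail e3; have [d d0 hd] := partial N z sz _ e3.
exists d => // w sw wz; have := hd w sw wz.
have := hN N z (leqnn _) sz; have := hN N w (leqnn _) sw.
move: (\sum_(_ <= _ < _) _) (\sum_(_ <= _ < _) _) => t s sw' sz' st.
rewrite (le_trans (cabs_trans s _ _))// (le_trans (lerD sw' (cabs_trans t _ _)))//.
by rewrite [cabs (t - _)]cabsC; lra.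
Qed.

Lemma exp_series_analytic z0 : open_strip z0 -> analytic_at Phi z0.
Proof.
move=> /= /andP[x0 x1]; set x := complex.Re z0 in x0 x1.
(* Distance from z0 to the boundary of the strip. *)
pose r := Num.min x (1 - x).
have r0 : 0 < r by rewrite lt_min x0 subr_gt0.
have rx : r <= x by rewrite ge_min lexx.
have r1x : r <= 1 - x by rewrite ge_min lexx orbT.
(* Both x - s and x + s stay in [0, 1], so the majorant [D] survives a shift by up to r. This makes
   the double series in j and in the Taylor index absolutely convergent. *)
have shift_le j (s : R) : 0 <= s -> s <= r ->
    cabs (c j) * expR (beta j * x) * expR (`|beta j| * s) <= D j.
  move=> s0 sr; rewrite -mulrA -expRD ler_wpM2l ?cabs_ge0//.
  have [b0|b0] := leP 0 (beta j).
    rewrite ger0_norm// -mulrDr; apply: expR_strip; apply/andP; split; lra.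
  rewrite ltr0_norm//; have -> : beta j * x + - beta j * s = beta j * (x - s) by ring.
  apply: expR_strip; apply/andP; split; lra.
(* The k-th Taylor coefficient at z0 of the partial sum over j < m; its limit in m is the
   coefficient of the whole sum. *)
pose A k m : C := \sum_(0 <= j < m) c j * cexp ((beta j)%:C%C * z0) *
  ((beta j)%:C%C ^+ k / k`!%:R).
have /choice[a ha] : forall k, exists l, ctends (A k) l.
  move=> k; apply: (@abs_series_cvg _ _ (M / r ^+ k)) => n.
  rewrite ler_pdivlMr ?exprn_gt0// mulr_suml (le_trans _ (series_le n))//.
  apply: ler_sum => j _; rewrite 2!cabsM cabs_expcoef cabs_cexp Re_realM -/x.
  rewrite -[_ * _ * r ^+ k]mulrA; apply: le_trans (shift_le j r (ltW r0) (lexx _)).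
  rewrite ler_wpM2l ?mulr_ge0 ?cabs_ge0 ?expR_ge0//.
  rewrite cabs_real mulrAC -exprMn.
  apply: le_trans (@expsum_le_expR _ k.+1 _ _); last by rewrite mulr_ge0// ltW.
  rewrite /expsum big_nat_recr//= lerDr; apply: sumr_ge0 => i _.
  by rewrite divr_ge0// exprn_ge0// mulr_ge0// ltW.
exists r => //; exists a => z zr; set h := z - z0 in zr *.
have sumE K m : \sum_(0 <= k < K) A k m * h ^+ k = \sum_(0 <= j < m)
    c j * cexp ((beta j)%:C%C * z0) * expsum K ((beta j)%:C%C * h).
  under eq_bigr do rewrite mulr_suml.
  rewrite exchange_big /=; apply: eq_bigr => j _.
  by rewrite mulr_sumr; apply: eq_bigr => k _; rewrite exprMn; ring.
have sz : closed_strip z.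
  have := le_trans (Re_le_cabs h) (ltW zr); rewrite ReB -/x ler_norml => /andP[h1 h2].
  by apply/andP; split; lra.
(* Three errors of eps / 3: the Taylor polynomial of the whole series against that of its first N
   terms, uniformly in the degree; the Taylor error of these N terms; the tail of the series beyond
   N. *)
apply: ctends_cvg => eps e0.
have e3 : 0 < eps / 3 by rewrite divr_gt0.
have [N [hD hN]] := tail e3.
have step3 : ctends (fun K => \sum_(0 <= k < K) A k N * h ^+ k)
    (\sum_(0 <= j < N) c j * cexp ((beta j)%:C%C * z)).
  have -> : (fun K => \sum_(0 <= k < K) A k N * h ^+ k) = (fun K => \sum_(0 <= j < N)
      c j * cexp ((beta j)%:C%C * z0) * expsum K ((beta j)%:C%C * h)).
    by apply/funext => K; rewrite sumE.
  have -> : \sum_(0 <= j < N) c j * cexp ((beta j)%:C%C * z) = \sum_(0 <= j < N)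
      c j * cexp ((beta j)%:C%C * z0) * cexp ((beta j)%:C%C * h).
    apply: eq_bigr => j _; rewrite -mulrA -cexpD /h; congr (_ * cexp _); ring.
  apply: ctends_sum => j; apply: ctendsM; first exact: ctends_cst.
  exact: expsum_tends.
have [K0 hK0] := step3 _ e3; exists K0 => K K0K.
have step2 : cabs (\sum_(0 <= k < K) a k * h ^+ k - \sum_(0 <= k < K) A k N * h ^+ k)
    <= eps / 3.
  have lim_m : ctends (fun m => \sum_(0 <= k < K) A k m * h ^+ k)
      (\sum_(0 <= k < K) a k * h ^+ k).
    by apply: ctends_sum => k; apply: ctendsM => //; exact: ctends_cst.
  apply: (ctends_shift_le (n0 := N) lim_m) => m Nm.
  rewrite !sumE (@big_cat_nat _ _ _ N 0 m)//= addrAC subrr add0r.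
  rewrite (le_trans (cabs_sum _ _ _))// (le_trans _ (hD N m (leqnn _) Nm))//.
  apply: ler_sum => j _; rewrite 2!cabsM cabs_cexp Re_realM -/x.
  apply: le_trans (shift_le j (cabs h) (cabs_ge0 _) (ltW zr)).
  rewrite ler_wpM2l ?mulr_ge0 ?cabs_ge0 ?expR_ge0//.
  rewrite (le_trans (cabs_expsum _ _))// cabsM cabs_real expsum_le_expR//.
  by rewrite mulr_ge0// cabs_ge0.
have := hK0 K K0K; have := hN N z (leqnn _) sz; move: step2.
set s := \sum_(0 <= k < K) a k * h ^+ k.
set t := \sum_(0 <= k < K) A k N * h ^+ k.
set u := \sum_(0 <= j < N) _ => st zu tu.
rewrite (le_trans (cabs_trans t _ _))// (le_trans (lerD st (cabs_trans u _ _)))//.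
by rewrite [cabs (u - _)]cabsC; lra.
Qed.

End series.

End exponential_series.

Section taylor_expansions.
Context {R : realType}.
Local Notation C := R[i].
Implicit Types (z h : C) (Phi Psi rho : C -> C).

Definition bounded_near0 rho : Prop := exists M : R, exists2 d : R, 0 < d &
  forall h, cabs h <= d -> cabs (rho h) <= M.

Lemma bounded_near0_cst (c : C) : bounded_near0 (fun=> c).
Proof. by exists (cabs c); exists 1. Qed.

Lemma bounded_near0_id : bounded_near0 id.
Proof. by exists 1; exists 1. Qed.

Lemma bounded_near0D rho1 rho2 : bounded_near0 rho1 -> bounded_near0 rho2 ->
  bounded_near0 (fun h => rho1 h + rho2 h).
Proof.
move=> [M1 [d1 d10 h1]] [M2 [d2 d20 h2]]; exists (M1 + M2).
exists (Num.min d1 d2) => [|h]; first by rewrite lt_min d10.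
rewrite le_min => /andP[hd1 hd2]; rewrite (le_trans (cabsD _ _))//.
by rewrite lerD ?h1 ?h2.
Qed.

Lemma bounded_near0M rho1 rho2 : bounded_near0 rho1 -> bounded_near0 rho2 ->
  bounded_near0 (fun h => rho1 h * rho2 h).
Proof.
move=> [M1 [d1 d10 h1]] [M2 [d2 d20 h2]]; exists (M1 * M2).
exists (Num.min d1 d2) => [|h]; first by rewrite lt_min d10.
rewrite le_min => /andP[hd1 hd2].
by rewrite cabsM ler_pM ?cabs_ge0 ?h1 ?h2.
Qed.

Definition taylor2 Phi z0 : Prop := exists a b : C, exists2 rho : C -> C,
  bounded_near0 rho &
  forall h, Phi (z0 + h) = Phi z0 + a * h + b * h ^+ 2 + h ^+ 3 * rho h.

Lemma taylor2_cst (c : C) z0 : taylor2 (fun=> c) z0.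
Proof.
exists 0, 0; exists (fun=> 0); first exact: bounded_near0_cst.
by move=> h; ring.
Qed.

Lemma taylor2D Phi Psi z0 : taylor2 Phi z0 -> taylor2 Psi z0 ->
  taylor2 (fun z => Phi z + Psi z) z0.
Proof.
move=> [a [b [rho brho h1]]] [c [d [sig bsig h2]]].
exists (a + c), (b + d); exists (fun h => rho h + sig h).
  exact: bounded_near0D.
by move=> h; rewrite h1 h2; ring.
Qed.

Lemma taylor2M Phi Psi z0 : taylor2 Phi z0 -> taylor2 Psi z0 ->
  taylor2 (fun z => Phi z * Psi z) z0.
Proof.
move=> [a [b [rho brho h1]]] [c [d [sig bsig h2]]].
exists (Phi z0 * c + a * Psi z0), (Phi z0 * d + a * c + b * Psi z0).
exists (fun h => (a * d + b * c) + b * d * h +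
  ((Phi z0 + a * h + b * (h * h)) * sig h +
   rho h * (Psi z0 + c * h + d * (h * h) + h * (h * h) * sig h))).
  by do ?[apply: bounded_near0D | apply: bounded_near0M | exact: bounded_near0_cst |
          exact: bounded_near0_id | by []].
by move=> h; rewrite h1 h2; ring.
Qed.

Lemma geometric_le2 (x : R) n : 0 <= x -> x <= 2^-1 -> \sum_(0 <= k < n) x ^+ k <= 2.
Proof.
move=> x0 x2; elim: n => [|n ih]; first by rewrite big_geq.
rewrite big_nat_recl//= expr0.
have -> : \sum_(0 <= i < n) x ^+ i.+1 = x * \sum_(0 <= i < n) x ^+ i.
  by rewrite mulr_sumr; apply: eq_bigr => k _; rewrite exprS.
have : 0 <= \sum_(0 <= i < n) x ^+ i by apply: sumr_ge0 => i _; rewrite exprn_ge0.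
move: (\sum_(_ <= _ < _) _) ih => s s2 s0.
have : x * s <= 2^-1 * 2 by apply: ler_pM.
lra.
Qed.

(** At s = r / 2 the terms a_n s^n are bounded, being differences of partial sums of a convergent
    series. For |h| <= s / 2 the remainder after the quadratic term is then dominated by a geometric
    series of ratio at most 1/2. *)
Lemma analytic_taylor2 Phi z0 : analytic_at Phi z0 -> taylor2 Phi z0.
Proof.
move=> [r r0 [a ha]].
have {}ha h : cabs h < r -> ctends (fun n => \sum_(0 <= k < n) a k * h ^+ k) (Phi (z0 + h)).
  move=> hr; have := ha (z0 + h); rewrite [z0 + h]addrC addrK => /(_ hr).
  exact: cvg_ctends.
pose s := r / 2; have s0 : 0 < s by rewrite divr_gt0.
have [B hB] : exists B, forall n, cabs (a n) * s ^+ n <= B.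
  have sr : cabs (s%:C%C : C) < r.
    by rewrite cabs_real gtr0_norm// ltr_pdivrMr// ltr_pMr// ltr1n.
  have [N hN] := ha _ sr _ ltr01.
  have nn k : 0 <= cabs (a k) * s ^+ k by rewrite mulr_ge0 ?cabs_ge0// exprn_ge0// ltW.
  exists (2 + \sum_(0 <= k < N) cabs (a k) * s ^+ k) => n; have [nN|Nn] := ltnP n N.
    rewrite (@le_trans _ _ (\sum_(0 <= k < N) cabs (a k) * s ^+ k))// ?lerDr//.
    rewrite (@big_cat_nat _ _ _ n.+1)//= big_nat_recr//= addrAC addrC lerDl.
    by rewrite addr_ge0// sumr_ge0.
  rewrite (@le_trans _ _ 2)// ?lerDl ?sumr_ge0//.
  have -> : cabs (a n) * s ^+ n = cabs (a n * s%:C%C ^+ n).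
    by rewrite cabsM cabsX cabs_real gtr0_norm.
  have h1 := hN _ Nn; have h2 := hN _ (leqW Nn).
  have := cabs_trans (Phi (z0 + s%:C%C)) (\sum_(0 <= k < n.+1) a k * s%:C%C ^+ k)
    (\sum_(0 <= k < n) a k * s%:C%C ^+ k).
  rewrite [X in X - _]big_nat_recr//= addrAC subrr add0r => /le_trans; apply.
  by rewrite [X in _ + X]cabsC; lra.
have B0 : 0 <= B by rewrite (le_trans _ (hB 0%N))// expr0 mulr1 cabs_ge0.
have a0E : a 0%N = Phi z0.
  have := ha 0; rewrite cabs0 addr0 => /(_ r0); apply: ctends_unique.
  move=> eps e0; exists 1%N => -[//|n] _; rewrite big_nat_recl// expr0 mulr1 big1.
    by rewrite addr0 subrr cabs0 ltW.
  by move=> i _; rewrite exprS mul0r mulr0.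
exists (a 1%N), (a 2%N).
(* At h = 0 the quotient is 0 by the convention for inverses, and the expansion holds trivially. *)
exists (fun h => (Phi (z0 + h) - Phi z0 - a 1%N * h - a 2%N * h ^+ 2) / h ^+ 3); last first.
  move=> h; have [->|h0] := eqVneq h 0; last by field.
  by rewrite addr0 expr0n /=; ring.
exists (2 * B / s ^+ 3); exists (s / 2) => [|h hs]; first by rewrite divr_gt0.
have [->|h0] := eqVneq h 0.
  rewrite !expr0n /= invr0 mulr0 cabs0.
  by apply: divr_ge0; [exact: mulr_ge0|exact/exprn_ge0/ltW].
have ch0 : 0 < cabs h.
  by rewrite lt_neqAle cabs_ge0 andbT eq_sym; apply: contra h0 => /eqP/cabs_eq0 ->.
rewrite cabsM cabsV cabsX ler_pdivrMr ?exprn_gt0//.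
have -> : Phi (z0 + h) - Phi z0 - a 1%N * h - a 2%N * h ^+ 2 =
    Phi (z0 + h) - (Phi z0 + a 1%N * h + a 2%N * h ^+ 2) by ring.
have hr : cabs h < r.
  by rewrite (le_lt_trans hs)// /s; move: r0; lra.
apply: (ctends_shift_le (n0 := 3%N) (ha _ hr)) => -[//|[//|[//|n]]] _.
rewrite !big_nat_recl//= a0E expr0 mulr1 expr1.
set t := \sum_(_ <= _ < _) _; have -> : Phi z0 + (a 1%N * h + (a 2%N * h ^+ 2 + t)) -
  (Phi z0 + a 1%N * h + a 2%N * h ^+ 2) = t by ring.
rewrite (le_trans (cabs_sum _ _ _))//.
pose x := cabs h / s.
have x0 : 0 <= x by rewrite divr_ge0 ?cabs_ge0 ?ltW.
have x2 : x <= 2^-1 by rewrite ler_pdivrMr// mulrC.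
apply: (@le_trans _ _ (\sum_(0 <= k < n) B * x ^+ 3 * x ^+ k)).
  apply: ler_sum => k _; rewrite cabsM cabsX -mulrA -exprD.
  have -> : cabs h = s * x by rewrite /x mulrC divfK// gt_eqF.
  by rewrite exprMn mulrA ler_wpM2r ?exprn_ge0// hB.
rewrite -mulr_sumr (@le_trans _ _ (B * x ^+ 3 * 2))//.
  rewrite ler_wpM2l ?geometric_le2// mulr_ge0 ?exprn_ge0//.
by rewrite /x expr_div_n; move: (s ^+ 3)^-1 (cabs h ^+ 3) => u v; lra.
Qed.

(** The hypotheses of the three lines theorem, in a form stable under sums and products. *)
Definition strip_regular Phi : Prop :=
  [/\ strip_continuous Phi,
      exists M : R, forall z, closed_strip z -> cabs (Phi z) <= M
    & forall z, open_strip z -> taylor2 Phi z].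

Lemma strip_regular_cst (c : C) : strip_regular (fun=> c).
Proof.
split.
- by move=> z _ eps e0; exists 1 => // w _ _; rewrite subrr cabs0 ltW.
- by exists (cabs c).
- by move=> z _; exact: taylor2_cst.
Qed.

Lemma strip_regularD Phi Psi : strip_regular Phi -> strip_regular Psi ->
  strip_regular (fun z => Phi z + Psi z).
Proof.
move=> [c1 [M1 b1] t1] [c2 [M2 b2] t2]; split.
- move: c1 c2 => /strip_continuousP c1 /strip_continuousP c2.
  by apply/strip_continuousP => z; apply: cvgD; [exact: c1|exact: c2].
- by exists (M1 + M2) => z sz; rewrite (le_trans (cabsD _ _))// lerD ?b1 ?b2.
- by move=> z sz; apply: taylor2D; [exact: t1|exact: t2].
Qed.

Lemma strip_regularM Phi Psi : strip_regular Phi -> strip_regular Psi ->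
  strip_regular (fun z => Phi z * Psi z).
Proof.
move=> [c1 [M1 b1] t1] [c2 [M2 b2] t2]; split.
- move: c1 c2 => /strip_continuousP c1 /strip_continuousP c2.
  by apply/strip_continuousP => z; apply: cvgM; [exact: c1|exact: c2].
- by exists (M1 * M2) => z sz; rewrite cabsM ler_pM ?cabs_ge0 ?b1 ?b2.
- by move=> z sz; apply: taylor2M; [exact: t1|exact: t2].
Qed.

Lemma strip_regular_sum (I : Type) (s : seq I) (P : I -> C -> C) :
  (forall i, strip_regular (P i)) -> strip_regular (fun z => \sum_(i <- s) P i z).
Proof.
move=> hP; elim: s => [|i s ih].
  by under eq_fun do rewrite big_nil; exact: strip_regular_cst.
by under eq_fun do rewrite big_cons; exact: strip_regularD.
Qed.

Lemma strip_regular_cexp (b : R) : strip_regular (fun z => cexp (b%:C%C * z)).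
Proof.
(* A single exponential is treated as an exponential series whose only nonzero term has index 0. *)
pose c (j : nat) : C := (j == 0%N)%:R.
have cE n (f : nat -> C) : \sum_(0 <= j < n.+1) c j * f j = f 0%N.
  by rewrite big_nat_recl// big1 ?addr0 ?mul1r// => i _; rewrite mul0r.
have le1 n : \sum_(0 <= j < n) cabs (c j) * (1 + expR b) <= 1 + expR b.
  case: n => [|n]; first by rewrite big_geq// addr_ge0// expR_ge0.
  rewrite big_nat_recl// big1 ?addr0 ?cabs1 ?mul1r// => i _.
  by rewrite cabs0 mul0r.
have tends z : closed_strip z -> ctends (fun n => \sum_(0 <= j < n) c j *
    cexp (b%:C%C * z)) (cexp (b%:C%C * z)).
  by move=> _ eps e0; exists 1%N => -[//|n] _; rewrite cE subrr cabs0 ltW.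
split.
- exact: (exp_series_continuous le1 tends).
- by exists (1 + expR b) => z; exact: (exp_series_bounded le1 tends).
- by move=> z sz; apply: analytic_taylor2; exact: (exp_series_analytic le1 tends).
Qed.

End taylor_expansions.

(** * The three lines theorem *)

Section three_lines.
Context {R : realType}.
Local Notation C := R[i].

Lemma sqr_sub_le (a b c : R) : 0 <= a -> 0 <= b -> 0 <= c -> b - c <= a ->
  b ^+ 2 - 2 * b * c <= a ^+ 2.
Proof.
move=> a0 b0 c0 abc; have [bc|bc] := leP b c.
  rewrite (@le_trans _ _ 0)// ?sqr_ge0// subr_le0 expr2 -mulrA mulrCA.
  by rewrite ler_wpM2l// (le_trans bc)// ler_peMl// ler1n.
have : (b - c) ^+ 2 <= a ^+ 2 by rewrite ler_pXn2r// nnegrE// subr_ge0 ltW.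
by have := sqr_ge0 c; rewrite sqrrB => h1 h2; lra.
Qed.

Lemma cvg_sqr (T : Type) (F : set_system T) (f : T -> R) (l : R) : Filter F ->
  f @ F --> l -> f x ^+ 2 @[x --> F] --> l ^+ 2.
Proof. by move=> FF fl; exact: (cvgM fl fl). Qed.

(** Over t, -t, it, -it all cross terms cancel and the sum is 4 |f|^2 + 4 t^2 |a|^2 + 4 t^4 |b|^2: a
    discrete form of the subharmonicity of |Phi|^2. *)
Lemma four_point_mean (f a b : C) (t : R) : 4 * cabs f ^+ 2 <=
  \sum_(h <- [:: t%:C%C; (- t)%:C%C; Complex 0 t; Complex 0 (- t)])
    cabs (f + a * h + b * h ^+ 2) ^+ 2.
Proof.
rewrite !big_cons big_nil !cabs_sqr; case: f a b => [f1 f2] [a1 a2] [b1 b2] /=.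
set s := (X in _ <= X).
have -> : s = 4 * (f1 ^+ 2 + f2 ^+ 2) + 4 * t ^+ 2 * (a1 ^+ 2 + a2 ^+ 2) +
    4 * (t ^+ 2) ^+ 2 * (b1 ^+ 2 + b2 ^+ 2) by rewrite /s; ring.
rewrite -addrA lerDl addr_ge0//; by do ?[exact: sqr_ge0 | by [] | apply: mulr_ge0 | apply: addr_ge0].
Qed.

(* At an interior maximum of |Phi|^2 - eta (y^2 - 2 x^2 + 2) the mean of this
   function over the four points z0 + h, h = t, -t, it, -it, would exceed its
   value at z0 by about eta t^2 / 2. *)
Theorem three_lines (Phi : C -> C) (B : R) : strip_regular Phi -> 0 <= B ->
  (forall t : R, cabs (Phi (Complex 0 t)) <= B) ->
  (forall t : R, cabs (Phi (Complex 1 t)) <= B) ->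
  forall z, closed_strip z -> cabs (Phi z) <= B.
Proof.
move=> [cPhi [M0 bPhi] tPhi] B0 h0 h1 z1 sz1; rewrite leNgt; apply/negP => Bz1.
pose M := `|M0|.
have {}bPhi z : closed_strip z -> cabs (Phi z) <= M.
  by move=> /bPhi /le_trans; apply; exact: ler_norm.
have M_ge0 : 0 <= M by exact: normr_ge0.
move: z1 sz1 Bz1 => [x1 y1] sz1 Bz1.
have gap : 0 < cabs (Phi (Complex x1 y1)) ^+ 2 - B ^+ 2.
  by rewrite subr_gt0 ltr_pXn2r// nnegrE ?cabs_ge0.
(* The penalty at the point x1 + i y1 is at most eta (y1^2 + 2), which is half of the gap. *)
pose eta := (cabs (Phi (Complex x1 y1)) ^+ 2 - B ^+ 2) / (2 * (y1 ^+ 2 + 2)).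
have y2 : 0 < y1 ^+ 2 + 2 by rewrite ltr_wpDl ?sqr_ge0.
have eta0 : 0 < eta by rewrite divr_gt0// mulr_gt0.
(* Its Laplacian is -2 eta < 0, so subtracting it keeps a strict form of subharmonicity; on the
   strip it is at least eta y^2, which confines the maximum to a rectangle. *)
pose pen (x y : R) := eta * (y ^+ 2 - 2 * x ^+ 2 + 2).
pose v (p : R * R) := cabs (Phi (Complex p.1 p.2)) ^+ 2 - pen p.1 p.2.
have v1 : B ^+ 2 < v (x1, y1).
  have etaE : eta * (y1 ^+ 2 + 2) = (cabs (Phi (Complex x1 y1)) ^+ 2 - B ^+ 2) / 2.
    by rewrite /eta; field; rewrite gt_eqF.
  rewrite /v /pen /=.
  have : 0 <= eta * (2 * x1 ^+ 2) by rewrite mulr_ge0 ?(ltW eta0)// mulr_ge0 ?sqr_ge0.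
  have -> : eta * (y1 ^+ 2 - 2 * x1 ^+ 2 + 2) = eta * (y1 ^+ 2 + 2) - eta * (2 * x1 ^+ 2).
    by ring.
  by rewrite etaE; move: gap; lra.
(* At heights at least Y the penalty is at least M^2, because eta Y >= M^2 and Y >= 1. *)
pose Y := `|y1| + M ^+ 2 / eta + 1.
have Y0 : 1 <= Y by rewrite lerDr addr_ge0// divr_ge0 ?sqr_ge0// ltW.
have pen_ge0 x y : 0 <= x <= 1 -> eta * y ^+ 2 <= pen x y.
  move=> /andP[x0 xl]; rewrite /pen ler_wpM2l ?(ltW eta0)//.
  have : x ^+ 2 <= 1 by rewrite expr_le1.
  lra.
pose A : set (R * R) := `[0, 1]%classic `*` `[- Y, Y]%classic.
have cA : compact A by apply: compact_setX; exact: segment_compact.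
have y1Y : `|y1| <= Y.
  by rewrite /Y -addrA lerDl addr_ge0// divr_ge0 ?sqr_ge0// ltW.
have x1A : A (x1, y1).
  by split; rewrite /= in_itv /= -?ler_norml.
have AS p : A p -> closed_strip (Complex p.1 p.2 : C).
  by move=> [] /=; rewrite in_itv.
have cv : {within A, continuous v}.
  apply/subspace_continuousP => -[x y] Axy.
  have -> : v = (fun p => cabs (Phi (Complex p.1 p.2)) ^+ 2) \- (fun p => pen p.1 p.2) by [].
  have c1 : p.1 @[p --> within A (nbhs (x, y))] --> x.
    by apply: cvg_within_filter; exact: cvg_fst.
  have c2 : p.2 @[p --> within A (nbhs (x, y))] --> y.
    by apply: cvg_within_filter; exact: cvg_snd.
  apply: cvgB; last first.
    apply: cvgMr; apply: cvgD; last exact: cvg_cst.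
    apply: cvgB; first exact: cvg_sqr.
    by apply: cvgMr; exact: cvg_sqr.
  apply: cvg_sqr.
  apply/cvgrPdist_le => /= eps e0.
  have [d d0 hd] := cPhi _ (AS _ Axy) _ e0.
  have d2 : 0 < d / 2 by rewrite divr_gt0.
  near=> p.
  have Ap : A p by near: p; exact: withinT.
  have : cabs (Phi (Complex p.1 p.2) - Phi (Complex x y)) <= eps.
    apply: hd; first exact: AS.
    rewrite (le_trans (cabs_le_ReIm _))//= (splitr d) lerD//.
      by rewrite distrC; near: p; move/cvgrPdist_le : c1; exact.
    by rewrite distrC; near: p; move/cvgrPdist_le : c2; exact.
  apply: le_trans; rewrite ler_norml; apply/andP; split.
    have := cabsD (Phi (Complex p.1 p.2) - Phi (Complex x y)) (Phi (Complex x y)).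
    by rewrite subrK; lra.
  have := cabsD (Phi (Complex x y) - Phi (Complex p.1 p.2)) (Phi (Complex p.1 p.2)).
  by rewrite subrK [X in _ <= X + _]cabsC; lra.
have [[x0 y0]] := compact_EVT_max (ex_intro _ _ x1A) cA cv.
rewrite inE => A0 hmax.
have {}hmax p : A p -> v p <= v (x0, y0) by move=> Ap; apply: hmax; rewrite inE.
have v0 : B ^+ 2 < v (x0, y0) by rewrite (lt_le_trans v1)// hmax.
have /andP[x00 x01] : 0 <= x0 <= 1 by have := A0.1; rewrite /= in_itv.
have /andP[y0l y0r] : - Y <= y0 <= Y by have := A0.2; rewrite /= in_itv.
have v_le x y (D : R) : 0 <= D -> 0 <= x <= 1 -> cabs (Phi (Complex x y)) <= D ->
    v (x, y) <= D ^+ 2 - eta * y ^+ 2.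
  move=> D0 xx hD; rewrite /v /= lerB ?pen_ge0// ler_pXn2r// nnegrE ?cabs_ge0//.
have y2_ge0 y : 0 <= eta * y ^+ 2 by rewrite mulr_ge0 ?sqr_ge0// ltW.
have x0n0 : x0 != 0.
  apply/negP => /eqP x0E; move: v0; rewrite x0E ltNge (le_trans (v_le _ _ B B0 _ (h0 _)))//.
    by rewrite lexx ler01.
  by rewrite gerBl.
have x0n1 : x0 != 1.
  apply/negP => /eqP x0E; move: v0; rewrite x0E ltNge (le_trans (v_le _ _ B B0 _ (h1 _)))//.
    by rewrite lexx ler01.
  by rewrite gerBl.
have vY y : 0 <= x0 <= 1 -> Y ^+ 2 <= y ^+ 2 -> v (x0, y) <= 0.
  move=> xx Yy; have := v_le x0 y M M_ge0 xx (bPhi (Complex x0 y) xx).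
  move=> /le_trans; apply; rewrite subr_le0.
  apply: (@le_trans _ _ (eta * Y ^+ 2)); last by rewrite ler_wpM2l// ltW.
  apply: (@le_trans _ _ (eta * Y)).
    rewrite mulrC -ler_pdivrMr// /Y [`|y1| + _]addrC -addrA lerDl addr_ge0//.
  by rewrite ler_wpM2l ?(ltW eta0)// expr2 ler_peMl// (le_trans ler01).
have vpos : 0 < v (x0, y0) by rewrite (le_lt_trans _ v0)// sqr_ge0.
have y0nY : y0 != Y.
  apply/negP => /eqP yE; move: vpos; rewrite ltNge vY ?yE//; exact/andP.
have y0nNY : y0 != - Y.
  apply/negP => /eqP yE; move: vpos; rewrite ltNge vY ?yE ?sqrrN//; exact/andP.
have {}x00 : 0 < x0 by rewrite lt_neqAle eq_sym x0n0.
have {}x01 : x0 < 1 by rewrite lt_neqAle x0n1.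
have {}y0l : - Y < y0 by rewrite lt_neqAle eq_sym y0nNY.
have {}y0r : y0 < Y by rewrite lt_neqAle y0nY.
pose z0 : C := Complex x0 y0.
have [a [b [rho [Mr [d d0 hrho]] taylorE]]] : taylor2 Phi z0.
  by apply: tPhi; apply/andP.
pose K := cabs (Phi z0) + cabs a + cabs b.
have K0 : 0 <= K by rewrite !addr_ge0 ?cabs_ge0.
have Mr0 : 0 <= Mr.
  by rewrite (le_trans (cabs_ge0 (rho 0)))// hrho// cabs0 ltW.
(* The cubic errors at the four points add up to at most 8 K Mr t^3, against a gain of 2 eta t^2;
   the summand 1 makes the contradiction strict. *)
pose L := 4 * K * Mr + 1.
have L0 : 0 < L by rewrite ltr_wpDl// !mulr_ge0.
have [t [t0 t1 td [tx tx1 ty tY] tL]] : exists t : R, [/\ 0 < t, t <= 1, t <= d,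
    [/\ t <= x0, t <= 1 - x0, t <= y0 + Y & t <= Y - y0] & t * L <= eta].
  pose t := Num.min 1 (Num.min d (Num.min x0 (Num.min (1 - x0)
    (Num.min (y0 + Y) (Num.min (Y - y0) (eta / L)))))).
  have := lexx t; rewrite {2}/t !le_min => /and3P[p1 p2 /and3P[p3 p4 /and3P[p5 p6 p7]]].
  exists t; split=> //; last by rewrite -ler_pdivlMr.
  rewrite !lt_min ltr01 d0 x00 divr_gt0// andbT !subr_gt0 x01 y0r /= andbT.
  by rewrite -(opprK Y) subr_gt0.
pose hs : seq C := [:: t%:C%C; (- t)%:C%C; Complex 0 t; Complex 0 (- t)].
have hs_cabs k : k \in hs -> cabs k = t.
  rewrite !inE => /or4P[] /eqP ->; rewrite ?cabs_real ?normrN ?gtr0_norm//;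
    by rewrite /cabs /= expr0n /= add0r ?sqrrN sqrtr_sqr gtr0_norm.
have point h : h \in hs ->
    cabs (Phi z0 + a * h + b * h ^+ 2) ^+ 2 - 2 * K * Mr * t ^+ 3 <= cabs (Phi (z0 + h)) ^+ 2.
  move=> hh; have ht := hs_cabs h hh.
  set P := Phi z0 + a * h + b * h ^+ 2.
  have PK : cabs P <= K.
    rewrite (le_trans (cabsD _ _))// lerD//; last first.
      by rewrite cabsM cabsX ht ler_piMr ?cabs_ge0// expr_le1// ltW.
    by rewrite (le_trans (cabsD _ _))// lerD// cabsM ht ler_piMr ?cabs_ge0.
  have err : cabs (h ^+ 3 * rho h) <= Mr * t ^+ 3.
    by rewrite cabsM cabsX ht mulrC ler_wpM2r ?exprn_ge0 ?(ltW t0)// hrho// ht.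
  have := @sqr_sub_le (cabs (Phi (z0 + h))) (cabs P) (cabs (h ^+ 3 * rho h)).
  rewrite !cabs_ge0 => /(_ isT isT isT) hh'; apply: le_trans (hh' _); last first.
    rewrite lerBlDr taylorE -/P.
    have := cabsB (P + h ^+ 3 * rho h) (h ^+ 3 * rho h).
    by rewrite addrK.
  rewrite lerB// -(mulrA (2 * K)) ler_pM ?mulr_ge0 ?cabs_ge0//.
  by rewrite ler_wpM2l.
have hsA h : h \in hs -> A (complex.Re (z0 + h), complex.Im (z0 + h)).
  move=> hh; split; rewrite /= in_itv /=; apply/andP; move: hh;
    rewrite !inE => /or4P[] /eqP -> /=; split;
    clear -t0 tx tx1 ty tY; lra.
have vsum : \sum_(h <- hs) v (complex.Re (z0 + h), complex.Im (z0 + h)) <= 4 * v (x0, y0).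
  rewrite (_ : 4 * v (x0, y0) = \sum_(h <- hs) v (x0, y0)).
    by rewrite !big_seq; apply: ler_sum => h hh; apply: hmax; exact: hsA.
  by rewrite !big_cons big_nil; ring.
have psum : \sum_(h <- hs) pen (complex.Re (z0 + h)) (complex.Im (z0 + h)) =
    4 * pen x0 y0 - 2 * eta * t ^+ 2.
  by rewrite !big_cons big_nil /pen /=; ring.
have fsum : 4 * cabs (Phi z0) ^+ 2 - 8 * K * Mr * t ^+ 3 <=
    \sum_(h <- hs) cabs (Phi (z0 + h)) ^+ 2.
  apply: (@le_trans _ _ (\sum_(h <- hs)
      (cabs (Phi z0 + a * h + b * h ^+ 2) ^+ 2 - 2 * K * Mr * t ^+ 3))).
    rewrite sumrB lerB ?four_point_mean// !big_cons big_nil.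
    by rewrite le_eqVlt; apply/orP; left; apply/eqP; ring.
  by rewrite !big_seq; apply: ler_sum => h; exact: point.
have vE : \sum_(h <- hs) v (complex.Re (z0 + h), complex.Im (z0 + h)) =
    \sum_(h <- hs) cabs (Phi (z0 + h)) ^+ 2 -
    \sum_(h <- hs) pen (complex.Re (z0 + h)) (complex.Im (z0 + h)).
  rewrite -sumrB; apply: eq_bigr => h _; rewrite /v /=; congr (cabs (Phi _) ^+ 2 - _).
  by case: h.
move: vsum; rewrite vE psum /v /= => vsum.
have : 2 * t ^+ 2 * (eta - t * L) <= - 2 * t ^+ 3.
  move: vsum fsum; rewrite /L; move: (\sum_(_ <- _) _) => S; rewrite !exprS expr0.
  by rewrite -/z0; lra.
have : 0 <= 2 * t ^+ 2 * (eta - t * L).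
  by rewrite mulr_ge0 ?subr_ge0// mulr_ge0// sqr_ge0.
have : 0 < t ^+ 3 by rewrite exprn_gt0.
lra.
Unshelve. all: by end_near. Qed.

End three_lines.

(** * The tree and its weights *)

Section tree_geometry.
Context {X : pointedType}.
Variables (q : nat) (e : rel X) (o : X).
Hypothesis tree_e : homogeneous_tree q e.
Implicit Types (x y v : X).

Local Notation p := (pred_vertex e o).
Local Notation lev := (gdist e o).

Lemma gdist_walk x : has_walk e o x (lev x) /\
  forall m, has_walk e o x m -> (lev x <= m)%N.
Proof.
have [_ _ conn _ _] := tree_e; have [s sp sl] := conn o x.
have ex : exists n, `[< has_walk e o x n >] by exists (size s); apply/asboolP; exists s.
rewrite /gdist; apply: (@xgetPex _ 0%N [set n | has_walk e o x n /\
  forall m, has_walk e o x m -> (n <= m)%N]).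
have [n /asboolP wn nmin] := ex_minnP ex; exists n; split=> // m wm.
by apply: nmin; apply/asboolP.
Qed.

Lemma gdist_le s x : path e o s -> last o s = x -> (lev x <= size s)%N.
Proof. by move=> sp sl; apply: (gdist_walk x).2; exists s. Qed.

Lemma gdist0 : lev o = 0%N.
Proof. by apply/eqP; rewrite -leqn0; exact: (@gdist_le [::]). Qed.

Lemma gdist_eq0 x : lev x = 0%N -> x = o.
Proof.
move=> x0; have [[s [_ sl ss]] _] := gdist_walk x.
by move: ss sl; rewrite x0 => /size0nil -> /= ->.
Qed.

Lemma pred_vertex_origin : p o = o.
Proof. by apply: xgetPN => x [_]; rewrite gdist0. Qed.

Lemma pred_vertexP x : x <> o -> e x (p x) /\ (lev (p x)).+1 = lev x.
Proof.
move=> xo; have [sym_e _ _ _ _] := tree_e.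
apply: (@xgetPex _ o [set y | e x y /\ (lev y).+1 = lev x]).
have [[s [sp sl ss]] smin] := gdist_walk x.
case/lastP: s sp sl ss => [|s z]; first by move=> _ /= /esym.
rewrite rcons_path last_rcons size_rcons => /andP[sp ez] zx ss.
rewrite zx in ez; exists (last o s); split; first by rewrite sym_e.
apply/eqP; rewrite eqn_leq; apply/andP; split.
  by rewrite -ss ltnS; exact: gdist_le.
have [[t [tp tl ts]] _] := gdist_walk (last o s).
rewrite -ts; have := @gdist_le (rcons t x) x; rewrite size_rcons; apply.
  by rewrite rcons_path tp tl.
by rewrite last_rcons.
Qed.

Lemma gdist_pred x : lev (p x) = (lev x).-1.
Proof.
have [->|xo] := pselect (x = o); first by rewrite pred_vertex_origin gdist0.
by have [_ <-] := pred_vertexP xo.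
Qed.

Lemma gdist_iter l x : lev (iter l p x) = (lev x - l)%N.
Proof.
by elim: l => [|l ih]; rewrite ?subn0// iterS gdist_pred ih subnS.
Qed.

Lemma iter_pred_origin l : iter l p o = o.
Proof. by elim: l => [//|l ih]; rewrite iterS ih pred_vertex_origin. Qed.

Lemma iter_pred_gdist x : iter (lev x) p x = o.
Proof. by apply: gdist_eq0; rewrite gdist_iter subnn. Qed.

(** The list is filtered from the q + 1 neighbours of v. Away from the origin [p v] is a neighbour
    that fails the filter, since [p (p v) = v] would contradict the levels. *)
Lemma children_exist v : exists s : seq X, [/\ uniq s, (size s <= q.+1)%N,
  v <> o -> (size s <= q)%N & forall y, y \in s <-> y <> o /\ p y = v].
Proof.
have [sym_e _ _ _ deg_e] := tree_e.
have /card_esym /card_set_bijP[f [fS fI fSurj]] := deg_e v.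
pose nbr := map f (iota 0 q.+1).
have nbr_uniq : uniq nbr.
  rewrite map_inj_in_uniq ?iota_uniq// => i j; rewrite !mem_iota /= !add0n => iq jq.
  by apply: fI; rewrite inE.
have nbrP y : y \in nbr <-> e v y.
  split=> [yn|/fSurj[i iq <-]].
    have [j] := mapP yn.
    by rewrite mem_iota add0n => iq ->; exact: fS.
  by apply/mapP; exists i => //; rewrite mem_iota add0n.
have nbr_size : size nbr = q.+1 by rewrite size_map size_iota.
pose a y := (y != o) && (p y == v).
exists [seq y <- nbr | a y]; split.
- exact: filter_uniq.
- by rewrite size_filter (leq_trans (count_size _ _))// nbr_size.
- move=> vo; have [evp lp] := pred_vertexP vo.
  rewrite -ltnS -nbr_size size_filter -(count_predC a nbr) -addn1 leq_add2l.
  rewrite -has_count; apply/hasP; exists (p v); first by apply/nbrP.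
  apply/negP => /andP[/eqP pvo /eqP ppv]; have := gdist_pred (p v).
  by rewrite ppv -lp; lia.
- move=> y; rewrite mem_filter; split=> [/andP[/andP[/eqP yo /eqP py] _]//|[yo py]].
  have [ey _] := pred_vertexP yo.
  by rewrite /a py eqxx andbT; apply/andP; split; [exact/eqP|apply/nbrP; rewrite sym_e -py].
Qed.

Definition children v : seq X := sval (cid (children_exist v)).

Lemma children_uniq v : uniq (children v).
Proof. by rewrite /children; case: cid => s []. Qed.

Lemma size_children v : (size (children v) <= q.+1)%N.
Proof. by rewrite /children; case: cid => s []. Qed.

Lemma size_children_lt v : v <> o -> (size (children v) <= q)%N.
Proof. by rewrite /children; case: cid => s /= [_ _ h _]; exact: h. Qed.

Lemma childrenP v y : y \in children v <-> y <> o /\ p y = v.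
Proof. by rewrite /children; case: cid => s []. Qed.

(* Requiring the right level excludes the paths that stay at the origin. *)
Definition descendants v l : set X :=
  [set y | iter l p y = v /\ lev y = (lev v + l)%N].

Fixpoint descendant_seq v l : seq X :=
  if l is l'.+1 then flatten [seq children y | y <- descendant_seq v l'] else [:: v].

Lemma descendant_seqP v l y : descendants v l y <-> y \in descendant_seq v l.
Proof.
elim: l y => [|l ih] y /=.
  by rewrite inE; split=> [[/= ->]//|/eqP ->]; split=> //=; rewrite addn0.
split=> [[yv ly]|/flatten_mapP[z /ih[zv lz] /childrenP[yo pyz]]].
  apply/flatten_mapP; exists (p y); last first.
    by apply/childrenP; split=> // yo; move: ly; rewrite yo gdist0 addnS.
  by apply/ih; split; [rewrite -iterSr|rewrite gdist_pred ly addnS].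
by split; [rewrite iterSr pyz|rewrite -(pred_vertexP yo).2 pyz lz addnS].
Qed.

(** The origin has at most q + 1 <= 2 q children and every other vertex at most q. The origin can
    only occur in generation 0, so the factor 2 is paid once. *)
Lemma size_descendant_seq v l : (0 < q)%N -> (size (descendant_seq v l) <= 2 * q ^ l)%N.
Proof.
move=> q0; have flat s : {in s, forall y, y <> o} ->
    (size (flatten [seq children y | y <- s]) <= size s * q)%N.
  elim: s => [//|y s ih] ho /=; rewrite size_cat mulSn leq_add//.
    by rewrite size_children_lt//; apply: ho; rewrite mem_head.
  by apply: ih => z zs; apply: ho; rewrite inE zs orbT.
case: l => [//|]; elim=> [|l ih].
  by rewrite /= cats0 expn1 (leq_trans (size_children v))//; lia.
rewrite [descendant_seq _ _]/= (leq_trans (flat _ _))//.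
  move=> y /(descendant_seqP v l.+1)[_ ly] yo.
  by move: ly; rewrite yo gdist0; lia.
by rewrite expnSr mulnA leq_mul2r ih orbT.
Qed.

Lemma sectorE v : sector e o v = \bigcup_l descendants v l.
Proof.
apply/seteqP; split=> [y [l ly]|y [l _ [ly _]]]; last by exists l.
have := gdist_iter l y; rewrite ly => lv.
have [ll|ll] := leqP l (lev y); first by exists l => //; split=> //; lia.
(* Here the iteration has run past the origin and stayed there, so v = o and y belongs to the
   generation given by its own level. *)
exists (lev y) => //; have vo : v = o by apply: gdist_eq0; lia.
by split; [rewrite vo iter_pred_gdist|rewrite vo gdist0].
Qed.

Lemma sector_origin : sector e o o = setT.
Proof. by apply/seteqP; split=> // y _; exists (lev y); exact: iter_pred_gdist. Qed.

Lemma sector_refl v : sector e o v v.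
Proof. by exists 0%N. Qed.

Lemma sector_pred v : sector e o (p v) v.
Proof. by exists 1%N. Qed.

Lemma finite_descendants v l : finite_set (descendants v l).
Proof.
have -> : descendants v l = [set` descendant_seq v l].
  by apply/seteqP; split=> y /=; rewrite descendant_seqP.
exact: finite_seq.
Qed.

Lemma countable_vertices : countable [set: X].
Proof.
rewrite -sector_origin sectorE; apply: bigcup_countable => // l _.
exact/finite_set_countable/finite_descendants.
Qed.

Lemma descendants_trivIset v : trivIset setT (descendants v).
Proof. by move=> i j _ _ [y [[_ h1] [_ h2]]]; lia. Qed.

End tree_geometry.

(** * Sums of nonnegative families *)

Section esum_extra.
Context {R : realType}.
Local Open Scope ereal_scope.

Lemma subset_esum (T : choiceType) (A B : set T) (f : T -> \bar R) :
  (forall x, 0 <= f x) -> A `<=` B -> \esum_(x in A) f x <= \esum_(x in B) f x.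
Proof.
move=> f0 AB; rewrite (esum_mkcond A) (esum_mkcond B); apply: le_esum => x _.
case: ifPn => [|_]; last by case: ifP.
by rewrite inE => /AB Bx; rewrite mem_set.
Qed.

Lemma esum_ge_point (T : choiceType) (A : set T) (f : T -> \bar R) x :
  (forall x, 0 <= f x) -> A x -> f x <= \esum_(x in A) f x.
Proof.
move=> f0 Ax; rewrite -(esum_set1 (f0 x)); apply: subset_esum => // y /= ->//.
Qed.

Lemma esumU_le (T : choiceType) (A B : set T) (f : T -> \bar R) :
  (forall x, 0 <= f x) ->
  \esum_(x in A `|` B) f x <= \esum_(x in A) f x + \esum_(x in B) f x.
Proof.
move=> f0; rewrite (esumID A)//; apply: leeD; apply: subset_esum => //.
by move=> x [[|]//].
Qed.

Lemma esum_seq_le (T : choiceType) (s : seq T) (f : T -> \bar R) :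
  (forall x, 0 <= f x) -> \esum_(x in [set` s]) f x <= \sum_(x <- s) f x.
Proof.
move=> f0; elim: s => [|a s ih].
  rewrite big_nil (_ : [set` [::]] = set0) ?esum_set0//.
  by apply/seteqP; split.
rewrite big_cons; apply: le_trans (leeD (lexx (f a)) ih).
rewrite -[X in _ <= X + _](esum_set1 (f0 a)).
apply: le_trans (esumU_le _ _ f0); apply: subset_esum => // x /=.
by rewrite inE => /orP[/eqP ->|xs]; [left|right].
Qed.

Lemma esum_uniq_seq (T : choiceType) (s : seq T) (f : T -> \bar R) :
  (forall x, 0 <= f x) -> uniq s -> \esum_(x in [set` s]) f x = \sum_(x <- s) f x.
Proof.
move=> f0 us; rewrite (esum_fset (finite_seq s))//.
by rewrite -fsbig_seq.
Qed.

Lemma sum_le_esum (T : choiceType) (s : seq T) (A : set T) (f : T -> \bar R) :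
  (forall x, 0 <= f x) -> uniq s -> (forall x, x \in s -> A x) ->
  \sum_(x <- s) f x <= \esum_(x in A) f x.
Proof. by move=> f0 us sA; rewrite -esum_uniq_seq//; apply: subset_esum. Qed.

Lemma esum_le_seq (T : choiceType) (A : set T) (f : T -> \bar R) (M : \bar R) :
  (forall s : seq T, uniq s -> (forall x, x \in s -> A x) -> \sum_(x <- s) f x <= M) ->
  \esum_(x in A) f x <= M.
Proof.
move=> h; apply: ub_ereal_sup => _ [B [fB BA] <-].
rewrite fsbig_finite//=; apply: h; first exact: finmap.fset_uniq.
by move=> x; rewrite in_fset_set// inE; exact: BA.
Qed.

Lemma esumZ (T : choiceType) (A : set T) (c : R) (f : T -> \bar R) :
  (forall x, 0 <= f x) -> (0 <= c)%R ->
  \esum_(x in A) (c%:E * f x) = c%:E * \esum_(x in A) f x.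
Proof.
move=> f0 c0.
have le (d : R) (g : T -> \bar R) : (0 <= d)%R -> (forall x, 0 <= g x) ->
    \esum_(x in A) (d%:E * g x) <= d%:E * \esum_(x in A) g x.
  move=> d0 g0; apply: esum_le_seq => s us sA.
  by rewrite -ge0_sume_distrr// lee_wpmul2l// ?lee_fin//; exact: sum_le_esum.
apply/eqP; rewrite eq_le le//=.
have [->|cn0] := eqVneq c 0%R; first by rewrite mul0e esum_ge0// => x _; rewrite mul0e.
have {cn0}c0 : (0 < c)%R by rewrite lt_neqAle eq_sym cn0.
rewrite -lee_pdivlMl// (le_trans _ (le _ _ _ _))//.
- by rewrite le_eqVlt; apply/orP; left; apply/eqP; apply: eq_esum => x _; rewrite muleA -EFinM mulVf ?mul1e// gt_eqF.
- by rewrite invr_ge0 ltW.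
- by move=> x; rewrite mule_ge0// lee_fin ltW.
Qed.

Lemma esum_swap (T1 T2 : choiceType) (a : T1 -> T2 -> \bar R) :
  (forall i j, 0 <= a i j) ->
  \esum_(i in [set: T1]) \esum_(j in [set: T2]) a i j =
  \esum_(j in [set: T2]) \esum_(i in [set: T1]) a i j.
Proof.
move=> a0; rewrite !esum_esum//.
rewrite (reindex_esum ([set: T2] `*`` fun=> [set: T1]) _ (fun x => (x.2, x.1)))//.
split=> [x _//|[i j] [k l] _ _ [-> ->]//|[i j] _]; by exists (j, i).
Qed.

Lemma esum_geometric_le (x : R) : (0 <= x < 1)%R ->
  \esum_(l in [set: nat]) (x ^+ l)%:E <= ((1 - x)^-1)%:E.
Proof.
move=> /andP[x0 x1]; rewrite -nneseries_esumT; last by move=> n; rewrite lee_fin exprn_ge0.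
apply: lime_le; first by apply: is_cvg_nneseries => n _ _; rewrite lee_fin exprn_ge0.
apply: nearW => n; rewrite sumEFin lee_fin -(div1r (1 - x)) ler_pdivlMr ?subr_gt0//.
suff -> : ((\sum_(0 <= k < n) x ^+ k) * (1 - x) = 1 - x ^+ n)%R.
  by rewrite gerBl exprn_ge0.
elim: n => [|n ih]; first by rewrite big_geq// mul0r expr0 subrr.
by rewrite big_nat_recr//= mulrDl ih exprS; ring.
Qed.

End esum_extra.

Section powers.
Context {R : realType}.

Lemma powR_lt1 (x s : R) : 1 < x -> s < 0 -> x `^ s < 1.
Proof.
move=> x1 s0; rewrite /powR gt_eqF ?(lt_trans ltr01)// expR_lt1 nmulr_rlt0//.
exact: ln_gt0.
Qed.

(* Young's inequality in the form that is optimised over lam in [hardy]. *)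
Lemma le_add_powR (r lam u : R) : 1 < r -> 0 < lam -> 0 <= u ->
  u <= lam + lam `^ (1 - r) * u `^ r.
Proof.
move=> r1 l0 u0; have [ul|lu] := leP u lam.
  by rewrite (le_trans ul)// lerDl mulr_ge0// powR_ge0.
have u0' : 0 < u by rewrite (lt_trans l0).
rewrite (@le_trans _ _ (lam `^ (1 - r) * u `^ r))// ?lerDr ?(ltW l0)//.
have -> : u `^ r = u * u `^ (r - 1) by rewrite mulr_powRB1// (lt_trans ltr01).
rewrite mulrCA ler_peMr//.
have -> : 1 - r = - (r - 1) by ring.
rewrite powRN ler_pdivlMl ?powR_gt0// mulr1.
by rewrite ge0_ler_powR ?nnegrE ?subr_ge0 ?ltW.
Qed.

End powers.

(** * Weights of generations and sectors, and Hardy's inequality *)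

Section weighted_tree.
Context {R : realType} {X : pointedType}.
Variables (q : nat) (e : rel X) (o : X) (alpha : R).
Hypothesis q_ge2 : (2 <= q)%N.
Hypothesis tree_e : homogeneous_tree q e.
Hypothesis alpha_gt1 : 1 < alpha.
Implicit Types (x y v : X).

Local Notation p := (pred_vertex e o).
Local Notation lev := (gdist e o).
Local Notation w := (weight q e o alpha).
Local Notation desc := (descendants e o).

Let q_gt0 : 0 < (q%:R : R).
Proof. by rewrite ltr0n; lia. Qed.

Let q_gt1 : 1 < (q%:R : R).
Proof. by rewrite ltr1n. Qed.

Definition decay : R := q%:R `^ (- alpha).

Lemma decay_gt0 : 0 < decay.
Proof. exact: powR_gt0. Qed.

Lemma decay_lt1 : decay < 1.
Proof.
by rewrite powR_lt1// oppr_lt0 (lt_trans ltr01).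
Qed.

Lemma weightE x : w x = decay ^+ lev x.
Proof. by rewrite /weight /decay -powR_mulrn ?powR_ge0// -powRrM mulNr. Qed.

Lemma weight_gt0 x : 0 < w x.
Proof. exact: powR_gt0. Qed.

Lemma weight_ge0 x : 0 <= w x.
Proof. exact: powR_ge0. Qed.

Lemma weight_origin : w o = 1.
Proof. by rewrite weightE (gdist0 o tree_e) expr0. Qed.

Lemma weight_le_pred v : w v <= w (p v).
Proof.
rewrite !weightE (gdist_pred o tree_e) ler_wiXn2l ?ltW ?decay_gt0 ?decay_lt1//.
by rewrite leq_pred.
Qed.

Lemma weight_pred_le v : decay * w (p v) <= w v.
Proof.
rewrite !weightE (gdist_pred o tree_e) -exprS ler_wiXn2l ?ltW ?decay_gt0 ?decay_lt1//.
by lia.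
Qed.

Lemma weight_descendants v l y : desc v l y -> w y = w v * decay ^+ l.
Proof. by move=> [_ ly]; rewrite !weightE ly exprD. Qed.

(** This is q^(1 - alpha): up to the extra child of the origin, the ratio of the total weights of
    successive generations. It is below 1 because alpha > 1. *)
Definition kappa : R := q%:R * decay.

Lemma kappa_gt0 : 0 < kappa.
Proof. by rewrite mulr_gt0// decay_gt0. Qed.

Lemma kappa_lt1 : kappa < 1.
Proof.
rewrite /kappa /decay -{1}(powRr1 (ltW q_gt0)) -powRD; last by rewrite (gt_eqF q_gt0) implybT.
by rewrite powR_lt1// subr_lt0.
Qed.

Lemma descendants_weight_le v l :
  (\esum_(y in desc v l) (w y)%:E <= (2 * kappa ^+ l * w v)%:E)%E.
Proof.
have q0 : (0 < q)%N by lia.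
have -> : desc v l = [set` descendant_seq o tree_e v l].
  by apply/seteqP; split=> y /=; rewrite (descendant_seqP o tree_e).
rewrite (le_trans (esum_seq_le _ _)) => [//|x|]; first by rewrite lee_fin weight_ge0.
rewrite sumEFin lee_fin.
apply: (@le_trans _ _ (\sum_(y <- descendant_seq o tree_e v l) w v * decay ^+ l)).
  by rewrite !big_seq ler_sum// => y /(descendant_seqP o tree_e) /weight_descendants ->.
rewrite big_const_seq count_predT iter_addr_0 -[X in X <= _]mulr_natl.
have -> : 2 * kappa ^+ l * w v = (2 * q ^ l)%:R * (w v * decay ^+ l).
  by rewrite /kappa exprMn natrM natrX; ring.
by rewrite ler_wpM2r ?ler_nat ?size_descendant_seq// mulr_ge0 ?weight_ge0// exprn_ge0// ltW// decay_gt0.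
Qed.

Lemma sector_esum (f : X -> \bar R) v : (forall x, (0 <= f x)%E) ->
  (\esum_(y in sector e o v) f y = \esum_(l in [set: nat]) \esum_(y in desc v l) f y)%E.
Proof.
move=> f0; rewrite (sectorE o tree_e) esum_bigcupT//.
exact: descendants_trivIset.
Qed.

(** A vertex y has only one ancestor l levels up, so the pairs (v, y) inject into the vertices y. *)
Lemma esum_descendants_le (f : X -> \bar R) l : (forall x, (0 <= f x)%E) ->
  (\esum_(v in [set: X]) \esum_(y in desc v l) f y <= \esum_(y in [set: X]) f y)%E.
Proof.
move=> f0; rewrite esum_esum//; apply: esum_le_seq => s us sA.
have inj : {in s &, injective (@snd X X)}.
  move=> [v y] [v' y'] /sA[_ /= [yv _]] /sA[_ /= [yv' _]] /= yy.
  by move: yv'; rewrite -yy yv => <-.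
have -> : (\sum_(k <- s) f k.2 = \sum_(y <- map snd s) f y)%E by rewrite big_map.
by apply: sum_le_esum => //; rewrite map_inj_in_uniq.
Qed.

(** Sum over l of the generation bounds 2 kappa^l. *)
Definition sector_const : R := 2 / (1 - kappa).

Lemma sector_const_gt0 : 0 < sector_const.
Proof. by rewrite divr_gt0// subr_gt0 kappa_lt1. Qed.

Lemma sector_weight_le v :
  (\esum_(y in sector e o v) (w y)%:E <= (sector_const * w v)%:E)%E.
Proof.
rewrite sector_esum; last by move=> x; rewrite lee_fin weight_ge0.
apply: (@le_trans _ _ (\esum_(l in [set: nat]) ((2 * w v)%:E * (kappa ^+ l)%:E))%E).
  apply: le_esum => l _; rewrite (le_trans (descendants_weight_le _ _))// -EFinM lee_fin.
  by rewrite mulrAC.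
have k0 := kappa_gt0; have k1 := kappa_lt1.
rewrite esumZ ?mulr_ge0 ?weight_ge0//; last by move=> l; rewrite lee_fin exprn_ge0// ltW.
apply: le_trans (lee_wpmul2l _ (esum_geometric_le _)) _.
- by rewrite lee_fin mulr_ge0// weight_ge0.
- by rewrite ltW.
by rewrite -EFinM lee_fin /sector_const; rewrite mulrAC.
Qed.

(* Hardy's inequality on the tree.  Splitting T_v into generations and
   applying [le_add_powR] to g rho^(-l) on the l-th one with rho kappa < 1
   replaces the maximal theorem. *)
Lemma hardy (r : R) : 1 < r -> exists2 K : R, 0 < K &
  forall g a : X -> R, (forall x, 0 <= g x) -> (forall v, 0 <= a v) ->
  (forall v, ((a v * w v)%:E <= \esum_(y in sector e o v) (g y * w y)%:E)%E) ->
  (\esum_(v in [set: X]) (a v `^ r * w v)%:E <=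
   K%:E * \esum_(y in [set: X]) (g y `^ r * w y)%:E)%E.
Proof.
move=> r1; have k0 := kappa_gt0; have k1 := kappa_lt1.
have r0 : 0 < r by rewrite (lt_trans ltr01).
(* The midpoint of 1 and 1 / kappa. The terms with lam sum over the generations since rho kappa < 1,
   those with lam^(1 - r) since rho > 1 gives sigma = rho^(1 - r) < 1. *)
pose rho := (1 + kappa^-1) / 2.
have kV : 1 < kappa^-1 by rewrite invf_gt1.
have rho1 : 1 < rho by rewrite /rho; lra.
have rho0 : 0 < rho by rewrite (lt_trans ltr01).
have rk1 : rho * kappa < 1.
  have -> : rho * kappa = (kappa + 1) / 2 by rewrite /rho; field; rewrite gt_eqF.
  lra.
have rk0 : 0 < rho * kappa by rewrite mulr_gt0.
pose sigma := rho `^ (1 - r).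
have s0 : 0 < sigma by rewrite powR_gt0.
have s1 : sigma < 1 by rewrite powR_lt1// subr_lt0.
pose C1 := 2 / (1 - rho * kappa).
have C10 : 0 < C1 by rewrite divr_gt0// subr_gt0.
pose K := (2 * C1) `^ (r - 1) * 2.
have K0 : 0 < K by rewrite mulr_gt0// powR_gt0// mulr_gt0.
have sV : 0 < (1 - sigma)^-1 by rewrite invr_gt0 subr_gt0.
exists (K * (1 - sigma)^-1); first by rewrite mulr_gt0.
move=> g a g0 a0 ga.
pose h y : \bar R := (g y `^ r * w y)%:E.
have h0 y : (0 <= h y)%E by rewrite lee_fin mulr_ge0 ?powR_ge0 ?weight_ge0.
have gw0 y : (0 <= (g y * w y)%:E)%E by rewrite lee_fin mulr_ge0 ?weight_ge0.
have w0 y : (0 <= (w y)%:E)%E by rewrite lee_fin weight_ge0.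
pose G v : \bar R := (\esum_(l in [set: nat]) ((sigma ^+ l)%:E * \esum_(y in desc v l) h y))%E.
have G0 v : (0 <= G v)%E.
  by apply: esum_ge0 => l _; rewrite mule_ge0 ?lee_fin ?exprn_ge0 ?(ltW s0)// esum_ge0.
have step1 (lam : R) v : 0 < lam ->
    ((a v * w v)%:E <= (lam * C1 * w v)%:E + (lam `^ (1 - r))%:E * G v)%E.
  move=> l0; apply: le_trans (ga v) _; rewrite sector_esum//.
  have pw l : (rho ^+ l) * (lam `^ (1 - r) * (rho ^- l) `^ r) = lam `^ (1 - r) * sigma ^+ l.
    rewrite mulrCA; congr *%R.
    rewrite /sigma -!powR_mulrn ?powR_ge0 ?(ltW rho0)// -powRN -!powRrM.
    by rewrite -powRD ?(gt_eqF rho0) ?implybT//; congr (_ `^ _); ring.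
  apply: (@le_trans _ _ (\esum_(l in [set: nat])
      ((lam * 2 * w v)%:E * ((rho * kappa) ^+ l)%:E +
       (lam `^ (1 - r))%:E * ((sigma ^+ l)%:E * \esum_(y in desc v l) h y)))%E).
    apply: le_esum => l _.
    apply: (@le_trans _ _ (\esum_(y in desc v l)
        ((lam * rho ^+ l)%:E * (w y)%:E + (lam `^ (1 - r) * sigma ^+ l)%:E * h y))%E).
      apply: le_esum => y _; rewrite -!EFinM -EFinD lee_fin mulrA -mulrDl ler_wpM2r ?weight_ge0//.
      rewrite -pw.
      have u0 : 0 <= g y * rho ^- l by rewrite mulr_ge0// invr_ge0 exprn_ge0// ltW.
      have := le_add_powR r1 l0 u0; rewrite powRM ?invr_ge0 ?exprn_ge0 ?(ltW rho0)// => hu.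
      have -> : g y = rho ^+ l * (g y * rho ^- l).
        by rewrite mulrCA mulfV ?mulr1// expf_neq0// gt_eqF.
      apply: le_trans (ler_wpM2l (exprn_ge0 l (ltW rho0)) hu) _.
      rewrite le_eqVlt; apply/orP; left; apply/eqP.
      rewrite [rho ^+ l * (g y * _)]mulrCA mulfV ?expf_neq0 ?(gt_eqF rho0)// mulr1; ring.
    have lr0 : 0 <= lam * rho ^+ l by rewrite mulr_ge0 ?exprn_ge0 ?ltW.
    have ls0 : 0 <= lam `^ (1 - r) * sigma ^+ l by rewrite mulr_ge0 ?powR_ge0 ?exprn_ge0 ?ltW.
    rewrite esumD; first last.
    - by move=> y _; rewrite mule_ge0.
    - by move=> y _; rewrite mule_ge0.
    rewrite !esumZ// leeD//; last by rewrite EFinM muleA.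
    apply: le_trans (lee_wpmul2l _ (descendants_weight_le v l)) _ => //.
    rewrite -!EFinM lee_fin [(rho * kappa) ^+ l]exprMn.
    by rewrite le_eqVlt; apply/orP; left; apply/eqP; ring.
  have lw0 : 0 <= lam * 2 * w v by rewrite mulr_ge0 ?mulr_ge0 ?weight_ge0 ?(ltW l0).
  rewrite esumD; first last.
  - by move=> l _; rewrite mule_ge0 ?lee_fin ?powR_ge0// mule_ge0 ?lee_fin ?exprn_ge0 ?(ltW s0)// esum_ge0.
  - by move=> l _; rewrite mule_ge0 ?lee_fin// exprn_ge0// ltW.
  rewrite !esumZ ?powR_ge0//; first last.
  - by move=> l; rewrite lee_fin exprn_ge0// ltW.
  - by move=> l; rewrite mule_ge0 ?lee_fin ?exprn_ge0 ?(ltW s0)// esum_ge0.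
  rewrite leeD//; apply: le_trans (lee_wpmul2l _ (esum_geometric_le _)) _ => //.
    by rewrite (ltW rk0).
  rewrite -EFinM lee_fin /C1 le_eqVlt; apply/orP; left; apply/eqP; ring.
have step2 v : ((a v `^ r * w v)%:E <= K%:E * G v)%E.
  have [->|av0] := eqVneq (a v) 0.
    by rewrite powR0 ?gt_eqF// mul0r mule_ge0// lee_fin ltW.
  have {}av0 : 0 < a v by rewrite lt_neqAle eq_sym av0 a0.
  (* For this lam the first term of [step1] is half of the left-hand side and can be absorbed. *)
  have [lam l0 aE] : exists2 lam, 0 < lam & a v = 2 * C1 * lam.
    exists (a v / (2 * C1)); first by rewrite divr_gt0// mulr_gt0.
    by rewrite mulrC divfK// gt_eqF// mulr_gt0.
  have := step1 lam v l0; have := G0 v; case: (G v) => [G'| |]; last by [].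
    rewrite -!EFinM -EFinD !lee_fin => G'0; rewrite aE => hl.
    have {}hl : C1 * lam * w v <= lam `^ (1 - r) * G' by lra.
    have {hl} : C1 * lam * w v * lam `^ (r - 1) <= G'.
      have lE : lam `^ (1 - r) * lam `^ (r - 1) = 1.
        have e0 : 1 - r + (r - 1) = 0 by ring.
        by rewrite -powRD ?e0 ?powRr0// (gt_eqF l0) implybT.
      rewrite [leRHS](_ : _ = lam `^ (1 - r) * G' * lam `^ (r - 1)).
        by rewrite ler_wpM2r ?powR_ge0.
      by rewrite mulrAC lE mul1r.
    have C20 : 0 <= 2 * C1 by rewrite mulr_ge0// ltW.
    rewrite powRM ?(ltW l0)// -(mulr_powRB1 (ltW l0) r0) -(mulr_powRB1 C20 r0) /K.
    move=> hl; rewrite -subr_ge0.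
    have -> : (2 * C1) `^ (r - 1) * 2 * G' -
      2 * C1 * (2 * C1) `^ (r - 1) * (lam * lam `^ (r - 1)) * w v =
      2 * (2 * C1) `^ (r - 1) * (G' - C1 * lam * w v * lam `^ (r - 1)) by ring.
    by rewrite mulr_ge0 ?subr_ge0// mulr_ge0// powR_ge0.
  by move=> _ _; rewrite gt0_muley ?lte_fin// leey.
have Ki0 : 0 < K * (1 - sigma)^-1 by rewrite mulr_gt0.
have : (0 <= \esum_(y in [set: X]) h y)%E by rewrite esum_ge0.
rewrite -/h; case HE : (\esum_(y in [set: X]) h y)%E => [H| |] // H0; last first.
  by rewrite gt0_muley ?lte_fin// leey.
apply: (@le_trans _ _ (K%:E * \esum_(v in [set: X]) G v)%E).
  rewrite -esumZ ?(ltW K0)//; exact: le_esum.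
clearbody K; rewrite EFinM -muleA lee_wpmul2l ?lee_fin ?(ltW K0)//.
(* For fixed l each y is counted at most once over all v, so summing over v costs only the factor 1
   / (1 - sigma). *)
rewrite /G esum_swap; last first.
  by move=> v l; rewrite mule_ge0 ?lee_fin ?exprn_ge0 ?(ltW s0)// esum_ge0.
apply: (@le_trans _ _ (\esum_(l in [set: nat]) (H%:E * (sigma ^+ l)%:E))%E).
  apply: le_esum => l _; rewrite esumZ ?exprn_ge0 ?(ltW s0)//; last first.
    by move=> v; rewrite esum_ge0.
  rewrite muleC lee_wpmul2r ?lee_fin ?exprn_ge0 ?(ltW s0)// -HE.
  exact: esum_descendants_le.
rewrite esumZ//; last by move=> l; rewrite lee_fin exprn_ge0// ltW.
rewrite muleC lee_wpmul2r// esum_geometric_le//.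
by rewrite (ltW s0).
Qed.

End weighted_tree.

(** * Integrals, volumes and L^p norms for the tree measure *)

Section tree_integrals.
Context {R : realType} {X : pointedType}.
Variables (q : nat) (e : rel X) (o : X) (alpha : R).
Hypothesis q_ge2 : (2 <= q)%N.
Hypothesis tree_e : homogeneous_tree q e.
Hypothesis alpha_gt1 : 1 < alpha.
Local Notation C := R[i].
Implicit Types (x y v : X) (D : set X) (f : X -> C) (g : X -> R).

Local Notation w := (weight q e o alpha).
Local Notation mu := (tree_measure q e o alpha).
Local Notation sc := (sector_const q alpha).

Definition wsum D g : \bar R := (\esum_(x in D) (g x * w x)%:E)%E.

Lemma discrete_measurable_set (D : set (discrete X)) : measurable D.
Proof. by []. Qed.

Let w_ge0 x : 0 <= w x.
Proof. exact: weight_ge0. Qed.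

Let w_gt0 x : 0 < w x.
Proof. exact: weight_gt0. Qed.

Let wsum_term_ge0 g x : (forall x, 0 <= g x) -> (0 <= (g x * w x)%:E)%E.
Proof. by move=> g0; rewrite lee_fin mulr_ge0. Qed.

Lemma tree_measure_set1 x : mu [set x] = (w x)%:E.
Proof. by rewrite /tree_measure esum_set1// lee_fin. Qed.

(** An injection of X into [nat] splits D into fibres of at most one point, on which the integrand
    is constant. *)
Lemma integral_wsum D g : (forall x, 0 <= g x) ->
  (\int[mu]_(x in (D : set (discrete X))) (g x)%:E = wsum D g)%E.
Proof.
move=> g0; have /countable_injP[f finj] := countable_vertices o tree_e.
pose F n : set X := D `&` [set x | f x = n].
have DF : D = \bigcup_n F n.
  by apply/seteqP; split=> [x Dx|x [n _ []]//]; exists (f x).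
have tF : trivIset [set: nat] F by move=> i j _ _ [x [[_ <-] [_ <-]]].
rewrite /wsum {1 2}DF ge0_integral_bigcup//; last by move=> x _; rewrite lee_fin.
rewrite esum_bigcupT//; last by move=> x; rewrite lee_fin mulr_ge0.
rewrite nneseries_esumT; last by move=> n; apply: integral_ge0 => x _; rewrite lee_fin.
apply: eq_esum => n _; have [F0|/set0P[x Fx]] := eqVneq (F n) set0.
  by rewrite F0 integral_set0 esum_set0.
have -> : F n = [set x].
  apply/seteqP; split=> [y [_ fy]|y /= ->//].
  by apply: finj; rewrite ?inE// fy; case: Fx.
rewrite esum_set1 ?lee_fin ?mulr_ge0//.
rewrite (eq_integral (cst (g x)%:E)); last by move=> y; rewrite inE /= => ->.
by rewrite integral_cst// [X in (_ * X)%E](tree_measure_set1 x).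
Qed.

Lemma wsum_ge0 D g : (forall x, 0 <= g x) -> (0 <= wsum D g)%E.
Proof. by move=> g0; apply: esum_ge0 => x _; exact: wsum_term_ge0. Qed.

Lemma le_wsum D g h : (forall x, D x -> g x <= h x) -> (wsum D g <= wsum D h)%E.
Proof. by move=> gh; apply: le_esum => x Dx; rewrite lee_fin ler_wpM2r ?gh. Qed.

Lemma wsum_subset D D' g : (forall x, 0 <= g x) -> D `<=` D' -> (wsum D g <= wsum D' g)%E.
Proof. by move=> g0 DD; apply: subset_esum => // x; exact: wsum_term_ge0. Qed.

Lemma wsum_subT D g : (forall x, 0 <= g x) -> (wsum D g <= wsum setT g)%E.
Proof. by move=> g0; exact: wsum_subset. Qed.

Lemma wsumZ D g (c : R) : (forall x, 0 <= g x) -> 0 <= c ->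
  wsum D (fun x => c * g x) = (c%:E * wsum D g)%E.
Proof.
move=> g0 c0; rewrite /wsum -esumZ//; last by move=> x; exact: wsum_term_ge0.
by apply: eq_esum => x _; rewrite -EFinM mulrA.
Qed.

Lemma wsumD D g h : (forall x, 0 <= g x) -> (forall x, 0 <= h x) ->
  wsum D (fun x => g x + h x) = (wsum D g + wsum D h)%E.
Proof.
move=> g0 h0; rewrite /wsum -esumD; first by apply: eq_esum => x _; rewrite -EFinD mulrDl.
  by move=> x _; exact: wsum_term_ge0.
by move=> x _; exact: wsum_term_ge0.
Qed.

Lemma wsum_ge_point D g x : (forall x, 0 <= g x) -> D x -> ((g x * w x)%:E <= wsum D g)%E.
Proof.
move=> g0 Dx; apply: (@esum_ge_point _ _ _ (fun x => (g x * w x)%:E)) => // y.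
exact: wsum_term_ge0.
Qed.

Lemma tree_measureE D : mu D = wsum D (fun=> 1).
Proof. by apply: eq_esum => x _; rewrite mul1r. Qed.

Lemma tree_measure_le_sector D v : D `<=` sector e o v -> (mu D <= (sc * w v)%:E)%E.
Proof.
move=> Dv; apply: le_trans (sector_weight_le o q_ge2 tree_e alpha_gt1 v).
by apply: subset_esum => // x; rewrite lee_fin.
Qed.

Lemma tree_measure_lty D : (mu D < +oo)%E.
Proof.
apply: (@le_lt_trans _ _ (sc * w o)%:E); last exact: ltry.
by apply: tree_measure_le_sector; rewrite (sector_origin o tree_e).
Qed.

Lemma volE D : mu D = (vol mu D)%:E.
Proof.
by rewrite /vol fineK// ge0_fin_numE ?tree_measure_lty.
Qed.

Lemma vol_ge0 D : 0 <= vol mu D.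
Proof. by rewrite -lee_fin -volE tree_measureE wsum_ge0. Qed.

Lemma weight_le_vol D x : D x -> w x <= vol mu D.
Proof.
move=> Dx; rewrite -lee_fin -volE tree_measureE -[w x]mul1r.
exact: (@wsum_ge_point D (fun=> 1)).
Qed.

Lemma vol_gt0 D x : D x -> 0 < vol mu D.
Proof. by move=> /weight_le_vol; apply: lt_le_trans. Qed.

Lemma vol_sector_le v : vol mu (sector e o v) <= sc * w v.
Proof. by rewrite -lee_fin -volE tree_measure_le_sector. Qed.

Lemma vol_set1 x : vol mu [set x] = w x.
Proof. by rewrite /vol [X in fine X](tree_measure_set1 x). Qed.

Lemma wsum_cst D (c : R) : 0 <= c -> wsum D (fun=> c) = (c * vol mu D)%:E.
Proof.
move=> c0; rewrite EFinM -volE tree_measureE -wsumZ//.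
by congr wsum; apply/funext => x; rewrite mulr1.
Qed.

Definition summable_on f : Prop := (wsum setT (fun x => cabs (f x)) < +oo)%E.

Let cabs_nneg f x : 0 <= cabs (f x).
Proof. exact: cabs_ge0. Qed.

Lemma integrable_part D f (part : C -> R) : (forall z, `|part z| <= cabs z) ->
  summable_on f -> mu.-integrable (D : set (discrete X)) (EFin \o (fun x => part (f x))).
Proof.
move=> part_le sf; apply/integrableP; split; first by [].
apply: le_lt_trans sf; rewrite [leLHS](_ : _ = wsum D (fun x => `|part (f x)|)).
  apply: (@le_trans _ _ (wsum D (fun x => cabs (f x)))); first exact: le_wsum.
  exact: wsum_subT.
by rewrite -integral_wsum.
Qed.

Lemma cint_setU D D' f : summable_on f -> [disjoint D & D'] ->
  cint mu (D `|` D') f = cint mu D f + cint mu D' f.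
Proof.
move=> sf DD; rewrite /cint; apply/eqP; rewrite eq_complex /=; apply/andP; split; apply/eqP;
  rewrite Rintegral_setU//.
- exact: (@integrable_part _ f (@complex.Re R) (@Re_le_cabs R)).
- exact: (@integrable_part _ f (@complex.Im R) (@Im_le_cabs R)).
Qed.

Lemma cint_eq_on D f f' : (forall x, D x -> f x = f' x) -> cint mu D f = cint mu D f'.
Proof.
by move=> ff; rewrite /cint; congr Complex; apply: eq_Rintegral => x; rewrite inE => /ff ->.
Qed.

Lemma cint_cst D (c : C) : cint mu D (fun=> c) = (vol mu D)%:C%C * c.
Proof.
rewrite real_cplxM /cint !Rintegral_cst// /vol; congr Complex; exact: mulrC.
Qed.

Lemma cint_set1 x f : cint mu [set x] f = (w x)%:C%C * f x.
Proof.
by rewrite (@cint_eq_on _ _ (fun=> f x)) ?cint_cst ?vol_set1// => y /= ->.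
Qed.

Lemma cint_set0 f : cint mu set0 f = 0.
Proof. by rewrite /cint !Rintegral_set0. Qed.

(** The factor 2 comes from bounding the real and the imaginary part of [cint] separately. *)
Lemma cabs_cint_le D f : summable_on f ->
  ((cabs (cint mu D f))%:E <= 2%:E * wsum D (fun x => cabs (f x)))%E.
Proof.
move=> sf; have part_le (part : C -> R) : (forall z, `|part z| <= cabs z) ->
    (`|\int[mu]_(x in (D : set (discrete X))) part (f x)|%:E <=
     wsum D (fun x => cabs (f x)))%E.
  move=> hp; have ip := integrable_part D hp sf.
  have := le_normr_Rintegral (discrete_measurable_set D) ip.
  rewrite -lee_fin => /le_trans; apply.
  rewrite /Rintegral fineK.
    rewrite (integral_wsum D (g := fun x => `|part (f x)|))//.
    by apply: le_wsum => x _.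
  apply: integrable_fin_num => //; exact: integrable_norm.
apply: (@le_trans _ _ (`|complex.Re (cint mu D f)| + `|complex.Im (cint mu D f)|)%:E).
  by rewrite lee_fin cabs_le_ReIm.
rewrite EFinD mule_natl mule2n; apply: leeD.
- exact: (part_le (@complex.Re R) (@Re_le_cabs R)).
- exact: (part_le (@complex.Im R) (@Im_le_cabs R)).
Qed.

Lemma Lp_norm1 f : Lp_norm mu 1 f = wsum setT (fun x => cabs (f x)).
Proof.
rewrite /Lp_norm Lnorm1 -integral_wsum//; apply: eq_integral => x _ /=.
by rewrite ger0_norm// cabs_ge0.
Qed.

(** The norm is the power 1 / p of the sum. Stated with a real bound N, it lets the later estimates
    be made on sums of p-th powers. *)
Lemma Lp_norm_le (p N : R) f : 0 < p -> 0 <= N ->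
  (Lp_norm mu p%:E f <= N%:E)%E <->
  (wsum setT (fun x => cabs (f x) `^ p)%R <= (N `^ p)%:E)%E.
Proof.
move=> p0 N0; have pn0 : p != 0 by rewrite gt_eqF.
have I0 : (0 <= wsum setT (fun x => cabs (f x) `^ p)%R)%E.
  by apply: wsum_ge0 => x; exact: powR_ge0.
have E : Lp_norm mu p%:E f = (wsum setT (fun x => cabs (f x) `^ p)%R `^ p^-1)%E.
  rewrite /Lp_norm unlock -integral_wsum; last by move=> x; exact: powR_ge0.
  congr (_ `^ _)%E; apply: eq_integral => x _ /=.
  by rewrite ger0_norm ?cabs_ge0.
rewrite E; move: (wsum _ _) I0 => I I0; split=> h.
  have := @gt0_ler_poweR _ p (ltW p0) (I `^ p^-1)%E N%:E.
  rewrite !in_itv /= !leey !andbT poweR_ge0 lee_fin N0 => /(_ isT isT h).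
  by rewrite -poweRrM mulVf// poweRe1// poweR_EFin.
have := @gt0_ler_poweR _ p^-1 _ I (N `^ p)%:E.
rewrite !in_itv /= !leey !andbT lee_fin powR_ge0 invr_ge0 (ltW p0) => /(_ isT I0 isT h).
by rewrite /= -powRrM mulfV// powRr1.
Qed.

(** Every vertex has positive mass, so a null set is empty and the essential supremum is a
    supremum. *)
Lemma Loo_norm_le (N : R) f :
  (Lp_norm mu +oo f <= N%:E)%E <-> (forall x, cabs (f x) <= N).
Proof.
have mu0 : (0 < mu [set: discrete X])%E.
  by rewrite volE lte_fin (@vol_gt0 _ o).
rewrite /Lp_norm unlock mu0; split=> [/ess_supP|h].
  move=> [A [_ A0 hA]] x; rewrite leNgt; apply/negP => Nx.
  have Ax : A x.
    by apply: hA => /=; rewrite ger0_norm ?cabs_ge0// lee_fin leNgt Nx.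
  have := weight_le_vol Ax; rewrite leNgt /vol.
  by have := A0; rewrite /= => ->; rewrite /= w_gt0.
apply/ess_supP/nearW => x /=.
by rewrite ger0_norm ?cabs_ge0// lee_fin.
Qed.

End tree_integrals.

(** * Complex interpolation *)

Section interpolation_generalities.
Context {R : realType} {X : pointedType}.
Local Notation C := R[i].
Implicit Types (A B : function_space R X) (f g : X -> C) (F : C -> X -> C).
Local Open Scope ereal_scope.

Lemma Fnorm_ge A0 A1 F (t : R) :
  fnorm A0 (F (0%R +i* t)%C) <= Fnorm A0 A1 F /\
  fnorm A1 (F (1%R +i* t)%C) <= Fnorm A0 A1 F.
Proof.
have h : maxe (fnorm A0 (F (0%R +i* t)%C)) (fnorm A1 (F (1%R +i* t)%C)) <= Fnorm A0 A1 F.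
  by apply: ereal_sup_ubound; exists t.
by split; apply: le_trans h; rewrite le_max lexx ?orbT.
Qed.

(** Taking N and M strictly positive allows division by them in the two estimates. The norms
    themselves, which may vanish, are reached by adding an arbitrarily small amount. *)
Lemma equivalent_spaces_intro A0 A1 B (theta C1 C2 : R) :
  (0 < C1)%R -> (0 < C2)%R -> (forall f, 0 <= fnorm A0 f) ->
  (forall f, fcarrier B f <-> fnorm B f < +oo) -> (forall f, 0 <= fnorm B f) ->
  (forall f (N : R), (0 < N)%R -> fnorm B f <= N%:E -> exists F,
     [/\ interp_family A0 A1 F, F (theta%:C%C) = f & Fnorm A0 A1 F <= (C1 * N)%:E]) ->
  (forall F (M : R), (0 < M)%R -> interp_family A0 A1 F -> Fnorm A0 A1 F <= M%:E ->
     fnorm B (F (theta%:C%C)) <= (C2 * M)%:E) ->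
  equivalent_spaces (interp A0 A1 theta) B.
Proof.
move=> C10 C20 A00 Bfin B0 upper lower.
have above (x : \bar R) : x < +oo -> exists2 M : R, (0 < M)%R & x <= M%:E.
  move=> xoo; exists (Num.max 1%R (fine x)); first by rewrite lt_max ltr01.
  case: x xoo => [r _| //|_] /=; last by rewrite leNye.
  by rewrite lee_fin le_max lexx orbT.
have carE : fcarrier (interp A0 A1 theta) = fcarrier B.
  apply/seteqP; split=> f /=.
    move=> [F hF <-]; apply/Bfin; have [_ _ _ /above[M M0 hM]] := hF.
    by apply: le_lt_trans (lower F M M0 hF hM) _; rewrite ltry.
  move=> /Bfin /above[N N0 hN]; have [F [hF Ff _]] := upper f N N0 hN.
  by exists F.
split=> //; exists C1^-1%R, C2; split; rewrite ?invr_gt0// => f.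
rewrite carE => /Bfin fB; split.
  rewrite lee_pdivrMl//; apply/lee_addgt0Pr => eps e0.
  pose d := (eps / C1)%R; have d0 : (0 < d)%R by rewrite divr_gt0.
  have bE : fnorm B f = (fine (fnorm B f))%:E by rewrite fineK// ge0_fin_numE.
  have N0 : (0 < fine (fnorm B f) + d)%R by rewrite ltr_wpDl// fine_ge0.
  have hN : fnorm B f <= (fine (fnorm B f) + d)%:E by rewrite bE lee_fin /= lerDl ltW.
  have [F [hF Ff hFN]] := upper f _ N0 hN.
  apply: ereal_inf_le; exists (Fnorm A0 A1 F); first by exists F.
  apply: le_trans hFN _; rewrite bE -EFinM -EFinD lee_fin /= mulrDr /d.
  by rewrite [(C1 * (eps / C1))%R]mulrC divfK// gt_eqF.
rewrite -lee_pdivrMl//; apply/ereal_infP => _ [F [hF Ff ->]].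
rewrite lee_pdivrMl//; have [_ _ _ Foo] := hF.
have F0 : 0 <= Fnorm A0 A1 F by apply: le_trans (Fnorm_ge A0 A1 F 0).1.
case E : (Fnorm A0 A1 F) Foo F0 => [r| |] // _; rewrite lee_fin => r0.
rewrite -EFinM; apply/lee_addgt0Pr => eps e0.
have M0 : (0 < r + eps / C2)%R by rewrite ltr_wpDl// divr_gt0.
have := lower F _ M0 hF; rewrite E lee_fin lerDl ltW ?divr_gt0// Ff => /(_ isT).
by rewrite mulrDr [(C2 * (eps / C2))%R]mulrC divfK// gt_eqF.
Qed.

Section functionals.
Variables A0 A1 : function_space R X.
Hypothesis A0_ge0 : forall f, 0 <= fnorm A0 f.
Hypothesis A1_ge0 : forall f, 0 <= fnorm A1 f.

Lemma sum_norm_ge0 f : 0 <= fnorm (sum_space A0 A1) f.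
Proof. by apply/ereal_infP => _ [f0 [f1 [_ _ _ ->]]]; rewrite adde_ge0. Qed.

Definition eval_bounded A x : Prop := exists K : R, forall f, fcarrier A f ->
  (cabs (f x))%:E <= K%:E * fnorm A f.

(** Point evaluations are the functionals through which the lower bounds see a family F. *)
Lemma eval_functional x : eval_bounded A0 x -> eval_bounded A1 x ->
  bounded_functional (sum_space A0 A1) (fun f => f x).
Proof.
move=> [K0 h0] [K1 h1]; split => //.
pose K := (`|K0| + `|K1| + 1)%R.
have K_gt0 : (0 < K)%R by rewrite ltr_wpDl.
have K0K : (K0 <= K)%R.
  by rewrite (le_trans (ler_norm _))// /K -addrA lerDl addr_ge0.
have K1K : (K1 <= K)%R.
  by rewrite (le_trans (ler_norm _))// /K addrAC [X in (_ <= X)%R]addrC lerDl addr_ge0.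
exists K => f _; rewrite -lee_pdivrMl//; apply/ereal_infP => _ [f0 [f1 [hf0 hf1 -> ->]]]; rewrite lee_pdivrMl//.
apply: (@le_trans _ _ ((cabs (f0 x))%:E + (cabs (f1 x))%:E)).
  by rewrite -EFinD lee_fin; exact: cabsD.
rewrite ge0_muleDr//; apply: leeD.
- by apply: le_trans (h0 _ hf0) _; rewrite lee_wpmul2r ?lee_fin.
- by apply: le_trans (h1 _ hf1) _; rewrite lee_wpmul2r ?lee_fin.
Qed.

Lemma eval_strip_regular F x : eval_bounded A0 x -> eval_bounded A1 x ->
  interp_family A0 A1 F -> strip_regular (fun z => F z x).
Proof.
move=> h0 h1 [_ hl _ _]; have [c b a] := hl _ (eval_functional h0 h1); split.
- exact/strip_continuousP.
- exact: b.
- by move=> z /a; exact: analytic_taylor2.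
Qed.

Lemma sum_carrier_left f : fcarrier A1 (fun=> 0%R) -> fcarrier A0 f ->
  fcarrier (sum_space A0 A1) f.
Proof.
by move=> c1 c0; exists f, (fun=> 0%R); split=> //; apply/funext => x /=; rewrite addr0.
Qed.

(** The families of the upper bounds lie in A0 at every point of the strip; there the decomposition
    f = f + 0 bounds the norm of the sum space by that of A0. *)
Lemma functional_left ell : fcarrier A1 (fun=> 0%R) -> fnorm A1 (fun=> 0%R) = 0 ->
  bounded_functional (sum_space A0 A1) ell ->
  exists2 M : R, (0 <= M)%R & forall f, fcarrier A0 f -> (cabs (ell f))%:E <= M%:E * fnorm A0 f.
Proof.
move=> c1 n1 [_ _ [M hM]]; exists `|M|%R => // f c0.
apply: le_trans (hM f (sum_carrier_left c1 c0)) _.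
apply: le_trans (lee_wpmul2r (sum_norm_ge0 f) (_ : M%:E <= `|M|%:E)) _.
  by rewrite lee_fin ler_norm.
rewrite lee_wpmul2l//; apply: ereal_inf_lbound; exists f, (fun=> 0%R); split=> //.
  by apply/funext => x /=; rewrite addr0.
by rewrite n1 adde0.
Qed.

(** The form shared by both upper bounds. The expansion of F is required after application of [ell],
    which each family justifies in its own way: by atomic tails in H^1, by L^p tails otherwise. *)
Lemma exp_family F (N : R) (c : nat -> C) (beta : nat -> R) (b : nat -> X -> C) :
  (forall z, closed_strip z -> fcarrier (sum_space A0 A1) (F z)) ->
  (forall ell, bounded_functional (sum_space A0 A1) ell ->
    (exists M : R, forall n, (\sum_(0 <= j < n)
       cabs (c j * ell (b j)) * (1 + expR (beta j)) <= M)%R) /\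
    forall z, closed_strip z -> ctends
      (fun n => \sum_(0 <= j < n) c j * ell (b j) * cexp ((beta j)%:C%C * z))%R (ell (F z))) ->
  (forall t : R, fcarrier A0 (F (0%R +i* t)%C) /\ fcarrier A1 (F (1%R +i* t)%C)) ->
  (forall t : R, fnorm A0 (F (0%R +i* t)%C) <= N%:E /\ fnorm A1 (F (1%R +i* t)%C) <= N%:E) ->
  interp_family A0 A1 F /\ Fnorm A0 A1 F <= N%:E.
Proof.
move=> cF lF bF nF.
have FN : Fnorm A0 A1 F <= N%:E.
  apply: ub_ereal_sup => _ [t _ <-]; have [n0 n1] := nF t.
  by rewrite ge_max n0 n1.
split=> //; split=> //; last by rewrite (le_lt_trans FN)// ltry.
move=> ell /lF[[M hM] tends]; split.
- apply/strip_continuousP; exact: (exp_series_continuous hM tends).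
- by exists M => z; exact: (exp_series_bounded hM tends).
- by move=> z; exact: (exp_series_analytic hM tends).
Qed.

End functionals.

End interpolation_generalities.

(** * Interpolation between H^1 and L^p *)

Section enumeration.
Context {R : realType} {X : pointedType}.
Hypothesis countable_X : countable [set: X].
Implicit Types (t : X -> R) (x : X).

Definition vertex_code : X -> nat := sval (cid (elimT (countable_injP _) countable_X)).

Lemma vertex_code_inj : injective vertex_code.
Proof.
rewrite /vertex_code; case: cid => f /= finj x y; apply: finj; exact: in_setT.
Qed.

(** An [option], as the code need not be onto; an index that codes no vertex contributes 0 to the
    series below. *)
Definition vertex_dec (n : nat) : option X :=
  if pselect (exists x, vertex_code x = n) is left h then Some (sval (cid h)) else None.

Lemma vertex_decK x : vertex_dec (vertex_code x) = Some x.
Proof.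
rewrite /vertex_dec; case: pselect => [h|[]]; last by exists x.
by congr Some; case: cid => y /= /vertex_code_inj.
Qed.

Lemma vertex_codeK n x : vertex_dec n = Some x -> vertex_code x = n.
Proof. by rewrite /vertex_dec; case: pselect => // h [<-]; case: cid. Qed.

Definition vertex_range (m n : nat) : seq X := pmap vertex_dec (index_iota m n).

Lemma vertex_rangeP m n x : x \in vertex_range m n = (m <= vertex_code x < n)%N.
Proof.
rewrite mem_pmap; apply/mapP/idP => [[k]|xn].
  by rewrite mem_index_iota => kn /esym /vertex_codeK ->.
by exists (vertex_code x); rewrite ?mem_index_iota// vertex_decK.
Qed.

Lemma vertex_range_uniq m n : uniq (vertex_range m n).
Proof.
apply: (@pmap_uniq _ _ _ vertex_code); last exact: iota_uniq.
move=> k; rewrite /=; case E : (vertex_dec k) => [x|] //=.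
  by rewrite (vertex_codeK E).
Qed.

Lemma vertex_sumE (V : zmodType) (f : X -> V) m n :
  \sum_(m <= j < n) oapp f 0 (vertex_dec j) = \sum_(x <- vertex_range m n) f x.
Proof.
rewrite /vertex_range; elim: (index_iota m n) => [|j s ih]; first by rewrite !big_nil.
rewrite big_cons ih /=; case: (vertex_dec j) => [x|] /=; last by rewrite add0r.
by rewrite big_cons.
Qed.

Lemma vertex_sum_le t (M : R) m n : (forall x, 0 <= t x) ->
  (\esum_(x in [set: X]) (t x)%:E <= M%:E)%E ->
  \sum_(m <= j < n) oapp t 0 (vertex_dec j) <= M.
Proof.
move=> t0 tM; rewrite vertex_sumE -lee_fin -sumEFin; apply: le_trans tM.
by apply: sum_le_esum => [x|//|//]; [rewrite lee_fin|exact: vertex_range_uniq].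
Qed.

Lemma vertex_code_bound (s : seq X) : exists k, forall x, x \in s -> (vertex_code x < k)%N.
Proof.
elim: s => [|x s [k hk]]; first by exists 0%N.
exists (maxn (vertex_code x).+1 k) => y; rewrite inE leq_max => /orP[/eqP ->|/hk ->].
  by rewrite leqnn.
by rewrite orbT.
Qed.

(** A finite set of vertices of code at least n lies in some [vertex_range n m], whose sum is a
    block of a convergent series. *)
Lemma esum_outside_le t (M : R) : (forall x, 0 <= t x) ->
  (\esum_(x in [set: X]) (t x)%:E <= M%:E)%E ->
  forall eps : R, 0 < eps -> exists N, forall n, (N <= n)%N ->
    (\esum_(x in [set x | (n <= vertex_code x)%N]) (t x)%:E <= eps%:E)%E.
Proof.
move=> t0 tM eps e0.
have d0 j : 0 <= oapp t 0 (vertex_dec j) by case: (vertex_dec j).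
have [N hN] := bounded_series_tail d0 (fun n => vertex_sum_le 0 n t0 tM) e0.
exists N => n Nn; apply: esum_le_seq => s us sn.
have [k hk] := vertex_code_bound s.
pose m := (n + k)%N.
have sm x : x \in s -> x \in vertex_range n m.
  by move=> xs; rewrite vertex_rangeP (sn x xs) /= ltn_addl// hk.
apply: (@le_trans _ _ (\sum_(x <- vertex_range n m) (t x)%:E)%E).
  have t0' x : (0 <= (t x)%:E)%E by rewrite lee_fin.
  rewrite -(esum_uniq_seq t0' (vertex_range_uniq n m)).
  exact: sum_le_esum.
by rewrite sumEFin lee_fin -vertex_sumE hN// leq_addr.
Qed.

End enumeration.

(** * Atoms, the norm of H^1 and point evaluations *)

Section spaces_on_tree.
Context {R : realType} {X : pointedType}.
Variables (q : nat) (e : rel X) (o : X) (alpha : R).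
Hypothesis q_ge2 : (2 <= q)%N.
Hypothesis tree_e : homogeneous_tree q e.
Hypothesis alpha_gt1 : 1 < alpha.
Local Notation C := R[i].
Implicit Types (x y v : X) (D : set X) (f a : X -> C).

Local Notation w := (weight q e o alpha).
Local Notation mu := (tree_measure q e o alpha).
Local Notation wsum := (wsum q e o alpha).
Local Notation Dy := (dyadic e o).

Let w_gt0 x : 0 < w x.
Proof. exact: weight_gt0. Qed.

Let w_ge0 x : 0 <= w x.
Proof. exact: weight_ge0. Qed.

Let cabs_nneg f x : 0 <= cabs (f x).
Proof. exact: cabs_ge0. Qed.

Let norm1E f : Lp_norm mu 1 f = wsum setT (fun x => cabs (f x)).
Proof. exact: Lp_norm1. Qed.

Lemma dyadic_nonempty D : Dy D -> exists x, D x.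
Proof. by move=> [v [->|->]]; exists v => //; exact: sector_refl. Qed.

Lemma atom_wsum_le1 a : atom mu Dy a -> (wsum setT (fun x => cabs (a x)) <= 1)%E.
Proof.
move=> [->|[D hD [aD aoo _]]].
  have v0 : 0 < vol mu [set: X] by exact: (@vol_gt0 _ _ _ _ o _ q_ge2 tree_e alpha_gt1 _ o).
  rewrite (_ : (fun x => _) = (fun=> (vol mu [set: X])^-1)).
    by rewrite wsum_cst ?invr_ge0 ?(ltW v0)// mulVf// gt_eqF.
  by apply/funext => x; rewrite cabs_real ger0_norm// invr_ge0 ltW.
have [y yD] := dyadic_nonempty hD.
have v0 : 0 < vol mu D by exact: (vol_gt0 o q_ge2 tree_e alpha_gt1 yD).
have {}aoo := (Loo_norm_le o q_ge2 tree_e alpha_gt1 _ a).1 aoo.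
apply: (@le_trans _ _ (wsum D (fun=> (vol mu D)^-1))); last first.
  by rewrite wsum_cst ?invr_ge0 ?(ltW v0)// mulVf// gt_eqF.
rewrite [leLHS]esum_mkcond [leRHS]esum_mkcond; apply: le_esum => x _; rewrite in_setT.
case: ifPn => [_|/negP]; first by rewrite lee_fin ler_wpM2r.
by rewrite inE => /aD ->; rewrite cabs0 mul0r.
Qed.

Lemma wsum_norm_sum (s : seq nat) (lam : nat -> C) (a : nat -> X -> C) :
  (forall j, (wsum setT (fun x => cabs (a j x)) <= 1)%E) ->
  (wsum setT (fun x => cabs (\sum_(j <- s) lam j * a j x)%R) <=
   (\sum_(j <- s) cabs (lam j))%:E)%E.
Proof.
move=> ha; elim: s => [|j s ih].
  rewrite big_nil (_ : (fun x => _) = fun=> 0); last by apply/funext => x; rewrite big_nil cabs0.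
  by rewrite wsum_cst// mul0r.
rewrite big_cons EFinD.
apply: (@le_trans _ _ (wsum setT (fun x => cabs (lam j) * cabs (a j x) +
    cabs (\sum_(j <- s) lam j * a j x)))).
  by apply: le_wsum => // x _; rewrite big_cons (le_trans (cabsD _ _))// cabsM.
have p1 x : 0 <= cabs (lam j) * cabs (a j x) by rewrite mulr_ge0 ?cabs_ge0.
have p2 x : 0 <= cabs (\sum_(j <- s) lam j * a j x) by exact: cabs_ge0.
have p3 x : 0 <= cabs (a j x) by exact: cabs_ge0.
rewrite (wsumD _ _ _ _ _ p1 p2) leeD// (wsumZ _ _ _ _ _ p3) ?cabs_ge0//.
by rewrite -[leRHS]mule1 lee_wpmul2l ?lee_fin ?cabs_ge0.
Qed.

Lemma cvg0_ereal_le (u : nat -> \bar R) : u @ \oo --> 0%E ->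
  forall eps : R, 0 < eps -> exists N, forall n, (N <= n)%N -> (u n <= eps%:E)%E.
Proof.
move=> u0 eps e0.
have : nbhs (0%E : \bar R) [set x | (x < eps%:E)%E].
  by apply: open_nbhs_nbhs; split; [exact: open_ereal_lt_ereal|rewrite /= lte_fin].
by move=> /u0[N _ hN]; exists N => n Nn; apply/ltW; exact: hN.
Qed.

Lemma ereal_le_cvg0 (u : nat -> \bar R) : (forall n, (0 <= u n)%E) ->
  (forall eps : R, 0 < eps -> exists N, forall n, (N <= n)%N -> (u n <= eps%:E)%E) ->
  u @ \oo --> 0%E.
Proof.
move=> u0 hu; have fin (r : R) (x : \bar R) : (0 <= x)%E -> (x <= r%:E)%E -> x \is a fin_num.
  by move=> x0 xr; rewrite ge0_fin_numE// (le_lt_trans xr)// ltry.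
apply/fine_cvgP; split.
  by have [N hN] := hu 1 ltr01; exists N => // n /= /hN; exact: fin.
apply/cvgrPdist_le => /= eps e0; have [N hN] := hu eps e0; exists N => // n /= /hN h.
by rewrite sub0r normrN ger0_norm ?fine_ge0// -lee_fin fineK// (fin eps).
Qed.

Lemma L1_le_atomic g (lam : nat -> C) (a : nat -> X -> C) : atomic_decomposition mu Dy g lam a ->
  (Lp_norm mu 1 g <= \sum_(0 <= j <oo) (cabs (lam j))%:E)%E.
Proof.
move=> [ha _ /cvg0_ereal_le conv]; apply/lee_addgt0Pr => eps e0.
have [N hN] := conv _ e0; have := hN N (leqnn N); rewrite !norm1E => hg.
apply: (@le_trans _ _ (wsum setT (fun x => cabs (\sum_(0 <= j < N) lam j * a j x) +
    cabs (g x - \sum_(0 <= j < N) lam j * a j x)))).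
  apply: le_wsum => // x _; rewrite [X in _ <= X]addrC.
  by rewrite -[X in cabs X <= _](subrK (\sum_(0 <= j < N) lam j * a j x)) cabsD.
have p1 x : 0 <= cabs (\sum_(0 <= j < N) lam j * a j x) by exact: cabs_ge0.
have p2 x : 0 <= cabs (g x - \sum_(0 <= j < N) lam j * a j x) by exact: cabs_ge0.
rewrite (wsumD _ _ _ _ _ p1 p2); apply: leeD => //; apply: le_trans (wsum_norm_sum _ _ _) _.
  by move=> j; apply: atom_wsum_le1.
rewrite -sumEFin; apply: nneseries_lim_ge => j _ _; by rewrite lee_fin cabs_ge0.
Qed.

Lemma H1_norm_ge0 f : (0 <= H1_norm mu Dy f)%E.
Proof.
apply/ereal_infP => _ [lam [a [_ ->]]]; apply: nneseries_ge0 => j _ _.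
by rewrite lee_fin cabs_ge0.
Qed.

Lemma L1_le_H1 f : (Lp_norm mu 1 f <= H1_norm mu Dy f)%E.
Proof. by apply/ereal_infP => _ [lam [a [hd ->]]]; exact: L1_le_atomic hd. Qed.

Lemma H1_eval_bounded x : eval_bounded (H1 mu Dy) x.
Proof.
exists (w x)^-1 => f _; rewrite lee_pdivlMl//; apply: le_trans (L1_le_H1 f).
rewrite norm1E -EFinM mulrC.
exact: (@wsum_ge_point _ _ q e o alpha setT (fun x => cabs (f x))).
Qed.

(** The single term |f x|^p w x is at most the p-th power of the norm. *)
Lemma Lp_eval_bounded (p : R) x : 0 < p -> eval_bounded (Lp mu p%:E) x.
Proof.
move=> p0; exists (w x `^ (- p^-1)) => f foo.
have f0 : (0 <= fnorm (Lp mu p%:E) f)%E by exact: Lnorm_ge0.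
have E : fnorm (Lp mu p%:E) f = (fine (fnorm (Lp mu p%:E) f))%:E.
  by rewrite fineK// ge0_fin_numE.
have N0 := fine_ge0 f0; move: (fine _) N0 E => N N0 E.
have : (Lp_norm mu p%:E f <= N%:E)%E by rewrite -E.
move=> /(Lp_norm_le o alpha tree_e f p0 N0) hN.
have pw0 x' : 0 <= cabs (f x') `^ p by exact: powR_ge0.
have := le_trans (wsum_ge_point q e o alpha pw0 (I : [set: X] x)) hN.
rewrite E -EFinM !lee_fin; move: (w x) (w_gt0 x) => W W0 h.
have := @ge0_ler_powR _ p^-1 _ (cabs (f x) `^ p * W) (N `^ p).
rewrite invr_ge0 (ltW p0) !nnegrE mulr_ge0 ?powR_ge0 ?(ltW W0)// => /(_ isT isT isT h).
rewrite powRM ?powR_ge0 ?(ltW W0)// -!powRrM mulfV ?(gt_eqF p0)// !powRr1 ?cabs_ge0//.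
by rewrite powRN ler_pdivlMl ?powR_gt0// mulrC.
Qed.

(* The partial sums are assumed eventually constant at each point, which is
   how the series of this development arise. *)
Lemma H1_series (lam : nat -> C) (a : nat -> X -> C) (g : X -> C) (M : R) :
  (forall j, atom mu Dy (a j)) -> (forall n, \sum_(0 <= j < n) cabs (lam j) <= M) ->
  (forall x, exists N, forall n, (N <= n)%N -> \sum_(0 <= j < n) lam j * a j x = g x) ->
  atomic_decomposition mu Dy g lam a.
Proof.
move=> ha hM hg.
have l0 j : 0 <= cabs (lam j) by exact: cabs_ge0.
split=> //.
  apply: (@le_lt_trans _ _ M%:E); last exact: ltry.
  apply: lime_le; first by apply: is_cvg_nneseries => n _ _; rewrite lee_fin.
  by apply: nearW => n; rewrite sumEFin lee_fin.
apply: ereal_le_cvg0 => [n|eps e0]; first exact: Lnorm_ge0.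
have [N hN] := bounded_series_tail l0 hM e0.
exists N => n Nn; rewrite norm1E; apply: esum_le_seq => s us _.
have [m nm hm] : exists2 m, (n <= m)%N &
    forall x, x \in s -> \sum_(0 <= j < m) lam j * a j x = g x.
  suff [m hm] : exists m, forall k x, (m <= k)%N -> x \in s ->
      \sum_(0 <= j < k) lam j * a j x = g x.
    by exists (n + m)%N => [|x xs]; [exact: leq_addr|apply: hm => //; exact: leq_addl].
  elim: s {us} => [|x s [m hm]]; first by exists 0%N.
  have [k hk] := hg x; exists (maxn k m) => i y; rewrite geq_max => /andP[ki mi].
  by rewrite inE => /orP[/eqP ->|]; [exact: hk|exact: hm].
apply: (@le_trans _ _ (wsum setT (fun x => cabs (\sum_(n <= j < m) lam j * a j x)))).
  apply: (@le_trans _ _ (\sum_(x <- s) (cabs (\sum_(n <= j < m) lam j * a j x) * w x)%:E)%E).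
    rewrite !big_seq; apply: lee_sum => x xs; rewrite lee_fin ler_wpM2r//.
    rewrite -(hm x xs) (@big_cat_nat _ _ _ n 0 m)//= [X in X - _]addrC addrK.
    exact: lexx.
  by apply: sum_le_esum => // x; rewrite lee_fin mulr_ge0// cabs_ge0.
apply: le_trans (wsum_norm_sum _ _ _) _; first by move=> j; exact: atom_wsum_le1.
by rewrite lee_fin hN.
Qed.

Lemma H1_norm_le (lam : nat -> C) (a : nat -> X -> C) g (M : R) : atomic_decomposition mu Dy g lam a ->
  (forall n, \sum_(0 <= j < n) cabs (lam j) <= M) -> (H1_norm mu Dy g <= M%:E)%E.
Proof.
move=> hd hM; apply: ereal_inf_le.
exists (\sum_(0 <= j <oo) (cabs (lam j))%:E)%E; first by exists lam, a.
apply: lime_le; first by apply: is_cvg_nneseries => n _ _; rewrite lee_fin cabs_ge0.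
by apply: nearW => n; rewrite sumEFin lee_fin.
Qed.

Lemma H1_carrier (lam : nat -> C) (a : nat -> X -> C) g : atomic_decomposition mu Dy g lam a ->
  fcarrier (H1 mu Dy) g.
Proof.
move=> hd; split; last by exists lam, a.
by case: (hd) => _ + _; apply: le_lt_trans; exact: L1_le_atomic hd.
Qed.

End spaces_on_tree.

(** * Phases, Young's inequality and complex powers *)

Section duality_tools.
Context {R : realType}.
Local Notation C := R[i].

Lemma phase_exists (z : C) : exists u : C, cabs u <= 1 /\ u * z = (cabs z)%:C%C.
Proof.
have [->|z0] := eqVneq z 0; first by exists 0; rewrite cabs0 mul0r.
have cz0 : cabs z != 0 by apply: contra z0 => /eqP/cabs_eq0 ->.
exists ((cabs z)%:C%C / z); rewrite divfK//; split=> //.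
by rewrite cabsM cabsV cabs_real ger0_norm ?cabs_ge0// mulfV.
Qed.

Definition phase (z : C) : C := sval (cid (phase_exists z)).

Lemma cabs_phase z : cabs (phase z) <= 1.
Proof. by rewrite /phase; case: cid => u /= []. Qed.

Lemma phaseM z : phase z * z = (cabs z)%:C%C.
Proof. by rewrite /phase; case: cid => u /= []. Qed.

Lemma powRV (x r : R) : 0 <= x -> x^-1 `^ r = x `^ (- r).
Proof. by move=> x0; rewrite -(powR_inv1 x0) -powRrM mulN1r. Qed.

(** The left side is at most the larger of a^s and t^s. Coefficients 1 in place of 1 / s and 1 - 1 /
    s are the origin of the factor 2 in [H1_Lp_interp_le]. *)
Lemma young_mul (s a t : R) : 1 < s -> 0 <= a -> 0 <= t ->
  a * t `^ (s - 1) <= a `^ s + t `^ s.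
Proof.
move=> s1 a0 t0; have s0 : 0 < s by rewrite (lt_trans ltr01).
rewrite -(mulr_powRB1 a0 s0) -(mulr_powRB1 t0 s0).
have s10 : 0 <= s - 1 by rewrite subr_ge0 ltW.
have [ta|/ltW at_] := leP t a.
  rewrite (@le_trans _ _ (a * a `^ (s - 1)))// ?lerDl ?mulr_ge0 ?powR_ge0//.
  by rewrite ler_wpM2l// ge0_ler_powR ?nnegrE.
rewrite (@le_trans _ _ (t * t `^ (s - 1)))// ?lerDr ?mulr_ge0 ?powR_ge0//.
by rewrite ler_wpM2r// powR_ge0.
Qed.

Lemma cexp_ln (b r : R) (z : C) : 0 < r ->
  cabs (cexp ((b * ln r)%:C%C * z)) = r `^ (b * complex.Re z).
Proof.
by move=> r0; rewrite cabs_cexp Re_realM /powR gt_eqF//; congr expR; ring.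
Qed.

Lemma cexp_ln_real (b r t : R) : 0 < r ->
  cexp ((b * ln r)%:C%C * t%:C%C) = (r `^ (b * t))%:C%C :> C.
Proof.
move=> r0; rewrite -rmorphM cexp_real /powR gt_eqF//; congr (expR _)%:C%C; ring.
Qed.

End duality_tools.

(** * Lower bound for (H^1, L^p1) *)

Section lower_bound_H1.
Context {R : realType} {X : pointedType}.
Variables (q : nat) (e : rel X) (o : X) (alpha : R).
Hypothesis q_ge2 : (2 <= q)%N.
Hypothesis tree_e : homogeneous_tree q e.
Hypothesis alpha_gt1 : 1 < alpha.
Local Notation C := R[i].
Implicit Types (x y v : X) (f : X -> C) (s : seq X).

Local Notation w := (weight q e o alpha).
Local Notation mu := (tree_measure q e o alpha).
Local Notation wsum := (wsum q e o alpha).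
Local Notation Dy := (dyadic e o).

Lemma Lp_norm_finite_sum (p M : R) f : 0 < p -> 0 <= M ->
  (forall s, uniq s -> \sum_(x <- s) cabs (f x) `^ p * w x <= M `^ p) ->
  (Lp_norm mu p%:E f <= M%:E)%E.
Proof.
move=> p0 M0 hs; apply/(Lp_norm_le o alpha tree_e f p0 M0).
by apply: esum_le_seq => s us _; rewrite sumEFin lee_fin hs.
Qed.

Lemma finite_sum_Lp_norm (p M : R) f s : 0 < p -> 0 <= M -> uniq s ->
  (Lp_norm mu p%:E f <= M%:E)%E -> \sum_(x <- s) cabs (f x) `^ p * w x <= M `^ p.
Proof.
move=> p0 M0 us /(Lp_norm_le o alpha tree_e f p0 M0); rewrite -lee_fin => h.
rewrite -sumEFin; apply: le_trans h; apply: sum_le_esum => // x.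
by rewrite lee_fin mulr_ge0 ?powR_ge0 ?weight_ge0.
Qed.

(* By testing the L^p norm on finite sets it suffices to treat f normalised on
   a finite set of vertices. *)
Lemma Lp_norm_normalised (p K : R) f : 1 < p -> 0 <= K ->
  (forall s (r : X -> R) (M : R), uniq s -> 0 < M -> (forall x, 0 <= r x) ->
     (forall x, cabs (f x) = M * r x) -> \sum_(x <- s) r x `^ p * w x = 1 -> M <= K) ->
  (Lp_norm mu p%:E f <= K%:E)%E.
Proof.
move=> p1 K0 h; have p0 : 0 < p by rewrite (lt_trans ltr01).
apply: Lp_norm_finite_sum => // s us; set n := \sum_(x <- s) _.
have n_ge0 : 0 <= n by apply: sumr_ge0 => x _; rewrite mulr_ge0 ?powR_ge0 ?weight_ge0.
have [->|n0] := eqVneq n 0; first exact: powR_ge0.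
have {}n0 : 0 < n by rewrite lt_neqAle eq_sym n0.
pose M := n `^ p^-1; have M0 : 0 < M by rewrite powR_gt0.
have Mp : M `^ p = n by rewrite /M -powRrM mulVf ?gt_eqF// powRr1.
rewrite -Mp ge0_ler_powR ?nnegrE ?(ltW p0) ?(ltW M0)//; clearbody M.
apply: (h s (fun x => cabs (f x) / M)) => // [x|x|].
- by rewrite divr_ge0 ?cabs_ge0// ltW.
- by rewrite mulrC divfK// gt_eqF.
rewrite (eq_bigr (fun x => n^-1 * (cabs (f x) `^ p * w x))).
  by rewrite -mulr_sumr mulVf// gt_eqF.
move=> x _; rewrite powRM ?cabs_ge0 ?invr_ge0 ?(ltW M0)//.
by rewrite powRV ?(ltW M0)// powRN Mp mulrAC mulrC.
Qed.

Lemma H1_Lp_interp_le (theta p p1 B : R) (F : C -> X -> C) :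
  0 < theta -> theta < 1 -> 1 < p -> p < p1 -> p^-1 = 1 - theta + theta / p1 -> 0 < B ->
  interp_family (H1 mu Dy) (Lp mu p1%:E) F ->
  (Fnorm (H1 mu Dy) (Lp mu p1%:E) F <= B%:E)%E ->
  (Lp_norm mu p%:E (F theta%:C%C) <= (2 * B)%:E)%E.
Proof.
move=> t0 t1 p_gt1 pp1 pE B0 hF FB.
have p0 : 0 < p by rewrite (lt_trans ltr01).
have p1_gt1 : 1 < p1 by rewrite (lt_trans p_gt1).
have p10 : 0 < p1 by rewrite (lt_trans ltr01).
have p1n : p1 != 0 by rewrite gt_eqF.
have pn : p != 0 by rewrite gt_eqF.
apply: Lp_norm_normalised => //; first by rewrite mulr_ge0// ltW.
move=> s r M us M0 r0 fr sum1; set f := F theta%:C%C in fr *.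
(* The power of r is psi z. At theta it is p - 1, dual to L^p. On Re z = 1 its real part is psi,
   which makes r^psi a function of norm 1 on s for the exponent conjugate to p1. *)
have [psi psiE] : exists psi, psi = p * (1 - p1^-1) by exists (p * (1 - p1^-1)).
have psi_theta : psi * theta = p - 1.
  have -> : psi * theta = p * (1 - (1 - theta + theta / p1)) by rewrite psiE; ring.
  by rewrite -pE mulrBr mulr1 mulfV.
(* Vertices with r x = 0 are removed by hand, since exp(psi ln(r x) z) does not represent a power of
   r x there. *)
pose Phi z : C := \sum_(x <- s) F z x * (if r x == 0 then 0 else
  phase (f x) * (w x)%:C%C * cexp ((psi * ln (r x))%:C%C * z)).
have w0 x : 0 <= w x by exact: weight_ge0.
have reg : strip_regular Phi.
  apply: strip_regular_sum => x; apply: strip_regularM.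
    apply: (eval_strip_regular _ _ _ _ hF).
    - exact: H1_norm_ge0.
    - by move=> ?; exact: Lnorm_ge0.
    - exact: H1_eval_bounded.
    - exact: Lp_eval_bounded.
  case: eqP => _; first exact: strip_regular_cst.
  apply: strip_regularM; first exact: strip_regular_cst.
  exact: strip_regular_cexp.
have le_term z : cabs (Phi z) <= \sum_(x <- s) cabs (F z x) * r x `^ (psi * complex.Re z) * w x.
  rewrite (le_trans (cabs_sum _ _ _))//; apply: ler_sum => x _; rewrite cabsM -[leRHS]mulrA.
  rewrite ler_wpM2l ?cabs_ge0//; case: ifPn => rx.
    by rewrite cabs0 mulr_ge0// powR_ge0.
  have rx0 : 0 < r x by rewrite lt_neqAle eq_sym rx r0.
  rewrite 2!cabsM cexp_ln// cabs_real (ger0_norm (w0 x)) mulrC ler_wpM2l ?powR_ge0//.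
  by rewrite ler_piMl// cabs_phase.
have PhiM : Phi theta%:C%C = M%:C%C.
  rewrite -[M]mulr1 -sum1 mulr_sumr rmorph_sum; apply: eq_bigr => x _.
  case: eqP => [rx|/eqP rx].
    have -> : F theta%:C%C x = 0 by apply: cabs_eq0; rewrite -/f fr rx mulr0.
    by rewrite mul0r rx powR0// mul0r mulr0.
  have rx0 : 0 < r x by rewrite lt_neqAle eq_sym rx r0.
  rewrite cexp_ln_real// psi_theta -(mulr_powRB1 (r0 x) p0).
  rewrite -/f !mulrA [f x * phase _]mulrC phaseM fr !rmorphM /=.
  by ring.
suff : cabs (Phi theta%:C%C) <= 2 * B by rewrite PhiM cabs_real gtr0_norm.
apply: (three_lines reg); [by rewrite mulr_ge0// ltW| | |by rewrite /closed_strip /= !ltW].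
(* On Re z = 0 the powers have exponent 0, with 0^0 = 1, and the pairing is at most the L^1 norm,
   hence the H^1 norm. *)
- move=> t; apply: le_trans (le_term _) _ => /=.
  have /le_trans /(_ FB) h := (Fnorm_ge (H1 mu Dy) (Lp mu p1%:E) F t).1.
  have := le_trans (L1_le_H1 o q_ge2 tree_e alpha_gt1 _) h.
  rewrite (Lp_norm1 o alpha tree_e) => {}h.
  apply: (@le_trans _ _ B); last by rewrite ler_peMl ?(ltW B0)// ler1n.
  rewrite -lee_fin -sumEFin; apply: le_trans h.
  apply: (@le_trans _ _ (\sum_(x <- s) (cabs (F (Complex 0 t) x) * w x)%:E)%E).
    by apply: lee_sum => x _; rewrite lee_fin mulr0 powRr0 mulr1.
  by apply: sum_le_esum => // x; rewrite lee_fin mulr_ge0 ?cabs_ge0.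
- move=> t; apply: le_trans (le_term _) _ => /=; rewrite mulr1.
  have /le_trans /(_ FB) h := (Fnorm_ge (H1 mu Dy) (Lp mu p1%:E) F t).2.
  have {}h := finite_sum_Lp_norm p10 (ltW B0) us h.
  (* Young's inequality for |F| / B and r^(p / p1), whose p1-th powers each have weighted sum at
     most 1. *)
  apply: (@le_trans _ _ (\sum_(x <- s) (B * B `^ (- p1) *
     (cabs (F (Complex 1 t) x) `^ p1 * w x) + B * (r x `^ p * w x)))).
    apply: ler_sum => x _; set G := cabs _.
    have := @young_mul R p1 (G / B) (r x `^ (p / p1)) p1_gt1.
    move=> /(_ (divr_ge0 (cabs_ge0 _) (ltW B0)) (powR_ge0 _ _)).
    rewrite -!powRrM.
    have -> : p / p1 * (p1 - 1) = psi by rewrite psiE; field.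
    have -> : p / p1 * p1 = p by rewrite divfK.
    rewrite powRM ?cabs_ge0 ?invr_ge0 ?(ltW B0)//.
    rewrite powRV ?(ltW B0)// => hG.
    have -> : G * r x `^ psi * w x = B * w x * (G / B * r x `^ psi).
      by field; rewrite gt_eqF.
    have -> : B * B `^ (- p1) * (G `^ p1 * w x) + B * (r x `^ p * w x) =
        B * w x * (G `^ p1 * B `^ (- p1) + r x `^ p) by ring.
    by rewrite ler_wpM2l// mulr_ge0// ltW.
  rewrite big_split /= -!mulr_sumr sum1 mulr1 mulrDl mul1r lerD2r -mulrA ler_piMr ?(ltW B0)//.
  apply: le_trans (ler_wpM2l (powR_ge0 _ _) h) _.
  by rewrite -powRD ?addNr ?powRr0// (gt_eqF B0) implybT.
Qed.

End lower_bound_H1.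

Lemma disjoint_intro (T : Type) (A B : set T) :
  (forall y, A y -> ~ B y) -> [disjoint A & B].
Proof. by move=> AB; apply/disj_set2P; rewrite -subset0 => y [/AB]. Qed.

(** * Atoms attached to the vertices *)

Section sector_atoms.
Context {R : realType} {X : pointedType}.
Variables (q : nat) (e : rel X) (o : X) (alpha : R).
Hypothesis q_ge2 : (2 <= q)%N.
Hypothesis tree_e : homogeneous_tree q e.
Hypothesis alpha_gt1 : 1 < alpha.
Local Notation C := R[i].
Implicit Types (x y v : X) (f : X -> C).

Local Notation p := (pred_vertex e o).
Local Notation lev := (gdist e o).
Local Notation w := (weight q e o alpha).
Local Notation mu := (tree_measure q e o alpha).
Local Notation Dy := (dyadic e o).
Local Notation T := (sector e o).
Local Notation kids := (children o tree_e).

Let w_gt0 x : 0 < w x.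
Proof. exact: weight_gt0. Qed.

Lemma kid_level x c : c \in kids x -> lev c = (lev x).+1.
Proof. by move=> /childrenP[co <-]; have [_ <-] := pred_vertexP tree_e co. Qed.

(** A common descendant determines both as its ancestor on the level just below x. *)
Lemma kid_sector_disjoint x c c' : c \in kids x -> c' \in kids x ->
  T c `&` T c' !=set0 -> c = c'.
Proof.
move=> cx cx' [y []]; rewrite !(sectorE o tree_e) => -[l _ [yc ly]] [l' _ [yc' ly']].
rewrite -yc -yc'; congr (iter _ p y); apply/eqP.
by rewrite -(eqn_add2l (lev x).+1) -(kid_level cx) -ly ly' (kid_level cx') (kid_level cx).
Qed.

Lemma kid_sector_level x c y : c \in kids x -> T c y -> (lev x < lev y)%N.
Proof.
move=> /kid_level cx; rewrite (sectorE o tree_e) => -[l _ [_ ->]].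
by rewrite cx leq_addr.
Qed.

Lemma sector_kids x : T x = [set x] `|` [set y | exists2 c, c \in kids x & T c y].
Proof.
apply/seteqP; split=> y.
  rewrite (sectorE o tree_e) => -[[|l] _ [yx ly]]; first by left.
  right; exists (iter l p y); last by exists l.
  apply/childrenP; split=> [yo|]; last by rewrite -iterS.
  by have := gdist_iter o tree_e l y; rewrite yo (gdist0 o tree_e) ly; lia.
case=> [->|[c /childrenP[_ cx] [l ly]]]; first exact: sector_refl.
by exists l.+1; rewrite iterS ly.
Qed.

(** Used to recover f from its sector sums: w x f x is the sum over T_x minus those over the sectors
    of the children. *)
Lemma cint_sector f x : summable_on q e o alpha f ->
  cint mu (T x) f = (w x)%:C%C * f x + \sum_(c <- kids x) cint mu (T c) f.
Proof.
move=> sf; rewrite sector_kids (cint_setU tree_e)//; last first.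
  apply: disjoint_intro => y /= -> [c cx /(kid_sector_level cx)].
  by rewrite ltnn.
rewrite cint_set1; congr (_ + _).
have : {subset kids x <= kids x} by [].
have := children_uniq o tree_e x; move: {1 2 4 5}(kids x) => s.
elim: s => [_ _|c s ih].
  rewrite big_nil -[RHS](cint_set0 q e o alpha f); congr cint.
  by apply/seteqP; split=> // y [].
rewrite cons_uniq => /andP[cs us] sx; rewrite big_cons -ih//; last first.
  by move=> y ys; apply: sx; rewrite inE ys orbT.
rewrite -(cint_setU tree_e sf).
  congr cint; apply/seteqP; split=> y.
    move=> [d]; rewrite inE => /orP[/eqP ->|ds] dy; [by left|].
    by right; exists d.
  case=> [cy|[d ds dy]]; first by exists c => //; exact: mem_head.
  by exists d => //; rewrite inE ds orbT.
apply: disjoint_intro => y cy [d ds dy].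
have dx : d \in kids x by apply: sx; rewrite inE ds orbT.
have cx : c \in kids x by apply: sx; exact: mem_head.
have cd : c = d by apply: (kid_sector_disjoint cx dx); exists y.
by move: cs; rewrite cd ds.
Qed.

(** Normalises the difference of point masses: its values are at most 2 / w v, while T_(p v) has
    volume at most [sector_const] times w v / [decay]. *)
Definition atom_const : R := 2 * sector_const q alpha / decay q alpha.

Lemma atom_const_gt0 : 0 < atom_const.
Proof. by rewrite divr_gt0 ?decay_gt0// mulr_gt0// sector_const_gt0. Qed.

(* The part of the atom that makes its integral vanish: at the origin, which
   has no predecessor, the mass is spread over the whole tree. *)
Definition balance v x : R :=
  if v == o then (vol mu [set: X])^-1 else (x == p v)%:R / w (p v).

Definition sector_atom v x : C :=
  ((((x == v)%:R / w v - balance v x) / atom_const)%R)%:C%C.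

Lemma volT_gt0 : 0 < vol mu [set: X].
Proof. exact: (vol_gt0 o q_ge2 tree_e alpha_gt1 (x := o)). Qed.

Lemma weight_le_volT x : w x <= vol mu [set: X].
Proof. exact: (weight_le_vol o q_ge2 tree_e alpha_gt1 (D := setT)). Qed.

Lemma balance_bound v x : 0 <= balance v x <= (w v)^-1.
Proof.
rewrite /balance; case: eqP => [->|_].
  by rewrite invr_ge0 ltW ?volT_gt0//= lef_pV2 ?posrE ?volT_gt0// weight_le_volT.
have wV : (w (p v))^-1 <= (w v)^-1 by rewrite lef_pV2 ?posrE// weight_le_pred.
case: eqP => _; last by rewrite mul0r lexx /= invr_ge0 ltW.
by rewrite mul1r invr_ge0 ltW.
Qed.

Lemma sector_atom_bound v x :
  cabs (sector_atom v x) <= (vol mu (T (p v)))^-1.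
Proof.
have /andP[b0 b1] := balance_bound v x.
have wV0 : 0 < (w v)^-1 by rewrite invr_gt0.
have vT : 0 < vol mu (T (p v)).
  exact: (vol_gt0 o q_ge2 tree_e alpha_gt1 (sector_refl _ _ _)).
rewrite cabs_real normrM [`|atom_const^-1|]gtr0_norm ?invr_gt0 ?atom_const_gt0//.
apply: (@le_trans _ _ (2 * (w v)^-1 / atom_const)).
  rewrite ler_wpM2r ?invr_ge0 ?(ltW atom_const_gt0)// ler_norml.
  by case: eqP => _; rewrite ?mul0r ?mul1r; apply/andP; split; lra.
rewrite -[leRHS]div1r ler_pdivlMr//.
have vle : vol mu (T (p v)) <= sector_const q alpha * (decay q alpha)^-1 * w v.
  apply: le_trans (vol_sector_le o q_ge2 tree_e alpha_gt1 (p v)) _.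
  rewrite -mulrA ler_wpM2l ?(ltW (sector_const_gt0 q_ge2 alpha_gt1))// mulrC ler_pdivlMr ?decay_gt0//.
  by rewrite mulrC weight_pred_le.
have k0 : 0 <= 2 * (w v)^-1 / atom_const.
  by apply: divr_ge0; [apply: mulr_ge0 => //; exact: ltW|exact/ltW/atom_const_gt0].
apply: le_trans (ler_wpM2l k0 vle) _.
rewrite /atom_const le_eqVlt; apply/orP; left; apply/eqP.
have := decay_gt0 q_ge2 alpha_gt1; have := sector_const_gt0 q_ge2 alpha_gt1.
have := w_gt0 v; move: (w v) (sector_const _ _) (decay _ _) => a b d a_gt0 b_gt0 d_gt0.
by field; rewrite !gt_eqF.
Qed.

Lemma sector_atom_summable v : summable_on q e o alpha (sector_atom v).
Proof.
apply: (@le_lt_trans _ _ (wsum q e o alpha setT (fun=> (vol mu (T (p v)))^-1))).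
  by apply: le_wsum => x _; exact: sector_atom_bound.
rewrite (wsum_cst o q_ge2 tree_e alpha_gt1) ?ltry// invr_ge0.
exact: (vol_ge0 o q_ge2 tree_e alpha_gt1).
Qed.

Lemma cint_vanish (D : set X) f : (forall x, D x -> f x = 0) -> cint mu D f = 0.
Proof.
by move=> h; rewrite (@cint_eq_on _ _ _ _ _ _ _ _ (fun=> 0))// cint_cst mulr0.
Qed.

(** The dyadic set is T_(p v), which is all of X for v = o since [p o = o]. The integral vanishes
    because the mass at v and the [balance] both have total mass 1. *)
Lemma sector_atomP v : atom mu Dy (sector_atom v).
Proof.
right; exists (T (p v)); first by exists (p v); right.
split=> [x nTx||].
- rewrite /sector_atom /balance; have xv : x == v = false.
    by apply/eqP => xv; apply: nTx; rewrite xv; exact: sector_pred.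
  have xp : x == p v = false.
    by apply/eqP => xp; apply: nTx; rewrite xp; exact: sector_refl.
  case: (eqVneq v o) => [vo|_]; last by rewrite xv xp !mul0r subr0 mul0r.
  exfalso; apply: nTx; rewrite vo (pred_vertex_origin o tree_e) (sector_origin o tree_e).
  exact: I.
- apply/(Loo_norm_le o q_ge2 tree_e alpha_gt1) => x; exact: sector_atom_bound.
- have sum_a := sector_atom_summable v.
  (* Splitting off v, and then p v when v is not the origin, leaves an integrand that is constant on
     the rest of the sector. *)
  have split1 (D : set X) x f : D x -> summable_on q e o alpha f ->
      cint mu D f = (w x)%:C%C * f x + cint mu (D `\ x) f.
    move=> Dx sf; rewrite -(cint_set1 q e o alpha x f) -(cint_setU tree_e sf).
      by congr cint; apply/seteqP; split=> y; [case: (eqVneq y x) => [->|/eqP yx]; [left|right]|case=> [->|[]]].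
    by apply: disjoint_intro => y /= -> [].
  rewrite (split1 _ v)//; last exact: sector_pred.
  have [vo|/eqP vo] := eqVneq v o.
    rewrite (@cint_eq_on _ _ _ _ _ _ _ _ (fun=> (- (vol mu setT)^-1 / atom_const)%:C%C)); last first.
      move=> x [_ xv]; rewrite /sector_atom /balance vo eqxx.
      by case: eqP => [xo|_]; [case: xv; rewrite xo vo|rewrite mul0r sub0r].
    rewrite cint_cst.
    have vE : vol mu (T (p v)) = w v + vol mu (T (p v) `\ v).
      have := split1 (T (p v)) v (fun=> 1) (sector_pred _ _ _).
      rewrite !cint_cst !mulr1 -rmorphD => h.
      have /h : summable_on q e o alpha (fun=> 1).
        rewrite /summable_on cabs1 (wsum_cst o q_ge2 tree_e alpha_gt1)// ltry//.
      by move=> [].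
    have -> : vol mu (T (p v) `\ v) = vol mu setT - w v.
      have TT : T (p v) = setT.
        by rewrite vo (pred_vertex_origin o tree_e) (sector_origin o tree_e).
      by move: vE; rewrite TT => ->; rewrite addrC addKr.
    rewrite /sector_atom /balance vo !eqxx -!rmorphM -rmorphD /=.
    have := volT_gt0; have := w_gt0 o; have := atom_const_gt0.
    move: (vol _ _) (w o) atom_const => a b c c0 b0 a0.
    rewrite (_ : _ + _ = 0)//; field; rewrite !gt_eqF//.
  have pv : p v <> v.
    by move=> pv; have [_] := pred_vertexP tree_e vo; rewrite pv; lia.
  rewrite (split1 _ (p v))//; last by split; [exact: sector_refl|].
  rewrite cint_vanish ?addr0.
    rewrite /sector_atom /balance; have -> : (v == o) = false by apply/eqP.
    have -> : (p v == v) = false by apply/eqP.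
    rewrite eq_sym; have -> : (p v == v) = false by apply/eqP.
    rewrite !eqxx -!rmorphM -rmorphD /=.
    have := w_gt0 v; have := w_gt0 (p v); have := atom_const_gt0.
    move: (w v) (w (p v)) atom_const => a b c c0 b0 a0.
    rewrite (_ : _ + _ = 0)//; field; rewrite !gt_eqF//.
  move=> x [[_ xv] xp]; rewrite /sector_atom /balance.
  have -> : (v == o) = false by apply/eqP.
  have -> : (x == v) = false by apply/eqP.
  have -> : (x == p v) = false by apply/eqP.
  by rewrite !mul0r subr0 mul0r.
Qed.

Definition constant_atom : X -> C := fun=> ((vol mu setT)^-1%R)%:C%C.

Lemma constant_atomP : atom mu Dy constant_atom.
Proof. by left. Qed.

End sector_atoms.

(** * Functionals applied to atomic series *)

Section functionals_on_H1.
Context {R : realType} {X : pointedType}.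
Variables (q : nat) (e : rel X) (o : X) (alpha : R).
Hypothesis q_ge2 : (2 <= q)%N.
Hypothesis tree_e : homogeneous_tree q e.
Hypothesis alpha_gt1 : 1 < alpha.
Local Notation C := R[i].
Local Notation mu := (tree_measure q e o alpha).
Local Notation Dy := (dyadic e o).

Lemma shift_sum (V : zmodType) (F : nat -> V) n m :
  \sum_(0 <= j < m) F (n + j)%N = \sum_(n <= j < n + m) F j.
Proof.
have := @big_addn V 0 +%R 0 (n + m) n xpredT F; rewrite add0n addKn => ->.
by apply: eq_bigr => j _; rewrite addnC.
Qed.

Lemma tail_eventually (lam : nat -> C) (a : nat -> X -> C) (g : X -> C) n :
  (forall x, exists N, forall n, (N <= n)%N -> \sum_(0 <= j < n) lam j * a j x = g x) ->
  forall x, exists N, forall m, (N <= m)%N ->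
    \sum_(0 <= j < m) lam (n + j)%N * a (n + j)%N x =
    g x - \sum_(0 <= j < n) lam j * a j x.
Proof.
move=> hg x; have [N hN] := hg x; exists N => m Nm.
rewrite -(hN (n + m)%N); last by rewrite (leq_trans Nm)// leq_addl.
rewrite [X in X - _](@big_cat_nat _ _ _ n)//= ?leq_addr// [X in X - _]addrC addrK.
exact: (shift_sum (fun j => lam j * a j x)).
Qed.

(** The remainder after n terms is the sum of the shifted series, so its H^1 norm is at most the
    tail of the coefficients. As [ell] is additive only on the carrier, each term and each remainder
    must be placed in H^1. *)
Lemma H1_functional_series (ell : (X -> C) -> C) (K M : R) (lam : nat -> C)
    (a : nat -> X -> C) (g : X -> C) :
  (forall f f', fcarrier (H1 mu Dy) f -> fcarrier (H1 mu Dy) f' ->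
     ell (f \+ f') = ell f + ell f') ->
  (forall c f, fcarrier (H1 mu Dy) f -> ell (fun x => c * f x) = c * ell f) ->
  0 <= K ->
  (forall f, fcarrier (H1 mu Dy) f -> ((cabs (ell f))%:E <= K%:E * H1_norm mu Dy f)%E) ->
  (forall j, atom mu Dy (a j)) -> (forall n, \sum_(0 <= j < n) cabs (lam j) <= M) ->
  (forall x, exists N, forall n, (N <= n)%N -> \sum_(0 <= j < n) lam j * a j x = g x) ->
  ctends (fun n => \sum_(0 <= j < n) lam j * ell (a j)) (ell g).
Proof.
move=> ellD ellZ K0 ellK ha hM hg.
have l0 j : 0 <= cabs (lam j) by exact: cabs_ge0.
pose G n : X -> C := fun x => g x - \sum_(0 <= j < n) lam j * a j x.
have tail_sum n m : \sum_(0 <= j < m) cabs (lam (n + j)%N) = \sum_(n <= j < n + m) cabs (lam j).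
  exact: (shift_sum (fun j => cabs (lam j))).
have decG n : atomic_decomposition mu Dy (G n) (fun j => lam (n + j)%N) (fun j => a (n + j)%N).
  apply: (H1_series (M := M) q_ge2 tree_e alpha_gt1) => // [m|].
    rewrite tail_sum; apply: le_trans (hM (n + m)%N).
    by rewrite (@big_cat_nat _ _ _ n 0 (n + m))//= ?leq_addr// lerDr sumr_ge0.
  exact: tail_eventually.
have carG n := H1_carrier q_ge2 tree_e alpha_gt1 (decG n).
have cara j : fcarrier (H1 mu Dy) (a j).
  pose l1 (i : nat) : C := (i == 0)%:R.
  have s1 (V : nat -> C) n : \sum_(0 <= i < n.+1) l1 i * V i = V 0%N.
    by rewrite big_nat_recl// big1 ?addr0 ?mul1r// => i _; rewrite mul0r.
  apply: (@H1_carrier _ _ _ _ _ _ q_ge2 tree_e alpha_gt1 l1 (fun=> a j)).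
  apply: (H1_series (M := 1) q_ge2 tree_e alpha_gt1) => // [[|n]|x].
  - by rewrite big_geq.
  - by rewrite big_nat_recl// big1 ?addr0 ?cabs1// => i _; rewrite cabs0.
  - by exists 1%N => -[//|n] _; exact: (s1 (fun=> a j x)).
have carZ j : fcarrier (H1 mu Dy) (fun x => lam j * a j x).
  apply: (@H1_carrier _ _ _ _ _ _ q_ge2 tree_e alpha_gt1 (fun i => (i == 0)%:R * lam j) (fun=> a j)).
  have z0 (V : nat -> C) n : \sum_(0 <= i < n) (i.+1 == 0)%:R * lam j * V i = 0.
    by rewrite big1// => i _; rewrite !mul0r.
  apply: (H1_series (M := cabs (lam j)) q_ge2 tree_e alpha_gt1) => // [[|n]|x].
  - by rewrite big_geq.
  - by rewrite big_nat_recl// big1 ?addr0 ?mul1r// => i _; rewrite mul0r cabs0.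
  - exists 1%N => -[//|n] _; rewrite big_nat_recl// mul1r (z0 (fun=> a j x)).
    by rewrite addr0.
have expand n : ell g = \sum_(0 <= j < n) lam j * ell (a j) + ell (G n).
  elim: n => [|n ih].
    by rewrite big_geq// add0r; congr ell; apply/funext => x; rewrite /G big_geq// subr0.
  rewrite ih big_nat_recr//= -addrA; congr (_ + _).
  rewrite -ellZ// -ellD//; congr ell; apply/funext => x /=.
  by rewrite /G big_nat_recr//=; ring.
move=> eps e0; have K1 : 0 < K + 1 by rewrite ltr_wpDl.
have e1 : 0 < eps / (K + 1) by rewrite divr_gt0.
have [N hN] := bounded_series_tail l0 hM e1.
exists N => n Nn; rewrite (expand n) opprD addNKr cabsN -lee_fin.
apply: le_trans (ellK _ (carG n)) _.
apply: (@le_trans _ _ (K%:E * (eps / (K + 1))%:E)%E).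
  apply: lee_wpmul2l; first by rewrite lee_fin.
  apply: (H1_norm_le (decG n)) => m; rewrite tail_sum hN// leq_addr//.
rewrite -EFinM lee_fin mulrA ler_pdivrMr// mulrC ler_wpM2l ?(ltW e0)//.
by rewrite lerDl.
Qed.

Lemma H1_atom_norm (a : X -> C) : atom mu Dy a ->
  fcarrier (H1 mu Dy) a /\ (H1_norm mu Dy a <= 1)%E.
Proof.
move=> ha; pose l1 (i : nat) : C := (i == 0)%:R.
have hM n : \sum_(0 <= j < n) cabs (l1 j) <= 1.
  case: n => [|n]; first by rewrite big_geq.
  by rewrite big_nat_recl// big1 ?addr0 ?cabs1// => i _; rewrite cabs0.
have dec : atomic_decomposition mu Dy a l1 (fun=> a).
  apply: (H1_series q_ge2 tree_e alpha_gt1 _ hM) => // x.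
  exists 1%N => -[//|n] _; rewrite big_nat_recl// big1 ?addr0 ?mul1r// => i _.
  by rewrite mul0r.
by split; [exact: H1_carrier dec|exact: (H1_norm_le dec)].
Qed.

End functionals_on_H1.

Section power_inequalities.
Context {R : realType}.
Implicit Types (u s p r : R).

Lemma powR_le_add1 u s p : 0 <= u -> 0 <= s -> s <= p -> u `^ s <= 1 + u `^ p.
Proof.
move=> u0 s0 sp; have [u1|/ltW u1] := leP u 1.
  have one : 1 `^ s = 1 :> R by rewrite powR1.
  rewrite (@le_trans _ _ 1)// ?lerDl ?powR_ge0// -[leRHS]one.
  by rewrite ge0_ler_powR ?nnegrE.
by rewrite (@le_trans _ _ (u `^ p)) ?lerDr// ler_powR.
Qed.

(** Each u i is at most m, the power 1 / r of the sum of the u i ^ r, so the sum of the u i is at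
    most [size t] times m. *)
Lemma powR_sum_le (I : eqType) (t : seq I) (u : I -> R) r : 0 < r ->
  (forall i, 0 <= u i) ->
  (\sum_(i <- t) u i) `^ r <= (size t)%:R `^ r * \sum_(i <- t) u i `^ r.
Proof.
move=> r0 u0; pose m := (\sum_(i <- t) u i `^ r) `^ r^-1.
have s0 : 0 <= \sum_(i <- t) u i `^ r by apply: sumr_ge0 => i _; exact: powR_ge0.
have m0 : 0 <= m by exact: powR_ge0.
have um i : i \in t -> u i <= m.
  move=> it; rewrite -[u i]powRr1// -(mulfV (lt0r_neq0 r0)) powRrM.
  rewrite ge0_ler_powR ?invr_ge0 ?(ltW r0) ?nnegrE ?powR_ge0//.
  rewrite (big_rem i it) /= lerDl; apply: sumr_ge0 => j _; exact: powR_ge0.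
have -> : \sum_(i <- t) u i `^ r = m `^ r.
  by rewrite /m -powRrM mulVf ?powRr1// gt_eqF.
rewrite -powRM// ge0_ler_powR ?nnegrE ?(ltW r0) ?mulr_ge0//; first exact: sumr_ge0.
apply: (@le_trans _ _ (\sum_(i <- t) m)); first by rewrite !big_seq ler_sum.
by rewrite big_const_seq count_predT iter_addr_0 mulr_natl.
Qed.

End power_inequalities.

(** * Upper bound for (H^1, L^p1): the analytic family *)

Section family_for_H1.
Context {R : realType} {X : pointedType}.
Variables (q : nat) (e : rel X) (o : X) (alpha : R).
Hypothesis q_ge2 : (2 <= q)%N.
Hypothesis tree_e : homogeneous_tree q e.
Hypothesis alpha_gt1 : 1 < alpha.
Local Notation C := R[i].
Implicit Types (x y v : X).

Local Notation w := (weight q e o alpha).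
Local Notation mu := (tree_measure q e o alpha).
Local Notation Dy := (dyadic e o).
Local Notation T := (sector e o).
Local Notation kids := (children o tree_e).
Local Notation wsum := (wsum q e o alpha).
Local Notation countX := (countable_vertices o tree_e).
Local Notation dec := (vertex_dec countX).
Local Notation K1 := (atom_const q alpha).
Local Notation at_ := (sector_atom q e o alpha).

Let w_gt0 x : 0 < w x.
Proof. exact: weight_gt0. Qed.

Let w_ge0 x : 0 <= w x.
Proof. exact: weight_ge0. Qed.

Variables (f : X -> C) (N H p p1 : R).
Hypothesis N_gt0 : 0 < N.
Hypothesis p_gt1 : 1 < p.
Hypothesis pp1 : p < p1.
Hypothesis f_summable : summable_on q e o alpha f.

Definition sector_sum v : C := cint mu (T v) f.

(** The further division by the norm bound N makes the means homogeneous of degree 0, so that the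
    bound H on their p-th powers can be chosen independently of f. *)
Definition sector_mean v : R := cabs (sector_sum v) / (w v * N).

Local Notation S := sector_sum.
Local Notation A := sector_mean.

Hypothesis mean_le : (wsum setT (fun v => A v `^ p)%R <= H%:E)%E.

Let wN_gt0 v : 0 < w v * N. Proof. exact: mulr_gt0. Qed.

Let A_ge0 v : 0 <= A v.
Proof. by rewrite divr_ge0 ?cabs_ge0// ltW. Qed.

Let S_A v : cabs (S v) = N * A v * w v.
Proof. by rewrite /A mulrAC [N * _]mulrC mulrAC mulrC; field; rewrite !gt_eqF. Qed.

Let p_gt0 : 0 < p. Proof. exact: lt_trans ltr01 p_gt1. Qed.
Let p1_gt0 : 0 < p1. Proof. exact: lt_trans p_gt0 pp1. Qed.

(** Together with [mean_rate] this makes [mean_term z v] equal to S_v A_v^(p - 1 + (p / p1 - p) z).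
    The exponent vanishes at theta; the modulus is N A^p w on Re z = 0 and N A^(p / p1) w on Re z =
    1. *)
Definition mean_coef v : C := if A v == 0 then 0 else S v * (A v `^ (p - 1))%:C%C.

Definition mean_rate v : R := (p / p1 - p) * ln (A v).

Local Notation c := mean_coef.
Local Notation beta := mean_rate.

Definition mean_term (z : C) v : C := c v * cexp ((beta v)%:C%C * z).

Local Notation Tz := mean_term.

Let cabs_c v : cabs (c v) = N * A v `^ p * w v.
Proof.
rewrite /mean_coef; case: eqP => [A0|/eqP A0].
  by rewrite cabs0 A0 powR0 ?gt_eqF// mulr0 mul0r.
rewrite cabsM cabs_real ger0_norm ?powR_ge0// S_A -(mulr_powRB1 (A_ge0 v) p_gt0).
ring.
Qed.

Let cabs_Tz z v : 0 < p + (p / p1 - p) * complex.Re z ->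
  cabs (Tz z v) = N * A v `^ (p + (p / p1 - p) * complex.Re z) * w v.
Proof.
move=> hz; rewrite cabsM cabs_c; have [A0|A0] := eqVneq (A v) 0.
  by rewrite A0 !powR0 ?gt_eqF// !(mulr0, mul0r).
have {}A0 : 0 < A v by rewrite lt_neqAle eq_sym A0 A_ge0.
by rewrite cexp_ln// powRD ?(gt_eqF A0) ?implybT//; ring.
Qed.

Let pp1_gt0 : 0 < p / p1. Proof. exact: divr_gt0. Qed.

Let pp1_le1 : p / p1 <= 1. Proof. by rewrite ler_pdivrMr// mul1r ltW. Qed.

Let cabs_Tz0 (t : R) v : cabs (Tz (Complex 0 t) v) = N * A v `^ p * w v.
Proof. by rewrite cabs_Tz /= mulr0 addr0. Qed.

Let cabs_Tz1 (t : R) v : cabs (Tz (Complex 1 t) v) = N * A v `^ (p / p1) * w v.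
Proof. by rewrite cabs_Tz /= mulr1 addrC subrK. Qed.

Let exp_beta v : cabs (c v) * expR (beta v) = N * A v `^ (p / p1) * w v.
Proof.
rewrite -(cabs_Tz1 0 v) cabsM cabs_cexp Re_realM /=; congr (_ * expR _).
by rewrite mulr1.
Qed.

Let V := vol mu [set: X].

Let N_ge0 : 0 <= N. Proof. exact: ltW. Qed.

Let total_le :
  (\esum_(v in [set: X]) (cabs (c v) * (1 + expR (beta v)))%:E <= (N * (2 * H + V))%:E)%E.
Proof.
apply: (@le_trans _ _ (wsum setT (fun v => N * (2 * A v `^ p + 1)))%R).
  apply: le_esum => v _; rewrite lee_fin mulrDr mulr1 exp_beta cabs_c.
  have -> : N * A v `^ p * w v + N * A v `^ (p / p1) * w v =
    N * (A v `^ p + A v `^ (p / p1)) * w v by ring.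
  rewrite ler_wpM2r// ler_wpM2l// mulr_natl mulr2n -addrA lerD2l [leRHS]addrC.
  apply: powR_le_add1 => //; first exact: ltW.
  by rewrite (le_trans pp1_le1)// ltW.
rewrite wsumZ//; last by move=> v; rewrite addr_ge0// mulr_ge0// powR_ge0.
rewrite EFinM lee_wpmul2l ?lee_fin// wsumD//; last by move=> v; rewrite mulr_ge0// powR_ge0.
rewrite EFinD wsumZ//; last by move=> v; exact: powR_ge0.
rewrite EFinM leeD ?lee_wpmul2l//.
by rewrite (wsum_cst o q_ge2 tree_e alpha_gt1)// mul1r.
Qed.

(** Pointwise value of the atomic series: v contributes at v and at its predecessor, so x collects
    its own term and those of its children. *)
Definition mean_family (z : C) x : C :=
  (w x)^-1%:C%C * (Tz z x - \sum_(k <- kids x) Tz z k).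

Lemma mean_family_theta (theta : R) : p^-1 = 1 - theta + theta / p1 ->
  mean_family theta%:C%C = f.
Proof.
move=> pE; have phi0 : p - 1 + (p / p1 - p) * theta = 0.
  have : p * p^-1 = 1 by rewrite mulfV ?gt_eqF.
  by rewrite pE => h; rewrite -[X in p - X]h; ring.
have TS v : Tz theta%:C%C v = S v.
  rewrite /mean_term /mean_coef; case: eqP => [A0|/eqP A0].
    by rewrite mul0r; apply/esym/cabs_eq0; rewrite S_A A0 mulr0 mul0r.
  have {}A0 : 0 < A v by rewrite lt_neqAle eq_sym A0 A_ge0.
  rewrite cexp_ln_real// -mulrA -rmorphM -powRD ?phi0 ?powRr0 ?mulr1//.
  by rewrite (gt_eqF A0) implybT.
apply/funext => x; rewrite /mean_family TS (eq_bigr S); last by move=> k _; exact: TS.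
rewrite /sector_sum cint_sector// addrK mulrA -rmorphM mulVf ?mul1r//.
by rewrite gt_eqF.
Qed.

(** Index 0 holds the constant atom with coefficient [c o]: it restores the mean that the atom at
    the origin has removed. An index that codes no vertex gets a constant atom with coefficient
    0. *)
Definition atom_seq (j : nat) : X -> C :=
  if j is k.+1 then oapp at_ (constant_atom q e o alpha) (dec k)
  else constant_atom q e o alpha.

Definition coef_seq (j : nat) : C :=
  if j is k.+1 then oapp (fun v => K1%:C%C * c v) 0 (dec k) else c o.

Definition rate_seq (j : nat) : R := if j is k.+1 then oapp beta 0 (dec k) else beta o.

Definition term_seq (z : C) (j : nat) : C := coef_seq j * cexp ((rate_seq j)%:C%C * z).

Let atom_seqP j : atom mu Dy (atom_seq j).
Proof.
case: j => [|j]; first exact: constant_atomP.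
rewrite /=; case: (dec j) => [v|] /=; last exact: constant_atomP.
exact: sector_atomP.
Qed.

(** The origin is counted twice, at index 0 and as a vertex, hence the factor 1 + K1. *)
Let seq_sum_le (t : X -> R) (M : R) (u : nat -> R) n : (forall x, 0 <= t x) ->
  (\esum_(x in [set: X]) (t x)%:E <= M%:E)%E -> u 0%N = t o ->
  (forall j, u j.+1 = oapp (fun v => K1 * t v) 0 (dec j)) ->
  \sum_(0 <= j < n) u j <= (1 + K1) * M.
Proof.
move=> t0 tM u0 uS; have K10 : 0 <= K1 by rewrite ltW// atom_const_gt0.
have tM' x : t x <= M.
  rewrite -lee_fin; apply: le_trans tM.
  by apply: (@esum_ge_point _ _ _ (fun x => (t x)%:E)) => // y; rewrite lee_fin.
have M0 : 0 <= M := le_trans (t0 o) (tM' o).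
case: n => [|n]; first by rewrite big_geq// mulr_ge0// addr_ge0.
rewrite big_nat_recl// u0 mulrDl mul1r lerD//.
rewrite (eq_bigr (fun j => oapp (fun v => K1 * t v) 0 (dec j))); last by move=> j _.
apply: vertex_sum_le => [x|]; first by rewrite mulr_ge0.
apply: (@le_trans _ _ (K1%:E * \esum_(x in [set: X]) (t x)%:E)%E).
  by rewrite -esumZ.
by rewrite [(K1 * M)%:E]EFinM lee_wpmul2l// lee_fin.
Qed.

Let K1_gt0 : 0 < K1. Proof. exact: atom_const_gt0. Qed.

Let term_seqS z j : term_seq z j.+1 = oapp (fun v => K1%:C%C * Tz z v) 0 (dec j).
Proof.
rewrite /term_seq /=; case: (dec j) => [v|] /=; last by rewrite mul0r.
by rewrite mulrA.
Qed.

Let coef_le n : \sum_(0 <= j < n) cabs (coef_seq j) * (1 + expR (rate_seq j)) <=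
  (1 + K1) * (N * (2 * H + V)).
Proof.
apply: (seq_sum_le _ _ total_le) => // [x|j].
  by rewrite mulr_ge0 ?cabs_ge0// addr_ge0// expR_ge0.
rewrite /=; case: (dec j) => [v|] /=; last by rewrite cabs0 mul0r.
by rewrite cabsM cabs_real gtr0_norm// mulrA.
Qed.

Let term_le z n : closed_strip z ->
  \sum_(0 <= j < n) cabs (term_seq z j) <= (1 + K1) * (N * (2 * H + V)).
Proof.
move=> sz; apply: le_trans (coef_le n); apply: ler_sum => j _.
by rewrite cabsM cabs_cexp Re_realM ler_wpM2l ?cabs_ge0// expR_strip.
Qed.

Let pred_fibre x n : (forall y, y \in x :: o :: kids x -> (vertex_code countX y < n)%N) ->
  forall g : X -> C,
  \sum_(v <- vertex_range countX 0 n | (v != o) && (pred_vertex e o v == x)) g v =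
  \sum_(k <- kids x) g k.
Proof.
move=> hn g; rewrite -big_filter; apply/perm_big/uniq_perm.
- exact/filter_uniq/vertex_range_uniq.
- exact: children_uniq.
move=> y; rewrite mem_filter vertex_rangeP /=; apply/idP/idP.
  by move=> /andP[/andP[/eqP yo /eqP py] _]; apply/childrenP.
move=> yx; have /childrenP[/eqP -> /eqP ->] := yx.
by rewrite /= hn// !inE yx !orbT.
Qed.

(** Once x, o and the children of x are enumerated, the later terms vanish at x, and the balance at
    the origin cancels against index 0. *)
Let term_seq_eventually z x : exists n0, forall n, (n0 <= n)%N ->
  \sum_(0 <= j < n) term_seq z j * atom_seq j x = mean_family z x.
Proof.
have [k hk] := vertex_code_bound countX (x :: o :: kids x).
exists k.+1 => -[//|n] kn; rewrite big_nat_recl//.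
have hn y : y \in x :: o :: kids x -> (vertex_code countX y < n)%N.
  by move=> /hk yk; rewrite (leq_trans yk).
rewrite (eq_bigr (fun j => oapp (fun v => Tz z v *
    ((x == v)%:R / w v - balance q e o alpha v x)%:C%C) 0 (dec j))); last first.
  move=> j _; rewrite term_seqS /=; case: (dec j) => [v|] /=; last by rewrite mul0r.
  rewrite /sector_atom [K1%:C%C * _]mulrC -mulrA -rmorphM; congr (_ * _%:C%C).
  by rewrite mulrC divfK// gt_eqF.
rewrite vertex_sumE.
rewrite (eq_bigr (fun v => Tz z v * ((x == v)%:R / w v)%:C%C -
    Tz z v * (balance q e o alpha v x)%:C%C)); last by move=> v _; rewrite rmorphB mulrBr.
rewrite sumrB.
have ux := vertex_range_uniq countX 0 n.
have xr : x \in vertex_range countX 0 n by rewrite vertex_rangeP hn// mem_head.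
have or_ : o \in vertex_range countX 0 n by rewrite vertex_rangeP hn// !inE eqxx orbT.
rewrite (bigD1_seq x xr ux) /= eqxx mul1r big1 ?addr0; last first.
  by move=> v /negbTE vx; rewrite eq_sym vx mul0r mulr0.
rewrite (bigD1_seq o or_ ux) /= /balance eqxx.
rewrite (eq_bigr (fun v => if pred_vertex e o v == x then (w x)^-1%:C%C * Tz z v else 0)).
  rewrite -big_mkcondr /= pred_fibre// -mulr_sumr /mean_family /term_seq /= /constant_atom.
  rewrite -/(mean_term z o) mulrBr opprD addrA.
  rewrite [Tz z x * _]mulrC; move: (Tz z o * _) (_ * Tz z x) (_ * \sum_(_ <- _) _) => a b d.
  ring.
move=> v /negbTE ->; rewrite eq_sym; case: eqP => [->|_]; last by rewrite mul0r mulr0.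
by rewrite mul1r mulrC.
Qed.

Lemma mean_family_atomic z : closed_strip z ->
  atomic_decomposition mu Dy (mean_family z) (term_seq z) atom_seq.
Proof.
move=> sz; apply: (H1_series q_ge2 tree_e alpha_gt1) => [|n|x].
- exact: atom_seqP.
- exact: term_le.
- exact: term_seq_eventually.
Qed.

Lemma mean_family_H1_norm (t : R) :
  (H1_norm mu Dy (mean_family (Complex 0%R t)) <= ((1 + K1) * (N * H))%:E)%E.
Proof.
apply: (H1_norm_le (mean_family_atomic _)); first by rewrite /closed_strip /= lexx ler01.
move=> n; apply: (seq_sum_le (t := fun v => cabs (Tz (Complex 0 t) v))) => // [x||j].
- exact: cabs_ge0.
- apply: (@le_trans _ _ (wsum setT (fun v => N * A v `^ p)%R)).
    by apply: le_esum => v _; rewrite lee_fin cabs_Tz0.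
  rewrite wsumZ//; last by move=> v; exact: powR_ge0.
  by rewrite EFinM lee_wpmul2l.
- rewrite term_seqS; case: (dec j) => [v|] /=; last exact: cabs0.
  by rewrite cabsM cabs_real gtr0_norm.
Qed.

(** [q.+2] bounds the number of terms in the value at x: x and at most q + 1 children. In 1 + 1 /
    decay, the power A_v^p w v is counted once at v and once at its predecessor, whose weight is
    larger by at most 1 / decay. *)
Definition mean_Lp_const : R :=
  q.+2%:R * ((1 + (decay q alpha)^-1) * H) `^ p1^-1.

Lemma mean_family_Lp_norm (t : R) :
  (Lp_norm mu p1%:E (mean_family (Complex 1%R t)) <= (mean_Lp_const * N)%:E)%E.
Proof.
have d0 := decay_gt0 q_ge2 alpha_gt1.
have dV0 : 0 <= (decay q alpha)^-1 by rewrite invr_ge0 ltW.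
have H0 : 0 <= H.
  rewrite -lee_fin; apply: le_trans mean_le; apply: wsum_ge0 => v; exact: powR_ge0.
have cH : 0 <= (1 + (decay q alpha)^-1) * H by rewrite mulr_ge0// addr_ge0.
have cN : 0 <= mean_Lp_const * N by rewrite mulr_ge0 ?mulr_ge0 ?powR_ge0.
apply/(Lp_norm_le o alpha tree_e _ p1_gt0 cN).
have -> : (mean_Lp_const * N) `^ p1 =
    (N * q.+2%:R) `^ p1 * ((1 + (decay q alpha)^-1) * H).
  have -> : mean_Lp_const * N =
      N * q.+2%:R * ((1 + (decay q alpha)^-1) * H) `^ p1^-1.
    by rewrite /mean_Lp_const mulrC mulrA.
  rewrite powRM ?powR_ge0//; last by rewrite mulr_ge0.
  by rewrite -powRrM mulVf ?powRr1// gt_eqF.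
pose h v := A v `^ p * w v.
have h0 v : 0 <= h v by rewrite mulr_ge0 ?powR_ge0.
have h0' v : (0 <= (h v)%:E)%E by rewrite lee_fin.
pose k x := h x + (decay q alpha)^-1 * \sum_(v <- kids x) h v.
have ks x : 0 <= \sum_(v <- kids x) h v by apply: sumr_ge0.
apply: (@le_trans _ _ (((N * q.+2%:R) `^ p1)%:E * \esum_(x in [set: X]) (k x)%:E)%E).
  rewrite -esumZ ?powR_ge0//; last by move=> x; rewrite lee_fin addr_ge0// mulr_ge0.
  apply: le_esum => x _; rewrite -EFinM lee_fin.
  have Fx : cabs (mean_family (Complex 1 t) x) <=
      N * \sum_(v <- x :: kids x) A v `^ (p / p1).
    rewrite /mean_family cabsM cabs_real ger0_norm ?invr_ge0// ler_pdivrMl//.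
    rewrite big_cons mulrDr mulrDr (le_trans (cabsB _ _))// lerD//.
      by rewrite cabs_Tz1 mulrC.
    rewrite (le_trans (cabs_sum _ _ _))// !mulr_sumr !big_seq; apply: ler_sum => v.
    move=> /childrenP[_ <-]; rewrite cabs_Tz1 mulrC ler_wpM2r ?mulr_ge0 ?powR_ge0//.
    exact: weight_le_pred.
  have S0 : 0 <= \sum_(v <- x :: kids x) A v `^ (p / p1).
    by apply: sumr_ge0 => v _; exact: powR_ge0.
  apply: (@le_trans _ _ ((N * \sum_(v <- x :: kids x) A v `^ (p / p1)) `^ p1 * w x)).
    rewrite ler_wpM2r// ge0_ler_powR ?nnegrE ?cabs_ge0 ?(ltW p1_gt0)//.
    exact: mulr_ge0.
  rewrite powRM// powRM// -!mulrA ler_wpM2l ?powR_ge0//.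
  have := @powR_sum_le R X (x :: kids x) (fun v => A v `^ (p / p1)) p1 p1_gt0.
  move=> /(_ (fun v => powR_ge0 _ _)).
  move=> /(ler_wpM2r (w_ge0 x)) /le_trans; apply.
  rewrite -mulrA; apply: ler_pM; rewrite ?powR_ge0 ?mulr_ge0 ?sumr_ge0//.
  - by move=> v _; exact: powR_ge0.
  - rewrite ge0_ler_powR ?nnegrE ?(ltW p1_gt0)// ler_nat /= ltnS.
    exact: size_children.
  have pw v : (A v `^ (p / p1)) `^ p1 = A v `^ p.
    by rewrite -powRrM divfK// gt_eqF.
  rewrite big_cons mulrDl pw.
  apply: lerD; first exact: lexx.
  rewrite mulr_sumr mulr_suml.
  rewrite big_seq [leRHS]big_seq.
  apply: ler_sum => v.
  move=> /childrenP[_ <-]; rewrite pw mulrCA ler_wpM2l ?powR_ge0//.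
  by rewrite -ler_pdivrMl ?invr_gt0// invrK weight_pred_le.
rewrite EFinM lee_wpmul2l ?lee_fin ?powR_ge0//.
rewrite (eq_esum (b := fun x => (h x)%:E + (decay q alpha)^-1%:E *
    (\sum_(v <- kids x) h v)%:E)%E); last by move=> x _; rewrite -EFinM -EFinD.
rewrite esumD//; last by move=> x _; rewrite mule_ge0// lee_fin.
rewrite esumZ// mulrDl mul1r EFinD leeD// EFinM lee_wpmul2l//.
(* The children of x form the first generation below x, and no vertex is a child twice. *)
apply: le_trans mean_le; apply: le_trans (esum_descendants_le e o 1 h0').
apply: le_esum => x _.
have -> : descendants e o x 1 = [set` kids x].
  by apply/seteqP; split=> y; rewrite (descendant_seqP o tree_e) /= cats0.
by rewrite esum_uniq_seq ?children_uniq// sumEFin.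
Qed.

Lemma Lp_zero (r : R) : 0 < r ->
  fcarrier (Lp mu r%:E) (fun=> 0) /\ fnorm (Lp mu r%:E) (fun=> 0) = 0%E.
Proof.
move=> r0; have E : Lp_norm mu r%:E (fun=> 0) = 0%E.
  apply/eqP; rewrite eq_le Lnorm_ge0 andbT.
  apply/(Lp_norm_le o alpha tree_e _ r0 (lexx 0)).
  by rewrite cabs0 !powR0 ?gt_eqF// (wsum_cst o q_ge2 tree_e alpha_gt1)// mul0r.
by split=> //; rewrite /= E ltry.
Qed.

Lemma mean_family_interp :
  interp_family (H1 mu Dy) (Lp mu p1%:E) mean_family /\
  (Fnorm (H1 mu Dy) (Lp mu p1%:E) mean_family <=
   (((1 + K1) * H + mean_Lp_const) * N)%:E)%E.
Proof.
have H0 : 0 <= H.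
  rewrite -lee_fin; apply: le_trans mean_le; apply: wsum_ge0 => v; exact: powR_ge0.
have c0 : 0 <= mean_Lp_const.
  rewrite mulr_ge0 ?powR_ge0//.
have KH0 : 0 <= (1 + K1) * H by rewrite mulr_ge0// addr_ge0// ltW.
have [z1 n1] := Lp_zero p1_gt0.
have nH f' : (0 <= fnorm (H1 mu Dy) f')%E by exact: H1_norm_ge0.
have nL f' : (0 <= fnorm (Lp mu p1%:E) f')%E by exact: Lnorm_ge0.
have carH z : closed_strip z -> fcarrier (H1 mu Dy) (mean_family z).
  by move=> sz; exact: (H1_carrier q_ge2 tree_e alpha_gt1 (mean_family_atomic sz)).
apply: (@exp_family _ _ _ _ _ _ coef_seq rate_seq atom_seq).
- by move=> z /carH; exact: sum_carrier_left.
- move=> ell hell; have [D Z _] := hell.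
  have [M M0 hM] := functional_left nH nL z1 n1 hell.
  have sumL f' : fcarrier (H1 mu Dy) f' ->
      fcarrier (sum_space (H1 mu Dy) (Lp mu p1%:E)) f' by exact: sum_carrier_left.
  split.
    exists (M * ((1 + K1) * (N * (2 * H + V)))) => n.
    apply: (@le_trans _ _ (\sum_(0 <= j < n)
        M * (cabs (coef_seq j) * (1 + expR (rate_seq j))))); last first.
      by rewrite -mulr_sumr ler_wpM2l.
    apply: ler_sum => j _; rewrite cabsM mulrA ler_wpM2r ?addr_ge0 ?expR_ge0//.
    rewrite mulrC ler_wpM2r ?cabs_ge0//.
    have [ca na] := H1_atom_norm q_ge2 tree_e alpha_gt1 (atom_seqP j).
    rewrite -lee_fin; apply: le_trans (hM _ ca) _.
    by rewrite -[leRHS]mule1 lee_wpmul2l.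
  move=> z sz.
  have := H1_functional_series (ell := ell) (K := M) q_ge2 tree_e alpha_gt1 _ _ M0 hM
    atom_seqP (fun n => term_le n sz) (term_seq_eventually z).
  have -> : (fun n => \sum_(0 <= j < n) coef_seq j * ell (atom_seq j) *
      cexp ((rate_seq j)%:C%C * z)) =
    (fun n => \sum_(0 <= j < n) term_seq z j * ell (atom_seq j)).
    by apply/funext => n; apply: eq_bigr => j _; rewrite /term_seq mulrAC.
  apply.
    by move=> f1 f2 h1 h2; apply: D; exact: sumL.
  by move=> a f1 h1; apply: Z; exact: sumL.
- move=> t; split; first by apply: carH; rewrite /closed_strip /= lexx ler01.
  by rewrite /= (le_lt_trans (mean_family_Lp_norm t)) ?ltry.
- move=> t; split.
    apply: le_trans (mean_family_H1_norm t) _; rewrite lee_fin.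
    by rewrite [N * H]mulrC mulrA ler_wpM2r ?lerDl.
  by apply: le_trans (mean_family_Lp_norm t) _; rewrite lee_fin ler_wpM2r ?lerDr.
Qed.

End family_for_H1.

(** * Upper bound for (H^1, L^p1): the constant from Hardy's inequality *)

Section upper_bound_H1.
Context {R : realType} {X : pointedType}.
Variables (q : nat) (e : rel X) (o : X) (alpha : R).
Hypothesis q_ge2 : (2 <= q)%N.
Hypothesis tree_e : homogeneous_tree q e.
Hypothesis alpha_gt1 : 1 < alpha.
Local Notation C := R[i].

Local Notation w := (weight q e o alpha).
Local Notation mu := (tree_measure q e o alpha).
Local Notation Dy := (dyadic e o).
Local Notation T := (sector e o).
Local Notation wsum := (wsum q e o alpha).

(** The measure is finite and t <= 1 + t^p. *)
Lemma Lp_summable (p N : R) (f : X -> C) : 1 <= p -> 0 <= N ->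
  (Lp_norm mu p%:E f <= N%:E)%E -> summable_on q e o alpha f.
Proof.
move=> p1 N0; have p0 : 0 < p by rewrite (lt_le_trans ltr01).
move=> /(Lp_norm_le o alpha tree_e f p0 N0) h.
have pw0 x : 0 <= cabs (f x) `^ p by exact: powR_ge0.
apply: (@le_lt_trans _ _ (wsum setT (fun x => 1 + cabs (f x) `^ p)%R)).
  apply: le_wsum => x _; rewrite -[leLHS]powRr1 ?cabs_ge0//.
  by apply: powR_le_add1; rewrite ?cabs_ge0.
rewrite wsumD// (wsum_cst o q_ge2 tree_e alpha_gt1)//.
by rewrite lte_add_pinfty ?ltry// (le_lt_trans h)// ltry.
Qed.

(** Hardy's inequality for g = 2 |f| / N, where the 2 is that of [cabs_cint_le]. The point is that H
    is chosen before f and N. *)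
Lemma sector_mean_le (p : R) : 1 < p -> exists2 H : R, 0 < H & forall f (N : R), 0 < N ->
  (Lp_norm mu p%:E f <= N%:E)%E ->
  (wsum setT (fun v => sector_mean q e o alpha f N v `^ p)%R <= H%:E)%E.
Proof.
move=> p1; have p0 : 0 < p by rewrite (lt_trans ltr01).
have [K K0 hK] := hardy o q_ge2 tree_e alpha_gt1 p1.
exists (K * 2 `^ p) => [|f N N0 hf]; first by rewrite mulr_gt0// powR_gt0.
have sf := Lp_summable (ltW p1) (ltW N0) hf.
have w0 v : 0 < w v by exact: weight_gt0.
pose g x := 2 / N * cabs (f x).
have g0 x : 0 <= g x by rewrite mulr_ge0 ?cabs_ge0// divr_ge0// ltW.
have A0 v : 0 <= sector_mean q e o alpha f N v.
  by rewrite divr_ge0 ?cabs_ge0// ltW// mulr_gt0.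
apply: le_trans (hK g (sector_mean q e o alpha f N) g0 A0 _) _.
  move=> v; rewrite -/(wsum (T v) g) /g wsumZ; last 2 first.
  - by move=> x; exact: cabs_ge0.
  - by rewrite divr_ge0// ltW.
  have -> : sector_mean q e o alpha f N v * w v = N^-1 * cabs (sector_sum q e o alpha f v).
    rewrite /sector_mean; move: (w0 v); move: (w v) (cabs _) => a b a0.
    by field; rewrite !gt_eqF.
  rewrite EFinM [(2 / N)%R]mulrC EFinM -muleA lee_wpmul2l ?lee_fin ?invr_ge0 ?(ltW N0)//.
  exact: cabs_cint_le.
rewrite EFinM lee_wpmul2l ?lee_fin ?(ltW K0)//.
rewrite -/(wsum setT (fun y => (g y `^ p)%R)).
have -> : (fun y => (g y `^ p)%R) = (fun y => (2 / N) `^ p * cabs (f y) `^ p).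
  by apply/funext => y; rewrite /g powRM ?cabs_ge0// divr_ge0// ltW.
rewrite wsumZ ?powR_ge0//; last by move=> y; exact: powR_ge0.
have /(Lp_norm_le o alpha tree_e f p0 (ltW N0)) h := hf.
apply: le_trans (lee_wpmul2l _ h) _; first by rewrite lee_fin powR_ge0.
by rewrite -EFinM lee_fin -powRM ?divrK ?divr_ge0 ?(ltW N0)// unitfE gt_eqF.
Qed.

Lemma Lp_H1_interp (theta p p1 : R) :
  0 < theta -> theta < 1 -> 1 < p -> p < p1 -> p^-1 = 1 - theta + theta / p1 ->
  exists2 K : R, 0 < K & forall f (N : R), 0 < N -> (Lp_norm mu p%:E f <= N%:E)%E ->
  exists F, [/\ interp_family (H1 mu Dy) (Lp mu p1%:E) F, F theta%:C%C = f &
    (Fnorm (H1 mu Dy) (Lp mu p1%:E) F <= (K * N)%:E)%E].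
Proof.
move=> t0 t1 p_gt1 pp1 pE; have [H H0 hH] := sector_mean_le p_gt1.
exists ((1 + atom_const q alpha) * H + mean_Lp_const q alpha H p1).
  rewrite ltr_wpDr ?mulr_ge0 ?powR_ge0// mulr_gt0// addr_gt0//.
  exact: atom_const_gt0.
move=> f N N0 hf; have sf := Lp_summable (ltW p_gt1) (ltW N0) hf.
have [fam nF] := mean_family_interp q_ge2 tree_e alpha_gt1 N0 p_gt1 pp1 (hH f N N0 hf).
exists (mean_family o alpha tree_e f N p p1); split=> //.
exact: mean_family_theta.
Qed.

End upper_bound_H1.

(** * Interpolation between L^p and BMO *)

Section BMO_estimates.
Context {R : realType} {X : pointedType}.
Variables (q : nat) (e : rel X) (o : X) (alpha : R).
Hypothesis q_ge2 : (2 <= q)%N.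
Hypothesis tree_e : homogeneous_tree q e.
Hypothesis alpha_gt1 : 1 < alpha.
Local Notation C := R[i].
Implicit Types (x y v : X) (f : X -> C) (D : set X).

Local Notation pr := (pred_vertex e o).
Local Notation w := (weight q e o alpha).
Local Notation mu := (tree_measure q e o alpha).
Local Notation Dy := (dyadic e o).
Local Notation T := (sector e o).
Local Notation wsum := (wsum q e o alpha).
Local Notation V := (vol mu [set: X]).

Let w_gt0 x : 0 < w x.
Proof. exact: weight_gt0. Qed.

Let w_ge0 x : 0 <= w x.
Proof. exact: weight_ge0. Qed.

Let V_gt0 : 0 < V.
Proof. exact: volT_gt0. Qed.

Lemma BMO_norm_ge0 f : (0 <= BMO_norm mu Dy f)%E.
Proof.
apply: adde_ge0; last by rewrite lee_fin cabs_ge0.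
apply: (@le_trans _ _ ((vol mu (T o))^-1%:E *
   \int[mu]_(x in (T o : set (discrete X))) (cabs (f x - avg mu (T o) f))%:E)%E); last first.
  by apply: ereal_sup_ubound; exists (T o) => //; exists o; right.
apply: mule_ge0; last by apply: integral_ge0 => x _; rewrite lee_fin cabs_ge0.
by rewrite lee_fin invr_ge0 (vol_ge0 o q_ge2 tree_e alpha_gt1).
Qed.

Section bounds.
Variables (f : X -> C) (B : R).
Hypothesis f_le : (BMO_norm mu Dy f <= B%:E)%E.

Let B_ge0 : 0 <= B.
Proof. by rewrite -lee_fin; apply: le_trans f_le; exact: BMO_norm_ge0. Qed.

Lemma BMO_mean : cabs (cint mu setT f) <= B.
Proof.
rewrite -lee_fin; apply: le_trans f_le; rewrite /BMO_norm leeDr//.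
apply: (@le_trans _ _ ((vol mu (T o))^-1%:E *
   \int[mu]_(x in (T o : set (discrete X))) (cabs (f x - avg mu (T o) f))%:E)%E); last first.
  by apply: ereal_sup_ubound; exists (T o) => //; exists o; right.
apply: mule_ge0; last by apply: integral_ge0 => x _; rewrite lee_fin cabs_ge0.
by rewrite lee_fin invr_ge0 (vol_ge0 o q_ge2 tree_e alpha_gt1).
Qed.

(** The vertex x alone contributes |f x - f_D| w x to the oscillation over D. *)
Lemma BMO_oscillation D x : Dy D -> D x ->
  cabs (f x - avg mu D f) <= vol mu D / w x * B.
Proof.
move=> hD Dx; have vD : 0 < vol mu D by exact: (vol_gt0 o q_ge2 tree_e alpha_gt1 Dx).
have h : ((vol mu D)^-1%:E * wsum D (fun x => cabs (f x - avg mu D f))%R <= B%:E)%E.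
  apply: le_trans f_le; rewrite /BMO_norm.
  rewrite -(integral_wsum o alpha tree_e); last by move=> y; exact: cabs_ge0.
  apply: (@le_trans _ _ (ereal_sup [set ((vol mu D)^-1%:E *
      \int[mu]_(x in (D : set (discrete X))) (cabs (f x - avg mu D f)%R)%:E)%E | D in Dy])).
    by apply: ereal_sup_ubound; exists D.
  by rewrite leeDl// lee_fin cabs_ge0.
rewrite lee_pdivrMl// in h.
have c0 y : 0 <= cabs (f y - avg mu D f) by exact: cabs_ge0.
have := le_trans (wsum_ge_point q e o alpha c0 Dx) h.
by rewrite -EFinM lee_fin mulrAC -ler_pdivlMr.
Qed.

Lemma BMO_point x : cabs (f x) <= (V / w x + V^-1) * B.
Proof.
have DX : Dy setT by exists o; right; rewrite (sector_origin o tree_e).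
rewrite -[f x](subrK (avg mu setT f)) (le_trans (cabsD _ _))// mulrDl lerD//.
  exact: BMO_oscillation.
rewrite /avg cabsM cabs_real ger0_norm ?invr_ge0 ?(ltW V_gt0)//.
by rewrite ler_wpM2l ?invr_ge0 ?(ltW V_gt0)// BMO_mean.
Qed.

(** The first two summands compare f at v and at its predecessor with the average over T_(p v); the
    last one bounds f at the origin, whose weight is 1. *)
Definition BMO_diff_const : R :=
  sector_const q alpha / decay q alpha + sector_const q alpha + (V + V^-1).

Let d_gt0 : 0 < decay q alpha. Proof. exact: decay_gt0. Qed.
Let sc_gt0 : 0 < sector_const q alpha. Proof. exact: sector_const_gt0. Qed.

Lemma BMO_diff_const_ge0 : 0 <= BMO_diff_const.
Proof.
have := ltW V_gt0; have := ltW d_gt0; have := ltW sc_gt0 => s0 d0 v0.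
by apply: addr_ge0; apply: addr_ge0; rewrite ?invr_ge0//; exact: divr_ge0.
Qed.

(** At the origin 0 stands for the missing predecessor, so that the differences along a geodesic add
    up to f itself; there the bound also uses the mean part of the norm. *)
Lemma BMO_diff v :
  cabs (f v - (if v == o then 0 else f (pr v))) <= BMO_diff_const * B.
Proof.
case: eqP => [->|vo].
  rewrite subr0 (le_trans (BMO_point o))// ler_wpM2r//.
  rewrite (weight_origin o alpha tree_e) divr1 /BMO_diff_const lerDr.
  by apply: addr_ge0; [apply: divr_ge0|]; exact: ltW.
have Dp : Dy (T (pr v)) by exists (pr v); right.
have vle := vol_sector_le o q_ge2 tree_e alpha_gt1 (pr v).
rewrite (le_trans (cabs_trans (avg mu (T (pr v)) f) _ _))//.
rewrite /BMO_diff_const mulrDl ler_wpDr ?mulr_ge0 ?addr_ge0 ?invr_ge0 ?(ltW V_gt0)//.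
rewrite mulrDl lerD//.
  apply: le_trans (BMO_oscillation Dp (sector_pred _ _ _)) _; rewrite ler_wpM2r//.
  rewrite ler_pdivrMr// (le_trans vle)// -[leRHS]mulrA ler_wpM2l ?(ltW sc_gt0)//.
  by rewrite ler_pdivlMl// weight_pred_le.
rewrite cabsC; apply: le_trans (BMO_oscillation Dp (sector_refl _ _ _)) _.
by rewrite ler_wpM2r// ler_pdivrMr.
Qed.

End bounds.

Lemma BMO_eval_bounded x : eval_bounded (BMO mu Dy) x.
Proof.
exists (V / w x + V^-1) => f [_ foo].
have E : BMO_norm mu Dy f = (fine (BMO_norm mu Dy f))%:E.
  by rewrite fineK// ge0_fin_numE// BMO_norm_ge0.
by rewrite /= E -EFinM lee_fin; apply: BMO_point; rewrite -E.
Qed.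

Lemma bounded_summable f (N : R) : (forall x, cabs (f x) <= N) ->
  summable_on q e o alpha f.
Proof.
move=> fN; have N0 : 0 <= N by rewrite (le_trans (cabs_ge0 (f o))).
apply: (@le_lt_trans _ _ (wsum setT (fun=> N))); first by apply: le_wsum => x _.
by rewrite (wsum_cst o q_ge2 tree_e alpha_gt1)// ltry.
Qed.

(** The constant is 1 + 2 for f and its average over D, plus 2 V for the integral over X; both
    factors 2 come from [cabs_cint_le]. *)
Lemma bounded_BMO f (N : R) : (forall x, cabs (f x) <= N) ->
  fcarrier (BMO mu Dy) f /\ (BMO_norm mu Dy f <= ((3 + 2 * V) * N)%:E)%E.
Proof.
move=> fN; have N0 : 0 <= N by rewrite (le_trans (cabs_ge0 (f o))).
have sf := bounded_summable fN.
have cint_le D : cabs (cint mu D f) <= 2 * (N * vol mu D).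
  rewrite -lee_fin; apply: le_trans (cabs_cint_le tree_e D sf) _.
  rewrite EFinM lee_wpmul2l// -(wsum_cst o q_ge2 tree_e alpha_gt1)//.
  by apply: le_wsum => x _.
have le : (BMO_norm mu Dy f <= ((3 + 2 * V) * N)%:E)%E.
  have -> : (3 + 2 * V) * N = 3 * N + 2 * (N * V) by ring.
  rewrite EFinD; apply: leeD; last by rewrite lee_fin cint_le.
  apply: ub_ereal_sup => _ [D hD <-].
  have [y yD] := dyadic_nonempty hD.
  have vD : 0 < vol mu D by exact: (vol_gt0 o q_ge2 tree_e alpha_gt1 yD).
  rewrite (integral_wsum o alpha tree_e); last by move=> x; exact: cabs_ge0.
  rewrite lee_pdivrMl//; apply: (@le_trans _ _ (wsum D (fun=> 3 * N))).
    apply: le_wsum => x _; rewrite (le_trans (cabsB _ _))//.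
    have -> : 3 * N = N + 2 * N by ring.
    rewrite lerD// /avg cabsM cabs_real ger0_norm ?invr_ge0 ?(ltW vD)//.
    by rewrite ler_pdivrMl// (le_trans (cint_le D))// mulrA mulrC.
  by rewrite (wsum_cst o q_ge2 tree_e alpha_gt1) ?mulr_ge0// -EFinM lee_fin mulrC.
split=> //; split; last by rewrite (le_lt_trans le)// ltry.
by rewrite /= (Lp_norm1 o alpha tree_e).
Qed.

Lemma BMO_zero : fcarrier (BMO mu Dy) (fun=> 0) /\ BMO_norm mu Dy (fun=> 0%R) = 0%E.
Proof.
have [c n] : fcarrier (BMO mu Dy) (fun=> 0) /\
    (BMO_norm mu Dy (fun=> 0%R) <= ((3 + 2 * V) * 0)%:E)%E.
  by apply: bounded_BMO => x; rewrite cabs0.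
by split=> //; apply/eqP; rewrite eq_le BMO_norm_ge0 andbT; move: n; rewrite mulr0.
Qed.

Lemma bounded_Lp (r N : R) f : 0 < r -> (forall x, cabs (f x) <= N) ->
  fcarrier (Lp mu r%:E) f.
Proof.
move=> r0 fN; have N0 : 0 <= N by rewrite (le_trans (cabs_ge0 (f o))).
have c0 : 0 <= N * V `^ r^-1 by rewrite mulr_ge0// powR_ge0.
apply: (@le_lt_trans _ _ (N * V `^ r^-1)%:E); last exact: ltry.
apply/(Lp_norm_le o alpha tree_e f r0 c0).
rewrite powRM ?powR_ge0// -powRrM mulVf ?gt_eqF// powRr1 ?(ltW V_gt0)//.
rewrite -(wsum_cst o q_ge2 tree_e alpha_gt1) ?powR_ge0//.
by apply: le_wsum => x _; rewrite ge0_ler_powR ?nnegrE ?cabs_ge0// ltW.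
Qed.

End BMO_estimates.

(** * Finitely supported functions *)

Section finite_supports.
Context {X : pointedType} {R : realType}.
Local Notation C := R[i].
Implicit Types (x y : X) (s : seq X) (a : X -> C).

Definition restrict s a : X -> C := fun y => if y \in s then a y else 0.

Definition point x : X -> C := fun y => (y == x)%:R.

Lemma restrict_cons x s a : x \notin s ->
  restrict (x :: s) a = (fun y => a x * point x y) \+ restrict s a.
Proof.
move=> xs; apply/funext => y /=; rewrite /restrict /point inE.
by have [->|_] /= := eqVneq y x; rewrite ?(negbTE xs) ?mulr1 ?addr0// mulr0 add0r.
Qed.

Lemma restrict_bounded s a : exists B : R, forall y, cabs (restrict s a y) <= B.
Proof.
exists (\sum_(x <- s) cabs (a x)) => y; rewrite /restrict; case: ifPn => [ys|_].
  by rewrite (big_rem y ys) /= lerDl sumr_ge0// => x _; exact: cabs_ge0.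
by rewrite cabs0 sumr_ge0// => x _; exact: cabs_ge0.
Qed.

End finite_supports.

(** * Upper bound for (L^p1, BMO): the analytic family *)

Section family_for_BMO.
Context {R : realType} {X : pointedType}.
Variables (q : nat) (e : rel X) (o : X) (alpha : R).
Hypothesis q_ge2 : (2 <= q)%N.
Hypothesis tree_e : homogeneous_tree q e.
Hypothesis alpha_gt1 : 1 < alpha.
Local Notation C := R[i].
Implicit Types (x y v : X) (s : seq X).

Local Notation w := (weight q e o alpha).
Local Notation mu := (tree_measure q e o alpha).
Local Notation Dy := (dyadic e o).
Local Notation wsum := (wsum q e o alpha).
Local Notation countX := (countable_vertices o tree_e).
Local Notation dec := (vertex_dec countX).
Local Notation V := (vol mu [set: X]).

Variables (f : X -> C) (N p p1 : R).
Hypothesis N_gt0 : 0 < N.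
Hypothesis p1_gt1 : 1 < p1.
Hypothesis p1p : p1 < p.
Hypothesis f_le : (Lp_norm mu p%:E f <= N%:E)%E.

Let w_ge0 x : 0 <= w x. Proof. exact: weight_ge0. Qed.
Let p1_gt0 : 0 < p1. Proof. exact: lt_trans ltr01 p1_gt1. Qed.
Let p_gt0 : 0 < p. Proof. exact: lt_trans p1_gt0 p1p. Qed.
Let N_ge0 : 0 <= N. Proof. exact: ltW. Qed.
Let kap_gt0 : 0 < p / p1. Proof. exact: divr_gt0. Qed.
Let V_gt0 : 0 < V. Proof. exact: volT_gt0. Qed.

Definition rel_size x : R := cabs (f x) / N.

Local Notation r := rel_size.

Let r_ge0 x : 0 <= r x. Proof. by rewrite divr_ge0// cabs_ge0. Qed.

Let fr x : cabs (f x) = N * r x.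
Proof. by rewrite /rel_size mulrC divfK// gt_eqF. Qed.

Let r_le : (wsum setT (fun x => r x `^ p)%R <= 1)%E.
Proof.
have -> : (fun x => r x `^ p) = (fun x => N `^ (- p) * cabs (f x) `^ p).
  by apply/funext => x; rewrite /rel_size powRM ?cabs_ge0 ?invr_ge0// powRV// mulrC.
rewrite wsumZ ?powR_ge0//; last by move=> x; exact: powR_ge0.
have /(Lp_norm_le o alpha tree_e f p_gt0 N_ge0) h := f_le.
apply: le_trans (lee_wpmul2l _ h) _; first by rewrite lee_fin powR_ge0.
by rewrite -EFinM lee_fin -powRD ?addNr ?powRr0// (gt_eqF N_gt0) implybT.
Qed.

(** The family is set to 0 where f vanishes. Elsewhere its modulus is N r^(p (1 - Re z) / p1): of
    p1-th power N^p1 r^p on Re z = 0, and equal to N on Re z = 1. *)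
Definition power_coef x : C :=
  if r x == 0 then 0 else f x * (r x `^ (p / p1 - 1))%:C%C.

Definition power_rate x : R := - (p / p1) * ln (r x).

Definition power_family (z : C) x : C := power_coef x * cexp ((power_rate x)%:C%C * z).

Local Notation F := power_family.

Let cabs_coef x : cabs (power_coef x) = N * r x `^ (p / p1).
Proof.
rewrite /power_coef; case: eqP => [r0|/eqP r0].
  by rewrite cabs0 r0 powR0 ?mulr0// gt_eqF.
by rewrite cabsM cabs_real ger0_norm ?powR_ge0// fr -mulrA mulr_powRB1.
Qed.

(** Only an inequality: on Re z = 1 a vertex with r x = 0 gives 0 on the left but 0^0 = 1 on the
    right. *)
Let cabs_F z x : complex.Re z <= 1 ->
  cabs (F z x) <= N * r x `^ (p / p1 * (1 - complex.Re z)).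
Proof.
move=> z1; rewrite cabsM cabs_coef; have [r0|r0] := eqVneq (r x) 0.
  by rewrite r0 powR0 ?gt_eqF// mulr0 mul0r mulr_ge0// powR_ge0.
have {}r0 : 0 < r x by rewrite lt_neqAle eq_sym r0 r_ge0.
rewrite cexp_ln// -mulrA -powRD; last by rewrite (gt_eqF r0) implybT.
by rewrite mulrBr mulr1 mulNr.
Qed.

Let cabs_F0 (t : R) x : cabs (F (Complex 0 t) x) <= N * r x `^ (p / p1).
Proof. by rewrite (le_trans (cabs_F _ _)) /= ?subr0 ?mulr1 ?ler01. Qed.

Let cabs_F1 (t : R) x : cabs (F (Complex 1 t) x) <= N.
Proof.
by rewrite (le_trans (cabs_F _ _)) /= ?lexx// subrr mulr0 powRr0 mulr1.
Qed.

Lemma power_family_theta (theta : R) : p^-1 = (1 - theta) / p1 -> F theta%:C%C = f.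
Proof.
move=> pE; have phi0 : p / p1 - 1 + - (p / p1) * theta = 0.
  have : p * p^-1 = 1 by rewrite mulfV ?gt_eqF.
  by rewrite pE => h; rewrite -[X in _ - X + _]h; ring.
apply/funext => x; rewrite /power_family /power_coef; case: eqP => [r0|/eqP r0].
  by rewrite mul0r; apply/esym/cabs_eq0; rewrite fr r0 mulr0.
have {}r0 : 0 < r x by rewrite lt_neqAle eq_sym r0 r_ge0.
rewrite cexp_ln_real// -mulrA -rmorphM -powRD ?phi0 ?powRr0 ?mulr1//.
by rewrite (gt_eqF r0) implybT.
Qed.

(** Bound of the L^p1 norm on the whole closed strip, from r^(p (1 - Re z)) <= 1 + r^p. It serves
    convergence; on Re z = 0 the bound N is proved separately. *)
Definition family_bound : R := N * (1 + V) `^ p1^-1.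

Let bound_ge0 : 0 <= family_bound.
Proof. by rewrite mulr_ge0// powR_ge0. Qed.

Let F_pow_le z x : closed_strip z ->
  cabs (F z x) `^ p1 <= N `^ p1 * (1 + r x `^ p).
Proof.
move=> /andP[z0 z1].
apply: (@le_trans _ _ ((N * r x `^ (p / p1 * (1 - complex.Re z))) `^ p1)).
  by rewrite ge0_ler_powR ?nnegrE ?cabs_ge0 ?(ltW p1_gt0) ?mulr_ge0 ?powR_ge0// cabs_F.
rewrite powRM ?powR_ge0// ler_wpM2l ?powR_ge0// -powRrM.
have -> : p / p1 * (1 - complex.Re z) * p1 = p * (1 - complex.Re z).
  by field; rewrite gt_eqF.
apply: powR_le_add1 => //; first by rewrite mulr_ge0 ?subr_ge0// ltW.
by rewrite ler_piMr ?(ltW p_gt0)// gerBl.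
Qed.

Let F_pow_sum z : closed_strip z ->
  (wsum setT (fun x => cabs (F z x) `^ p1)%R <= (family_bound `^ p1)%:E)%E.
Proof.
move=> sz; apply: (@le_trans _ _ (wsum setT (fun x => N `^ p1 * (1 + r x `^ p))%R)).
  by apply: le_wsum => x _; exact: F_pow_le.
rewrite wsumZ ?powR_ge0//; last by move=> x; rewrite addr_ge0// powR_ge0.
rewrite wsumD//; last by move=> x; exact: powR_ge0.
rewrite (wsum_cst o q_ge2 tree_e alpha_gt1)// mul1r.
rewrite /family_bound powRM ?powR_ge0// -powRrM mulVf ?gt_eqF// powRr1; last first.
  by rewrite addr_ge0// ltW.
rewrite EFinM lee_wpmul2l ?lee_fin ?powR_ge0// EFinD [leRHS]addeC.
exact: leeD.
Qed.

Let F_Lp z : closed_strip z -> (Lp_norm mu p1%:E (F z) <= family_bound%:E)%E.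
Proof. by move=> sz; apply/(Lp_norm_le o alpha tree_e _ p1_gt0 bound_ge0); exact: F_pow_sum. Qed.

Let F_car z : closed_strip z -> fcarrier (Lp mu p1%:E) (F z).
Proof. by move=> /F_Lp h; rewrite /= (le_lt_trans h)// ltry. Qed.

Let S0 : closed_strip (0 : C). Proof. by rewrite /closed_strip /= lexx ler01. Qed.
Let S1 : closed_strip (1 : C). Proof. by rewrite /closed_strip /= lexx ler01. Qed.

Section functional.
Variables (ell : (X -> C) -> C) (M : R).
Local Notation A := (Lp mu p1%:E).
Hypothesis ellD : forall g h, fcarrier A g -> fcarrier A h -> ell (g \+ h) = ell g + ell h.
Hypothesis ellZ : forall a g, fcarrier A g -> ell (fun x => a * g x) = a * ell g.
Hypothesis M_ge0 : 0 <= M.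
Hypothesis ell_le : forall g, fcarrier A g -> ((cabs (ell g))%:E <= M%:E * fnorm A g)%E.

Let car_restrict s a : fcarrier A (restrict s a).
Proof. by have [B hB] := restrict_bounded s a; exact: bounded_Lp hB. Qed.

Let car_point x : fcarrier A (point x).
Proof.
apply: (bounded_Lp o (N := 1) q_ge2 tree_e alpha_gt1 p1_gt0) => y; rewrite /point.
by case: eqP => _; rewrite ?cabs1 ?cabs0.
Qed.

Let car_scale x (a : C) : fcarrier A (fun y => a * point x y).
Proof.
apply: (bounded_Lp o (N := cabs a) q_ge2 tree_e alpha_gt1 p1_gt0) => y; rewrite /point.
by case: eqP => _; rewrite ?mulr1 ?mulr0 ?cabs0// cabs_ge0.
Qed.

Let ell_norm g (B : R) : 0 <= B -> (Lp_norm mu p1%:E g <= B%:E)%E -> cabs (ell g) <= M * B.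
Proof.
move=> B0 gB; rewrite -lee_fin; apply: le_trans (ell_le _) _.
  by rewrite /= (le_lt_trans gB)// ltry.
by rewrite EFinM lee_wpmul2l// lee_fin.
Qed.

Lemma ell_restrict s a : uniq s -> ell (restrict s a) = \sum_(x <- s) a x * ell (point x).
Proof.
elim: s => [_|x s ih /= /andP[xs us]].
  rewrite big_nil -(mul0r (ell (restrict [::] a))) -ellZ//; congr ell.
  by apply/funext => y; rewrite /restrict mul0r.
by rewrite big_cons restrict_cons// ellD// ellZ// ih.
Qed.

(** Multiplying the values of F z by phases does not increase the L^p1 norm and makes [ell] return
    the sum of the moduli. *)
Let point_sum_le z s : closed_strip z -> uniq s ->
  \sum_(x <- s) cabs (F z x) * cabs (ell (point x)) <= M * family_bound.
Proof.
move=> sz us; pose a x := phase (F z x * ell (point x)) * F z x.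
have E : ell (restrict s a) = (\sum_(x <- s) cabs (F z x) * cabs (ell (point x)))%:C%C.
  rewrite ell_restrict// rmorph_sum; apply: eq_bigr => x _.
  by rewrite /a -mulrA phaseM cabsM.
have : cabs (ell (restrict s a)) <= M * family_bound.
  apply: ell_norm => //; apply/(Lp_norm_le o alpha tree_e _ p1_gt0 bound_ge0).
  apply: le_trans (F_pow_sum sz); apply: le_wsum => x _.
  rewrite ge0_ler_powR ?nnegrE ?cabs_ge0 ?(ltW p1_gt0)// /restrict; case: ifP => _.
    by rewrite /a cabsM ler_piMl ?cabs_ge0// cabs_phase.
  by rewrite cabs0 cabs_ge0.
rewrite E cabs_real; apply: le_trans; exact: ler_norm.
Qed.

Definition point_coef j : C := oapp power_coef 0 (dec j).
Definition point_rate j : R := oapp power_rate 0 (dec j).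
Definition point_seq j : X -> C := oapp point (fun=> 0) (dec j).

(** 1 and exp(beta) are the moduli of the exponential at z = 0 and z = 1, so [point_sum_le] applies
    at these two points. *)
Lemma point_series_le n :
  \sum_(0 <= j < n) cabs (point_coef j * ell (point_seq j)) * (1 + expR (point_rate j)) <=
  M * family_bound + M * family_bound.
Proof.
rewrite (eq_bigr (fun j => oapp (fun x => cabs (F 0 x) * cabs (ell (point x)) +
    cabs (F 1 x) * cabs (ell (point x))) 0 (dec j))).
  rewrite vertex_sumE big_split /= lerD// point_sum_le// vertex_range_uniq//.
move=> j _; rewrite /point_coef /point_rate /point_seq; case: (dec j) => [x|] /=.
  rewrite /power_family !(cabsM, cabs_cexp, Re_realM) /= mulr0 mulr1 expR0; ring.
by rewrite mul0r cabs0 mul0r.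
Qed.

Lemma point_series_tends z : closed_strip z ->
  ctends (fun n => \sum_(0 <= j < n) point_coef j * ell (point_seq j) *
    cexp ((point_rate j)%:C%C * z)) (ell (F z)).
Proof.
move=> sz eps e0.
have M1 : 0 < M + 1 by rewrite ltr_wpDl.
pose d := eps / (M + 1); have d0 : 0 < d by rewrite divr_gt0.
have t0 x : 0 <= cabs (F z x) `^ p1 * w x by rewrite mulr_ge0 ?powR_ge0.
have dp : 0 < d `^ p1 by rewrite powR_gt0.
have [n0 hn0] := esum_outside_le countX t0 (F_pow_sum sz) dp.
exists n0 => n nn0.
have -> : \sum_(0 <= j < n) point_coef j * ell (point_seq j) * cexp ((point_rate j)%:C%C * z)
    = ell (restrict (vertex_range countX 0 n) (F z)).
  rewrite ell_restrict ?vertex_range_uniq// -vertex_sumE; apply: eq_bigr => j _.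
  rewrite /point_coef /point_rate /point_seq; case: (dec j) => [x|] /=; last by rewrite !mul0r.
  by rewrite /power_family mulrAC.
(* The part of F z not yet enumerated, small in L^p1; the error of the partial sum is [ell g]. *)
pose g x := if x \in vertex_range countX 0 n then 0 else F z x.
have gd : (Lp_norm mu p1%:E g <= d%:E)%E.
  apply/(Lp_norm_le o alpha tree_e _ p1_gt0 (ltW d0)).
  apply: le_trans (hn0 n nn0); rewrite [leRHS]esum_mkcond; apply: le_esum => x _.
  rewrite /g vertex_rangeP /=; case: ifPn => [xn|]; last first.
    by rewrite -leqNgt => xn; rewrite mem_set.
  by rewrite cabs0 powR0 ?gt_eqF// mul0r; case: ifP => _ //; rewrite lee_fin.
have gcar : fcarrier A g by rewrite /= (le_lt_trans gd)// ltry.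
have -> : ell (F z) = ell (restrict (vertex_range countX 0 n) (F z)) + ell g.
  rewrite -ellD//; congr ell.
  by apply/funext => x; rewrite /= /restrict /g; case: ifP => _; rewrite ?addr0 ?add0r.
rewrite opprD addNKr cabsN (le_trans (ell_norm (ltW d0) gd))//.
by rewrite /d mulrA ler_pdivrMr// mulrC ler_wpM2l ?(ltW e0)// lerDl.
Qed.

End functional.

Lemma power_family_interp :
  interp_family (Lp mu p1%:E) (BMO mu Dy) F /\
  (Fnorm (Lp mu p1%:E) (BMO mu Dy) F <= ((3 + 2 * V) * N)%:E)%E.
Proof.
have [z1 n1] := BMO_zero o q_ge2 tree_e alpha_gt1.
have nB f' : (0 <= fnorm (BMO mu Dy) f')%E by exact: BMO_norm_ge0.
have nL f' : (0 <= fnorm (Lp mu p1%:E) f')%E by exact: Lnorm_ge0.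
have bB (t : R) := bounded_BMO o q_ge2 tree_e alpha_gt1 (cabs_F1 t).
apply: (@exp_family _ _ _ _ _ _ point_coef point_rate point_seq).
- by move=> z /F_car; exact: sum_carrier_left.
- move=> ell hell; have [D Z _] := hell.
  have [M M0 hM] := functional_left nL nB z1 n1 hell.
  have sumL f' : fcarrier (Lp mu p1%:E) f' ->
      fcarrier (sum_space (Lp mu p1%:E) (BMO mu Dy)) f' by exact: sum_carrier_left.
  have ellD g h : fcarrier (Lp mu p1%:E) g -> fcarrier (Lp mu p1%:E) h ->
      ell (g \+ h) = ell g + ell h by move=> h1 h2; apply: D; exact: sumL.
  have ellZ a g : fcarrier (Lp mu p1%:E) g -> ell (fun x => a * g x) = a * ell g.
    by move=> h1; apply: Z; exact: sumL.
  split.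
    by exists (M * family_bound + M * family_bound) => n; exact: point_series_le.
  by move=> z; exact: (point_series_tends ellD ellZ M0 hM).
- move=> t; split; last exact: (bB t).1.
  by apply: F_car; rewrite /closed_strip /= lexx ler01.
- move=> t; split; last exact: (bB t).2.
  apply: (@le_trans _ _ N%:E).
    apply/(Lp_norm_le o alpha tree_e _ p1_gt0 N_ge0).
    apply: (@le_trans _ _ (wsum setT (fun x => N `^ p1 * r x `^ p)%R)).
      apply: le_wsum => x _.
      have -> : r x `^ p = (r x `^ (p / p1)) `^ p1 by rewrite -powRrM divfK ?gt_eqF.
      by rewrite -powRM ?powR_ge0// ge0_ler_powR ?nnegrE ?cabs_ge0 ?(ltW p1_gt0) ?mulr_ge0 ?powR_ge0.
    rewrite wsumZ ?powR_ge0//; last by move=> x; exact: powR_ge0.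
    by rewrite -[leRHS]mule1 lee_wpmul2l// lee_fin powR_ge0.
  rewrite lee_fin ler_peMl// (@le_trans _ _ 3)// ?ler1n// lerDl mulr_ge0// ltW//.
Qed.

End family_for_BMO.

Section upper_bound_BMO.
Context {R : realType} {X : pointedType}.
Variables (q : nat) (e : rel X) (o : X) (alpha : R).
Hypothesis q_ge2 : (2 <= q)%N.
Hypothesis tree_e : homogeneous_tree q e.
Hypothesis alpha_gt1 : 1 < alpha.
Local Notation mu := (tree_measure q e o alpha).
Local Notation Dy := (dyadic e o).

Lemma Lp_BMO_interp (theta p1 p : R) :
  0 < theta -> theta < 1 -> 1 < p1 -> p1 < p -> p^-1 = (1 - theta) / p1 ->
  exists2 K : R, 0 < K & forall f (N : R), 0 < N -> (Lp_norm mu p%:E f <= N%:E)%E ->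
  exists F, [/\ interp_family (Lp mu p1%:E) (BMO mu Dy) F, F theta%:C%C = f &
    (Fnorm (Lp mu p1%:E) (BMO mu Dy) F <= (K * N)%:E)%E].
Proof.
move=> t0 t1 p1_gt1 p1p pE; exists (3 + 2 * vol mu [set: X]).
  by rewrite ltr_wpDr// mulr_ge0// (vol_ge0 o q_ge2 tree_e alpha_gt1).
move=> f N N0 hf.
have [fam nF] := power_family_interp q_ge2 tree_e alpha_gt1 N0 p1_gt1 p1p hf.
exists (power_family f N p p1); split=> //.
exact: power_family_theta.
Qed.

End upper_bound_BMO.

(** * Summation by parts along geodesics *)

Section summation_by_parts.
Context {X : pointedType}.
Variables (q : nat) (e : rel X) (o : X).
Hypothesis tree_e : homogeneous_tree q e.
Implicit Types (x y v : X) (s : seq X).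

Local Notation pr := (pred_vertex e o).
Local Notation lev := (gdist e o).
Local Notation T := (sector e o).

Lemma ancestor_closure s : exists t : seq X,
  [/\ uniq t, {subset s <= t} & forall v, v \in t -> pr v \in t].
Proof.
pose anc y := [seq iter l pr y | l <- iota 0 (lev y).+1].
have ancP y l : iter l pr y \in anc y.
  have [ly|ly] := leqP l (lev y).
    by apply/mapP; exists l => //; rewrite mem_iota add0n.
  (* Iterates beyond the level of y stay at o, which is already in the list. *)
  apply/mapP; exists (lev y); first by rewrite mem_iota add0n ltnSn.
  by rewrite -(subnK (ltnW ly)) iterD (iter_pred_gdist o tree_e) (iter_pred_origin o tree_e).
exists (undup (flatten [seq anc y | y <- s])); split; first exact: undup_uniq.
  move=> y ys; rewrite mem_undup; apply/flatten_mapP; exists y => //.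
  exact: (ancP y 0%N).
move=> v; rewrite !mem_undup => /flatten_mapP[y ys /mapP[l _ ->]].
by apply/flatten_mapP; exists y => //; rewrite -iterS.
Qed.

Variables (t : seq X).
Hypothesis t_uniq : uniq t.
Hypothesis t_closed : forall v, v \in t -> pr v \in t.

(** Telescoping along the geodesic from y to o, whose vertices are exactly the v with y in T_v; they
    all lie in t because t is closed under predecessors. *)
Lemma sum_ancestors (V : zmodType) (f : X -> V) y : y \in t ->
  \sum_(v <- t | `[< T v y >]) (f v - (if v == o then 0 else f (pr v))) = f y.
Proof.
have [n] := ubnP (lev y); elim: n y => // n ih y; rewrite ltnS => yn yt.
have Tyy : `[< T y y >] = true by apply/asboolP; exact: sector_refl.
rewrite big_mkcond (bigD1_seq y yt t_uniq) /= Tyy.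
have [yo|yo] := eqVneq y o.
  rewrite subr0 big1 ?addr0// => v vy; case: asboolP => // -[l].
  by rewrite yo (iter_pred_origin o tree_e) => vo; rewrite -vo yo eqxx in vy.
have yo' : y <> o by apply/eqP.
have [_ ly] := pred_vertexP tree_e yo'.
rewrite (eq_bigr (fun v => if `[< T v (pr y) >] then
    f v - (if v == o then 0 else f (pr v)) else 0)); last first.
  move=> v vy; congr (if _ then _ else _); apply/asboolP/asboolP => -[l ev].
    case: l ev => [/= ev|l]; first by rewrite ev eqxx in vy.
    by rewrite iterSr; exists l.
  by exists l.+1; rewrite iterSr.
have := ih (pr y); rewrite -ltnS ly => /(_ yn (t_closed yt)).
have Typ : `[< T y (pr y) >] = false.
  by apply/asboolP => -[l] /(congr1 lev); rewrite (gdist_iter o tree_e); lia.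
by rewrite big_mkcond (bigD1_seq y yt t_uniq) /= Typ add0r => ->; rewrite subrK.
Qed.

(** Each x is the predecessor of at most q + 1 vertices other than o. *)
Lemma sum_pred_le (R : realType) (h : X -> R) : (forall x, 0 <= h x) ->
  \sum_(v <- t | v != o) h (pr v) <= q.+1%:R * \sum_(x <- t) h x.
Proof.
move=> h0; have E v : v \in t -> h (pr v) = \sum_(x <- t | pr v == x) h x.
  move=> vt; rewrite big_mkcond (bigD1_seq (pr v) (t_closed vt) t_uniq) /= eqxx.
  by rewrite big1 ?addr0// => x; rewrite eq_sym => /negbTE ->.
rewrite big_seq_cond (eq_bigr (fun v => \sum_(x <- t | pr v == x) h x)); last first.
  by move=> v /andP[/E].
rewrite -big_seq_cond (exchange_big_dep xpredT)//= mulr_sumr; apply: ler_sum => x _.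
rewrite -big_filter big_const_seq count_predT iter_addr_0 -[leLHS]mulr_natl.
rewrite ler_wpM2r// ler_nat (leq_trans _ (size_children o tree_e x))//.
apply: uniq_leq_size; first exact: filter_uniq.
by move=> v; rewrite mem_filter => /andP[/andP[/eqP vo /eqP vx] _]; apply/childrenP.
Qed.

End summation_by_parts.

(** * Lower bound for (L^p1, BMO) *)

Section lower_bound_BMO.
Context {R : realType} {X : pointedType}.
Variables (q : nat) (e : rel X) (o : X) (alpha : R).
Hypothesis q_ge2 : (2 <= q)%N.
Hypothesis tree_e : homogeneous_tree q e.
Hypothesis alpha_gt1 : 1 < alpha.
Local Notation C := R[i].
Implicit Types (x y v : X) (f : X -> C) (s : seq X).

Local Notation pr := (pred_vertex e o).
Local Notation w := (weight q e o alpha).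
Local Notation mu := (tree_measure q e o alpha).
Local Notation T := (sector e o).
Local Notation Dy := (dyadic e o).
Local Notation Cb := (BMO_diff_const q e o alpha).

Lemma Lp_BMO_interp_le (theta p1 p : R) :
  0 < theta -> theta < 1 -> 1 < p1 -> p1 < p -> p^-1 = (1 - theta) / p1 ->
  exists2 K : R, 0 < K & forall (F : C -> X -> C) (B : R), 0 < B ->
    interp_family (Lp mu p1%:E) (BMO mu Dy) F ->
    (Fnorm (Lp mu p1%:E) (BMO mu Dy) F <= B%:E)%E ->
    (Lp_norm mu p%:E (F theta%:C%C) <= (K * B)%:E)%E.
Proof.
move=> t0 t1 p1_gt1 p1p pE.
have w0 x : 0 <= w x by exact: weight_ge0.
have w_gt0 x : 0 < w x by exact: weight_gt0.
have p10 : 0 < p1 by rewrite (lt_trans ltr01).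
have p_gt1 : 1 < p by rewrite (lt_trans p1_gt1).
have p0 : 0 < p by rewrite (lt_trans ltr01).
have pm1 : 0 < p - 1 by rewrite subr_gt0.
(* The exponent conjugate to p. *)
have [P PE] : exists P, P = p / (p - 1) by exists (p / (p - 1)).
have P1 : 1 < P by rewrite PE ltr_pdivlMr// mul1r gtrBl.
have P0 : 0 < P by rewrite (lt_trans ltr01).
have Pp : (p - 1) * P = p by rewrite PE mulrC divfK// gt_eqF.
have PV : P^-1 = 1 - p^-1 by rewrite PE; field; rewrite !gt_eqF.
have [Kh Kh0 hardyP] := hardy o q_ge2 tree_e alpha_gt1 P1.
have Cb0 : 0 <= Cb by exact: BMO_diff_const_ge0.
(* The first two summands bound the pairing on Re z = 0, the last one on Re z = 1. *)
pose K := q.+2%:R + 2 * Kh + Kh * Cb.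
have K_ge : q.+2%:R + 2 * Kh <= K by rewrite lerDl mulr_ge0// ltW.
have K_ge' : Kh * Cb <= K by rewrite lerDr addr_ge0// mulr_ge0// ltW.
have K0 : 0 < K by rewrite (lt_le_trans _ K_ge)// ltr_wpDr// mulr_ge0// ltW.
exists K => // F B B0 hF FB.
have KB0 : 0 <= K * B by rewrite mulr_ge0// ltW.
apply: (Lp_norm_normalised tree_e p_gt1 KB0) => s r M us M0 r0.
set f := F theta%:C%C => fr sum1.
have [t [ut st tcl]] := ancestor_closure o tree_e s.
(* The modulus of the dual function, of norm 1 in L^P. Below, S v sums the dual function itself,
   with the phases of f, over T_v, and A v is the average that Hardy's inequality controls. *)
pose g y : R := if y \in s then r y `^ (p - 1) else 0.
have g0 y : 0 <= g y by rewrite /g; case: ifP => // _; exact: powR_ge0.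
pose S v : C := \sum_(y <- s | `[< T v y >]) phase (f y) * (r y `^ (p - 1) * w y)%:C%C.
pose A v : R := cabs (S v) / w v.
have A0 v : 0 <= A v by rewrite divr_ge0 ?cabs_ge0.
have SA v : cabs (S v) = A v * w v by rewrite divfK// gt_eqF.
have gw y : (0 <= (g y * w y)%:E)%E by rewrite lee_fin mulr_ge0.
have sumA : \sum_(v <- t) A v `^ P * w v <= Kh.
  rewrite -lee_fin -sumEFin.
  apply: (@le_trans _ _ (\esum_(v in [set: X]) (A v `^ P * w v)%:E)%E).
    by apply: sum_le_esum => // v; rewrite lee_fin mulr_ge0 ?powR_ge0.
  apply: le_trans (hardyP g A g0 A0 _) _ => [v|].
    rewrite -SA; apply: (@le_trans _ _ (\sum_(y <- [seq y <- s | `[< T v y >]]) (g y * w y)%:E)%E).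
      rewrite sumEFin lee_fin big_filter (le_trans (cabs_sum _ _ _))//.
      rewrite [leLHS]big_seq_cond [leRHS]big_seq_cond; apply: ler_sum => y /andP[ys _].
      rewrite cabsM cabs_real ger0_norm ?mulr_ge0 ?powR_ge0// /g ys.
      by rewrite ler_piMl ?cabs_phase// mulr_ge0 ?powR_ge0.
    apply: sum_le_esum => //; first exact: filter_uniq.
    by move=> y; rewrite mem_filter => /andP[/asboolP].
  rewrite -[leRHS]mule1 lee_wpmul2l ?lee_fin ?(ltW Kh0)//.
  have -> : 1%:E = (\esum_(y in [set` s]) (g y `^ P * w y)%:E)%E.
    rewrite esum_uniq_seq// => [|y]; last by rewrite lee_fin mulr_ge0 ?powR_ge0.
    rewrite sumEFin -sum1; congr (_%:E); rewrite !big_seq; apply: eq_bigr => y ys.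
    by rewrite /g ys -powRrM Pp.
  rewrite [leLHS](esumID [set` s])//; last by move=> y _; rewrite lee_fin mulr_ge0 ?powR_ge0.
  rewrite setTI setTI [X in (_ + X)%E]esum1 ?adde0// => y /= ys.
  by rewrite /g ifF ?powR0 ?gt_eqF ?mul0r//; apply/negP.
(* The power of A is phi0 + (P / p1) z, which vanishes at theta. With the factor A contained in S,
   the exponent of the modulus is P (1 - 1 / p1) on Re z = 0, which pairs with L^p1, and P on Re z =
   1, which pairs with bounded differences. *)
have [phi0 phi0E] : exists phi0, phi0 = P * (1 - p1^-1) - 1 by exists (P * (1 - p1^-1) - 1).
have Pq : 0 < P * (1 - p1^-1) by rewrite mulr_gt0// subr_gt0 invf_lt1.
have phi_theta : phi0 + P / p1 * theta = 0.
  have : P * P^-1 = 1 by rewrite mulfV ?gt_eqF.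
  rewrite PV pE => h; rewrite phi0E -[X in _ - X + _]h; ring.
pose co v : C := if A v == 0 then 0 else S v * (A v `^ phi0)%:C%C.
pose ra v : R := P / p1 * ln (A v).
pose d (z : C) v : C := F z v - (if v == o then 0 else F z (pr v)).
pose Phi z : C := \sum_(v <- t) co v * cexp ((ra v)%:C%C * z) * d z v.
have reg : strip_regular Phi.
  have ev x : strip_regular (fun z => F z x).
    apply: (eval_strip_regular _ _ _ _ hF).
    - by move=> ?; exact: Lnorm_ge0.
    - by move=> ?; exact: BMO_norm_ge0.
    - exact: Lp_eval_bounded.
    - exact: BMO_eval_bounded.
  apply: strip_regular_sum => v; apply: strip_regularM.
    by apply: strip_regularM; [exact: strip_regular_cst|exact: strip_regular_cexp].
  rewrite /d; case: eqP => _; apply: strip_regularD => //.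
    exact: strip_regular_cst.
  have -> : (fun z => - F z (pr v)) = (fun z => (-1) * F z (pr v)).
    by apply/funext => z; rewrite mulN1r.
  by apply: strip_regularM => //; exact: strip_regular_cst.
have coE z v : 0 <= complex.Re z -> cabs (co v * cexp ((ra v)%:C%C * z)) =
    A v `^ (P * (1 - p1^-1) + P / p1 * complex.Re z) * w v.
  move=> z0; have ex0 : 0 < P * (1 - p1^-1) + P / p1 * complex.Re z.
    by rewrite ltr_wpDr// mulr_ge0// divr_ge0// ltW.
  rewrite /co; case: eqP => [Av|/eqP Av].
    by rewrite mul0r cabs0 Av powR0 ?mul0r// gt_eqF.
  have {}Av : 0 < A v by rewrite lt_neqAle eq_sym Av A0.
  rewrite 2!cabsM cabs_real ger0_norm ?powR_ge0// cexp_ln// SA.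
  have -> : P * (1 - p1^-1) + P / p1 * complex.Re z = 1 + (phi0 + P / p1 * complex.Re z).
    by rewrite phi0E; ring.
  have nz (a b : R) : (a + b == 0) ==> (A v != 0) by rewrite (gt_eqF Av) implybT.
  by rewrite (powRD (nz 1 _)) (powRD (nz phi0 _)) powRr1//; ring.
have PhiM : Phi theta%:C%C = M%:C%C.
  have coS v : co v * cexp ((ra v)%:C%C * theta%:C%C) = S v.
    rewrite /co; case: eqP => [Av|/eqP Av].
      by rewrite mul0r; apply/esym/cabs_eq0; rewrite SA Av mul0r.
    have {}Av : 0 < A v by rewrite lt_neqAle eq_sym Av A0.
    rewrite cexp_ln_real// -mulrA -rmorphM -powRD ?phi_theta ?powRr0 ?mulr1//.
    by rewrite (gt_eqF Av) implybT.
  rewrite /Phi (eq_bigr (fun v => \sum_(y <- s | `[< T v y >])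
      phase (f y) * (r y `^ (p - 1) * w y)%:C%C * d theta%:C%C v)); last first.
    by move=> v _; rewrite coS mulr_suml.
  have -> : M%:C%C = \sum_(x <- s) (M * (r x `^ p * w x))%:C%C :> C.
    by rewrite -rmorph_sum -mulr_sumr sum1 mulr1.
  (* Summation by parts: for each y the differences at its ancestors add up to f y, which its phase
     turns into M r y. *)
  rewrite (exchange_big_dep xpredT)//=.
  rewrite big_seq [RHS]big_seq; apply: eq_bigr => y ys; rewrite -mulr_sumr.
  rewrite (sum_ancestors tree_e ut tcl f (st y ys)) mulrAC phaseM fr.
  by rewrite -rmorphM -(mulr_powRB1 (r0 y) p0) /=; congr (_%:C%C); ring.
suff : cabs (Phi theta%:C%C) <= K * B by rewrite PhiM cabs_real gtr0_norm.
have Phi_le z : 0 <= complex.Re z -> cabs (Phi z) <=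
    \sum_(v <- t) A v `^ (P * (1 - p1^-1) + P / p1 * complex.Re z) * w v * cabs (d z v).
  move=> z0; rewrite (le_trans (cabs_sum _ _ _))//; apply: ler_sum => v _.
  by rewrite cabsM coE.
apply: (three_lines reg) => // [z|z|]; last by rewrite /closed_strip /= !ltW.
- apply: le_trans (Phi_le _ _) _; rewrite /= ?lexx//.
  have /le_trans /(_ FB) h := (Fnorm_ge (Lp mu p1%:E) (BMO mu Dy) F z).1.
  have {}h := finite_sum_Lp_norm tree_e p10 (ltW B0) ut h.
  set Fz := F _ in h *.
  pose G v := cabs (Fz v) / B.
  have G0 v : 0 <= G v by rewrite divr_ge0 ?cabs_ge0// ltW.
  have FG v : cabs (Fz v) = B * G v by rewrite mulrC divfK// gt_eqF.
  have sumG : \sum_(v <- t) G v `^ p1 * w v <= 1.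
    rewrite (eq_bigr (fun v => B `^ (- p1) * (cabs (Fz v) `^ p1 * w v))).
      rewrite -mulr_sumr; apply: le_trans (ler_wpM2l (powR_ge0 _ _) h) _.
      by rewrite -powRD ?addNr ?powRr0// (gt_eqF B0) implybT.
    move=> v _; rewrite /G powRM ?cabs_ge0 ?invr_ge0 ?(ltW B0)// powRV ?(ltW B0)//; ring.
  (* Young's inequality for |F| / B and A^(P / p1); it is applied with x = v and with x the
     predecessor of v. *)
  have youngA v x : A v `^ (P * (1 - p1^-1)) * G x <= G x `^ p1 + A v `^ P.
    have := young_mul p1_gt1 (G0 x) (powR_ge0 (A v) (P / p1)).
    rewrite -!powRrM divfK ?gt_eqF// mulrC.
    by have -> : P / p1 * (p1 - 1) = P * (1 - p1^-1) by field; rewrite gt_eqF.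
  have term v : A v `^ (P * (1 - p1^-1) + P / p1 * 0) * w v * cabs (d (Complex 0 z) v) <=
      B * (G v `^ p1 * w v + (if v != o then G (pr v) `^ p1 * w (pr v) else 0) +
           2 * (A v `^ P * w v)).
    rewrite mulr0 addr0 /d.
    have AP : 0 <= A v `^ P * w v by rewrite mulr_ge0// powR_ge0.
    have first_ : A v `^ (P * (1 - p1^-1)) * w v * cabs (Fz v) <=
        B * (G v `^ p1 * w v + A v `^ P * w v).
      rewrite FG -mulrDl.
      have -> : A v `^ (P * (1 - p1^-1)) * w v * (B * G v) =
        B * (A v `^ (P * (1 - p1^-1)) * G v * w v) by ring.
      by rewrite ler_wpM2l ?(ltW B0)// ler_wpM2r.
    case: eqP => [vo|vo] /=.
      rewrite subr0 addr0; apply: le_trans first_ _.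
      by rewrite ler_wpM2l ?(ltW B0)// lerD2l ler_peMl// ler1n.
    have Aw : 0 <= A v `^ (P * (1 - p1^-1)) * w v by rewrite mulr_ge0// powR_ge0.
    apply: le_trans (ler_wpM2l Aw (cabsB _ _)) _; rewrite mulrDr.
    have second_ : A v `^ (P * (1 - p1^-1)) * w v * cabs (Fz (pr v)) <=
        B * (G (pr v) `^ p1 * w (pr v) + A v `^ P * w v).
      rewrite FG.
      have -> : A v `^ (P * (1 - p1^-1)) * w v * (B * G (pr v)) =
        B * (A v `^ (P * (1 - p1^-1)) * G (pr v) * w v) by ring.
      rewrite ler_wpM2l ?(ltW B0)//.
      apply: le_trans (ler_wpM2r (w0 v) (youngA v (pr v))) _; rewrite mulrDl lerD2r.
      by rewrite ler_wpM2l ?powR_ge0// weight_le_pred.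
    apply: le_trans (lerD first_ second_) _.
    by rewrite le_eqVlt; apply/orP; left; apply/eqP; ring.
  apply: (@le_trans _ _ (\sum_(v <- t) B * (G v `^ p1 * w v +
     (if v != o then G (pr v) `^ p1 * w (pr v) else 0) + 2 * (A v `^ P * w v)))).
    by apply: ler_sum => v _; exact: term.
  rewrite -mulr_sumr mulrC ler_wpM2r ?(ltW B0)//; apply: le_trans K_ge.
  rewrite 2!big_split /= -mulr_sumr -big_mkcond /=; apply: lerD; last by rewrite ler_wpM2l.
  have hG v : 0 <= G v `^ p1 * w v by rewrite mulr_ge0// powR_ge0.
  (* One unit for the values at the vertices themselves and q + 1 for those at their
     predecessors. *)
  rewrite -(natr1 q.+1) addrC; apply: lerD => //.
  apply: le_trans (sum_pred_le tree_e ut tcl hG) _.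
  by rewrite ler_piMr.
- apply: le_trans (Phi_le _ _) _; rewrite /= ?ler01//.
  have /le_trans /(_ FB) h := (Fnorm_ge (Lp mu p1%:E) (BMO mu Dy) F z).2.
  have -> : P * (1 - p1^-1) + P / p1 * 1 = P by ring.
  apply: (@le_trans _ _ (\sum_(v <- t) A v `^ P * w v * (Cb * B))).
    apply: ler_sum => v _; rewrite ler_wpM2l ?mulr_ge0 ?powR_ge0//.
    exact: (BMO_diff q_ge2 tree_e alpha_gt1 h).
  rewrite -mulr_suml mulrA ler_wpM2r ?(ltW B0)//; apply: le_trans K_ge'.
  by rewrite ler_wpM2r.
Qed.

End lower_bound_BMO.

Theorem theorem2 (R : realType) (q : nat) (X : pointedType) (e : rel X) (o : X)
    (alpha : R) :
  (2 <= q)%N -> homogeneous_tree q e -> 1 < alpha ->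
  let mu := tree_measure q e o alpha in
  (forall theta p1 p : R, 0 < theta -> theta < 1 -> 1 < p1 -> p1 < p ->
     p^-1 = (1 - theta) / p1 ->
     equivalent_spaces
       (interp (Lp mu p1%:E) (BMO mu (dyadic e o)) theta)
       (Lp mu p%:E)) /\
  (forall theta p p1 : R, 0 < theta -> theta < 1 -> 1 < p -> p < p1 ->
     p^-1 = 1 - theta + theta / p1 ->
     equivalent_spaces
       (interp (H1 mu (dyadic e o)) (Lp mu p1%:E) theta)
       (Lp mu p%:E)).
Proof.
move=> q_ge2 tree_e alpha_gt1 mu; split.
- move=> theta p1 p t0 t1 p1_gt1 p1p pE.
  have [K1 K10 upper] := Lp_BMO_interp o q_ge2 tree_e alpha_gt1 t0 t1 p1_gt1 p1p pE.
  have [K2 K20 lower] := Lp_BMO_interp_le o q_ge2 tree_e alpha_gt1 t0 t1 p1_gt1 p1p pE.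
  apply: (equivalent_spaces_intro K10 K20) => //.
  + by move=> f; exact: Lnorm_ge0.
  + by move=> f; exact: Lnorm_ge0.
- move=> theta p p1 t0 t1 p_gt1 pp1 pE.
  have [K1 K10 upper] := Lp_H1_interp o q_ge2 tree_e alpha_gt1 t0 t1 p_gt1 pp1 pE.
  (* Here [ltr0Sn R 1] fixes the constant of the lower bound to be 2. *)
  apply: (equivalent_spaces_intro K10 (ltr0Sn R 1)) => //.
  + by move=> f; exact: H1_norm_ge0.
  + by move=> f; exact: Lnorm_ge0.
  + move=> F M M0 hF; exact: (H1_Lp_interp_le q_ge2 tree_e alpha_gt1 t0 t1 p_gt1 pp1 pE M0 hF).
Qed.
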